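(* Let $\beta\in B$, and let $h\colon Z\to[0,+\infty)$ be $\mathcal Z$-measurable with $h(z)>0$ whenever $\beta'_+(z,0)=-\infty$, $z\in Z$. For every $a\in\mathrm{dom}(J_{[\beta h]})$ there exists a unique (up to $\mu$-a.e. equality) $\mathcal Z$-measurable function $\tilde g_{[\beta h],a}$ such that $$B_\beta(g,h)=J_{[\beta h]}(a)+B_{[\beta h]}(g,\tilde g_{[\beta h],a})+C_{[\beta h]}(g),\qquad g\in\mathcal G_a^+.$$ This function $\tilde g_{[\beta h],a}$ equals the effective dual solution $g^*_{F(a),[\beta h],a}$ of the $(F(a),[\beta h])$-dual problem for $a$.
   Context: Setting. $(Z,\mathcal Z)$ is a measurable space with a $\sigma$-finite measure $\mu$, and $\varphi\colon Z\to\mathbb R^d$ is $\mathcal Z$-measurable (the moment mapping). $\Gamma$ is the class of functions $\gamma\colon\mathbb R\to(-\infty,+\infty]$ that are finite and strictly convex on $(0,+\infty)$, equal to $+\infty$ for $t<0$, and satisfy $\gamma(0)=\lim_{t\downarrow0}\gamma(t)$. For $\gamma\in\Gamma$, $\gamma'_\pm(t)$ are the right/left derivatives at $t>0$, $\gamma'_-(0)=-\infty$, $\gamma'_+(0)=\lim_{t\downarrow0}\gamma'_+(t)$. $B$ is the class of functions $\beta\colon Z\times\mathbb R\to(-\infty,+\infty]$ such that $\beta(\cdot,t)$ is $\mathcal Z$-measurable for each $t$ and $\beta(z,\cdot)\in\Gamma$ for each $z$; $\beta'_\pm(z,t)$ refer to $\beta(z,\cdot)$. $\mathrm{sgn}(r)$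 is the symbol $+$ if $r\ge0$ and $-$ if $r<0$. Convention: an integral whose positive and negative parts are both infinite equals $+\infty$. Bregman distance. For $\gamma\in\Gamma$ and $s,t\ge0$ let $\Delta_\gamma(s,t)=\gamma(s)-\gamma(t)-\gamma'_{\mathrm{sgn}(s-t)}(t)[s-t]$ if $\gamma'_+(t)$ is finite, and $\Delta_\gamma(s,0)=s\cdot(+\infty)$ otherwise (with $0\cdot\infty=0$); $\Delta_\gamma(s,t)=+\infty$ if $s<0$ or $t<0$. For any $\alpha\in B$ and $\mathcal Z$-measurable $g,k$: $B_\alpha(g,k)=\int_Z\Delta_{\alpha(z,\cdot)}(g(z),k(z))\,\mu(dz)$. For $h$ as in the claim, $[\beta h](z,t)=\Delta_{\beta(z,\cdot)}(t,h(z))$; then $[\beta h]\in B$, and $B_{[\beta h]}$ is the Bregman distance with $\alpha=[\beta h]$. $\mathcal G$ is the linear space of $\mathcal Z$-measurable $g\colon Z\to\mathbb R$ with $\varphi g$ $\mu$-integrable; $\mathcal G_a=\{g\in\mathcal G\colon\int_Z\varphi g\,d\mu=a\}$; the superscript $+$ denotes the subset of nonnegative functions. $J_{[\beta h]}(a)=\inf_{g\in\mathcal G_a^+}B_\beta(g,h)\in[0,+\infty]$ ($\inf\emptyset=+\infty$), $\mathrm{dom}(J_{[\beta h]})=\{a\in\mathbb R^d\colon J_{[\beta h]}(a)<+\infty\}$. Faces. $\mathrm{cn}_\varphi(\mu)=\{\int_Z\varphi g\,d\mu\colon g\in\mathcal G^+\}$. A face of a convex set $C\subseteq\mathbb R^d$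 is a nonempty convex $F\subseteq C$ such that every closed line segment in $C$ with a relative interior point in $F$ lies in $F$. For $a\in\mathrm{cn}_\varphi(\mu)$, $F(a)$ is the unique face of $\mathrm{cn}_\varphi(\mu)$ whose relative interior contains $a$. $\mathrm{cl}$ is closure. $(F,[\beta h])$-dual problem. Write $\beta_h=[\beta h]$ and $\beta_h^*(z,r)=\sup_t[rt-\beta_h(z,t)]$, with derivative $(\beta_h^* )'$ in $r$. For a face $F$ of $\mathrm{cn}_\varphi(\mu)$: $K_{F,[\beta h]}(\vartheta)=\int_{\{\varphi\in\mathrm{cl}(F)\}}\beta_h^*(z,\langle\vartheta,\varphi(z)\rangle)\,\mu(dz)$; $(F,[\beta h])$-dual solutions for $a$ are the maximizers of $\vartheta\mapsto\langle\vartheta,a\rangle-K_{F,[\beta h]}(\vartheta)$ when the supremum is finite (for $a\in\mathrm{dom}(J_{[\beta h]})$ and $F=F(a)$ they exist). $\Theta_{F,[\beta h]}$ is the set of $\vartheta$ with $K_{F,[\beta h]}(\vartheta)<+\infty$ such that for $\mu$-a.a. $z$ with $\varphi(z)\in\mathrm{cl}(F)$ the function $\beta_h^*(z,\cdot)$ is finite in a neighborhood of $\langle\vartheta,\varphi(z)\rangle$; it always contains $0$. For $\vartheta\in\Theta_{F,[\beta h]}$, $f_{F,[\beta h],\vartheta}(z)=(\beta_h^* )'(z,\langle\vartheta,\varphi(z)\rangle)$ if $\varphi(z)\in\mathrm{cl}(F)$ and the derivative exists, and $0$ otherwise. All $(F,[\beta h])$-dual solutions for $a$ belong to $\Theta_{F,[\beta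 h]}$ and give $\mu$-a.e. the same $f_{F,[\beta h],\vartheta}$, called the effective dual solution $g^*_{F,[\beta h],a}$. Correction functional. For $a\in\mathrm{dom}(J_{[\beta h]})$ and $g\in\mathcal G_a^+$, with $F=F(a)$ and $\vartheta$ any $(F(a),[\beta h])$-dual solution for $a$, writing $f=f_{F(a),[\beta h],\vartheta}$, $$C_{[\beta h]}(g)=\int_{\{\varphi\in\mathrm{cl}(F(a))\}}\big[(\beta_h)'_{\mathrm{sgn}(g(z)-f(z))}(z,f(z))-\langle\vartheta,\varphi(z)\rangle\big]\,[g(z)-f(z)]\,\mu(dz);$$ the integrand is nonnegative $\mu$-a.e. and the value does not depend on the choice of $\vartheta$. *)

(* Defs.v *)
From HB Require Import structures.
From mathcomp Require Import all_boot all_order all_algebra.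
From mathcomp Require Import all_classical all_reals all_analysis.
From mathcomp Require Import measurable_realfun.

Set Implicit Arguments.
Unset Strict Implicit.
Unset Printing Implicit Defensive.
Import Order.TTheory GRing.Theory Num.Theory.
Import numFieldNormedType.Exports.

Local Open Scope classical_set_scope.
Local Open Scope ring_scope.

Section Gamma.
Context {R : realType}.
Implicit Types (gamma u : R -> \bar R) (s t r : R).

Record in_Gamma gamma : Prop := {
  Gamma_gtNy : forall t, (-oo < gamma t)%E ;
  Gamma_fin : forall t, 0 < t -> gamma t \is a fin_num ;
  Gamma_strictly_convex : forall s t l, 0 < s -> 0 < t -> s != t ->
    0 < l -> l < 1 ->
    (gamma (l * s + (1 - l) * t)%R <
     l%:E * gamma s + (1 - l)%:E * gamma t)%E ;
  Gamma_neg : forall t, t < 0 -> gamma t = +oo%E ;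
  Gamma_cvg0 : gamma t @[t --> 0^'+] --> gamma 0
}.

Definition diff_quot gamma t e : R := e^-1 * (fine (gamma (t + e)) - fine (gamma t)).

(* The value at t < 0, where gamma is infinite, is arbitrary. *)
Definition rderiv gamma t : \bar R :=
  if 0 < t then (lim (diff_quot gamma t e @[e --> 0^'+]))%:E
  else if t == 0 then
    lim ((lim (diff_quot gamma u e @[e --> 0^'+]))%:E @[u --> 0^'+])
  else -oo%E.

Definition lderiv gamma t : \bar R :=
  if 0 < t then (lim (diff_quot gamma t e @[e --> 0^'-]))%:E else -oo%E.

Definition sgn_deriv gamma r t : \bar R :=
  if 0 <= r then rderiv gamma t else lderiv gamma t.

Definition Delta gamma s t : \bar R :=
  (if ((s < 0) || (t < 0))%R then +oo
   else if rderiv gamma t \is a fin_num then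
     gamma s - gamma t - sgn_deriv gamma (s - t)%R t * (s - t)%:E
   else s%:E * +oo)%E.

Definition conjugate gamma r : \bar R :=
  ereal_sup (range (fun t : R => ((r * t)%:E - gamma t)%E)).

Definition ederivable u r : Prop :=
  (\forall s \near r, u s \is a fin_num) /\ derivable (fine \o u) r 1.

Definition ederive1 u r : R := derive1 (fine \o u) r.

End Gamma.

Section Faces.
Context {R : realType} {d : nat}.
Notation V := 'rV[R]_d.
Implicit Types (C F : set V) (x y a : V).

Definition dotp x y : R := \sum_(i < d) x 0 i * y 0 i.

Definition segment x y : set V :=
  range (fun l : {i01 R} => conv l (x : convex_lmodType V) y).

Definition affine_hull C : set V :=
  [set x | exists n (p : 'I_n -> V) (l : 'I_n -> R),
    [/\ forall i, C (p i), \sum_(i < n) l i = 1 &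
        x = \sum_(i < n) l i *: p i]].

Definition relative_interior C : set V :=
  [set x | C x /\ \forall y \near x, affine_hull C y -> C y].

Definition is_face C F : Prop :=
  [/\ F !=set0, convex_set (F : set (convex_lmodType V)), F `<=` C &
    forall x y, segment x y `<=` C ->
      relative_interior (segment x y) `&` F !=set0 -> segment x y `<=` F].

(* F(a), which exists and is unique when C is convex and a is in C. *)
Definition face_of_point C a : set V :=
  xget set0 [set F | is_face C F /\ relative_interior F a].

End Faces.

Section Bregman.
Context {R : realType} {disp : measure_display} {Z : measurableType disp}.
Variable mu : {measure set Z -> \bar R}.
Implicit Types (alpha beta : Z -> R -> \bar R) (g h k : Z -> R).

Definition in_B beta : Prop :=
  (forall t, measurable_fun [set: Z] (beta ^~ t)) /\
  (forall z, in_Gamma (beta z)).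

(* In the extended reals +oo - +oo is -oo; here an integral whose positive and
   negative parts are both infinite must be +oo. *)
Definition cintegral (D : set Z) (f : Z -> \bar R) : \bar R :=
  if (\int[mu]_(z in D) f^\+ z == +oo)%E then +oo%E
  else (\int[mu]_(z in D) f z)%E.

Definition bregman alpha g k : \bar R :=
  cintegral [set: Z] (fun z => Delta (alpha z) (g z) (k z)).

Definition recenter beta h : Z -> R -> \bar R :=
  fun z t => Delta (beta z) t (h z).

Section Moments.
Context {d : nat}.
Notation V := 'rV[R]_d.
Variable phi : Z -> V.
Implicit Types (a theta : V) (F : set V).

Definition in_G g : Prop :=
  measurable_fun [set: Z] g /\
  forall i, mu.-integrable [set: Z] (fun z => (phi z 0 i * g z)%:E).

Definition moment g : V := \row_i \int[mu]_z (phi z 0 i * g z).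

Definition Gplus : set (Z -> R) := [set g | in_G g /\ forall z, 0 <= g z].

Definition Gplus_at a : set (Z -> R) := [set g | Gplus g /\ moment g = a].

Definition moment_cone : set V := moment @` Gplus.

Definition value_J beta h a : \bar R :=
  ereal_inf [set bregman beta g h | g in Gplus_at a].

Definition domJ beta h : set V := [set a | (value_J beta h a < +oo)%E].

Definition on_closure F : set Z := [set z | closure F (phi z)].

Definition face_at a : set V := face_of_point moment_cone a.

(* In the rest of this section alpha stands for [beta h]. *)
Definition dual_K F alpha theta : \bar R :=
  cintegral (on_closure F) (fun z => conjugate (alpha z) (dotp theta (phi z))).

Definition dual_objective F alpha a theta : \bar R :=
  ((dotp theta a)%:E - dual_K F alpha theta)%E.

Definition dual_value F alpha a : \bar R :=
  ereal_sup (range (dual_objective F alpha a)).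

Definition dual_solution F alpha a theta : Prop :=
  dual_value F alpha a \is a fin_num /\
  dual_objective F alpha a theta = dual_value F alpha a.

Definition dual_density F alpha theta : Z -> R := fun z =>
  let r := dotp theta (phi z) in
  if `[< on_closure F z /\ ederivable (conjugate (alpha z)) r >]
  then ederive1 (conjugate (alpha z)) r else 0.

(* The correction functional, computed from the dual solution theta. *)
Definition correction F alpha theta g : \bar R :=
  let f := dual_density F alpha theta in
  cintegral (on_closure F) (fun z =>
    ((sgn_deriv (alpha z) (g z - f z)%R (f z) - (dotp theta (phi z))%:E) *
     (g z - f z)%:E)%E).

End Moments.
End Bregman.

(* Main.v *)
Require Import Defs.
From HB Require Import structures.
From mathcomp Require Import all_boot all_order all_algebra.
From mathcomp Require Import all_classical all_reals all_analysis.
From mathcomp Require Import measurable_realfun.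
From mathcomp Require Import ring lra.

Set Implicit Arguments.
Unset Strict Implicit.
Unset Printing Implicit Defensive.
Import Order.TTheory GRing.Theory Num.Theory.
Import numFieldNormedType.Exports.

Local Open Scope classical_set_scope.
Local Open Scope ring_scope.

(* The problem is reduced to the integrand alpha = [beta h], which is nonnegative
   and vanishes at h. Every g in G_a^+ vanishes a.e. off M = {phi in cl F(a)}, so
   off M the values are common to all g. On M, separating the epigraph of the
   value function (on the moments of densities of finite value) from its point
   over a gives a dual solution theta; properness of the separation and the
   relative interior position of a exclude a vertical hyperplane, and an
   interchange of supremum and integral gives equality of the primal and dual
   values. Hence the value of g exceeds the optimum by the integral of the defect
   alpha*(r) - (r g - alpha(g)), r = <theta, phi>, in Young's inequality. Along a
   minimizing sequence with summable excess this defect tends to 0 a.e., and by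
   strict convexity the sequence converges a.e. to the maximizer f of
   r t - alpha(t), where alpha* is differentiable with derivative f. Since r is
   a subgradient of alpha at f, the defect is the sum of Delta_alpha(g, f) and of
   the correction integrand, both nonnegative. *)

(** * Functions of the class Gamma *)

Section OneSidedDerivatives.
Context {R : realType}.
Implicit Types (gamma : R -> \bar R) (s t r c l : R).

(** The infimum need not be attained, so [f] may lie outside the class of [a] and the identity
    cannot come from perturbing a minimizer: a pointwise identity is integrated against a dual
    solution instead. The face enters because [a] may lie on the boundary of the moment cone, where
    a separating hyperplane could be vertical. A vanishing defect does not by itself control the
    minimizing sequence: if [r] is an end point of the domain of the conjugate, the sequence could
    escape to infinity. Fatou's lemma bounds [alpha] along a subsequence at almost every point, and
    the growth of [alpha] away from its minimizer [h] then bounds that subsequence.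
    Differentiability of the conjugate at [r] is a consequence and not an assumption: it follows
    from an attained maximum and strict convexity. The sequence is chosen before [theta], so all
    dual solutions share one density. *)

Lemma Gamma_EFin gamma t : in_Gamma gamma -> 0 < t -> gamma t = (fine (gamma t))%:E.
Proof. by move=> G t0; rewrite fineK// (Gamma_fin G). Qed.

(** Strict convexity with weight [(w - y) / (w - x)], cleared of denominators so that later
    estimates are linear in the values of [gamma]. *)
Lemma Gamma_chord gamma x y w : in_Gamma gamma -> 0 < x -> x < y -> y < w ->
  fine (gamma y) * (w - x) < fine (gamma x) * (w - y) + fine (gamma w) * (y - x).
Proof.
move=> G x0 xy yw.
have y0 : 0 < y := lt_trans x0 xy.
have w0 : 0 < w := lt_trans y0 yw.
have xw := lt_trans xy yw.
have wx : 0 < w - x by rewrite subr_gt0.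
have := @Gamma_strictly_convex _ _ G x w ((w - y) / (w - x)) x0 w0.
rewrite (lt_eqF xw) => /(_ isT).
rewrite divr_gt0 ?subr_gt0// => /(_ isT).
rewrite ltr_pdivrMr// mul1r ltrD2l ltrN2 xy => /(_ isT).
have -> : (w - y) / (w - x) * x + (1 - (w - y) / (w - x)) * w = y.
  by field; rewrite gt_eqF.
rewrite (Gamma_EFin G x0) (Gamma_EFin G w0) (Gamma_EFin G y0) lte_fin.
rewrite -(ltr_pM2r wx) => /lt_le_trans; apply.
rewrite le_eqVlt; apply/orP; left; apply/eqP; field.
by rewrite gt_eqF.
Qed.

Lemma diff_quotE gamma t s :
  diff_quot gamma t (s - t) = (fine (gamma s) - fine (gamma t)) / (s - t).
Proof. by rewrite /diff_quot [t + _]addrC subrK mulrC. Qed.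

(** The signs of [e] and [e'] fix the order of [t], [t + e], [t + e']; for each of the three orders
    this is [Gamma_chord] for that triple. *)
Lemma diff_quot_lt gamma t e e' : in_Gamma gamma -> 0 < t -> - t < e -> e < e' ->
  e != 0 -> e' != 0 -> diff_quot gamma t e < diff_quot gamma t e'.
Proof.
move=> G t0 te ee' e0 e'0; rewrite /diff_quot.
have te0 : 0 < t + e by lra.
have te'0 : 0 < t + e' by lra.
have [ep|en|/eqP] := ltgtP 0 e; last by rewrite eq_sym (negbTE e0).
  have e'p : 0 < e' := lt_trans ep ee'.
  have := @Gamma_chord gamma t (t + e) (t + e') G t0.
  rewrite ltrDl ep => /(_ isT); rewrite ltrD2l ee' => /(_ isT) H.
  rewrite ltr_pdivrMl// mulrCA ltr_pdivlMl//.
  lra.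
have [e'p|e'n|/eqP] := ltgtP 0 e'; last by rewrite eq_sym (negbTE e'0).
  have := @Gamma_chord gamma (t + e) t (t + e') G te0.
  rewrite gtrDl en => /(_ isT); rewrite ltrDl e'p => /(_ isT) H.
  have -> : forall x : R, e^-1 * x = - ((- e)^-1 * x).
    by move=> x; rewrite invrN mulNr opprK.
  rewrite ltrNl ltr_pdivlMl ?oppr_gt0// mulrN mulrCA ltrNl ltr_pdivlMl//.
  lra.
have := @Gamma_chord gamma (t + e) (t + e') t G te0.
rewrite ltrD2l ee' gtrDl e'n => /(_ isT isT) H.
have -> : forall x : R, e^-1 * x = - ((- e)^-1 * x).
  by move=> x; rewrite invrN mulNr opprK.
have -> : forall x : R, e'^-1 * x = - ((- e')^-1 * x).
  by move=> x; rewrite invrN mulNr opprK.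
rewrite ltrN2 ltr_pdivlMl ?oppr_gt0// mulrCA ltr_pdivrMl ?oppr_gt0//.
lra.
Qed.

(** Difference quotients increase with the increment, so the right derivative is their infimum over
    positive increments, bounded below by any quotient with a negative increment. Comparing with the
    quotient at half the increment makes the supporting line strict. *)
Lemma rderivP gamma t : in_Gamma gamma -> 0 < t -> exists D : R,
  [/\ rderiv gamma t = D%:E, diff_quot gamma t e @[e --> 0^'+] --> D &
   forall s, 0 < s -> s != t ->
     fine (gamma t) + D * (s - t) < fine (gamma s)].
Proof.
move=> G t0; set q := diff_quot gamma t.
pose I := [set` `]0%R, +oo[ ] : set R.
have qlt e e' : - t < e -> e < e' -> e != 0 -> e' != 0 -> q e < q e'.
  exact: diff_quot_lt.
have lbq x : - t < x -> x < 0 -> lbound (q @` I) (q x).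
  move=> tx x0 ? [e]; rewrite /I /= in_itv/= andbT => e0 <-.
  by have xe := lt_trans x0 e0; rewrite ltW// qlt//; [rewrite lt_eqF|rewrite gt_eqF].
have ht : - t < - (t / 2) /\ - (t / 2) < 0 by split; lra.
have hl : has_lbound (q @` I) by exists (q (- (t / 2))); apply: lbq; case: ht.
have cq : q e @[e --> 0^'+] --> inf (q @` I).
  apply: nondecreasing_at_right_cvgr => // x y; rewrite !in_itv/= !andbT => x0 y0.
  by rewrite le_eqVlt => /predU1P[->//|xy]; apply/ltW/qlt => //; [|apply: lt0r_neq0..]; lra.
exists (inf (q @` I)); split => //.
  by rewrite /rderiv t0; congr EFin; apply: cvg_lim.
move=> s s0 st; have [lst|gst] : s < t \/ t < s.
  by case: (ltgtP s t) st; [left|right|].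
- have : q ((s - t) / 2) <= inf (q @` I).
    apply: lb_le_inf; last by apply: lbq; lra.
    by exists (q 1), 1 => //; rewrite /I /= in_itv/= ltr01.
  have : q (s - t) < q ((s - t) / 2) by apply: qlt; [| |apply: ltr0_neq0..]; lra.
  move=> /lt_le_trans/[apply].
  by rewrite /q diff_quotE ltr_ndivrMr; lra.
- have : inf (q @` I) <= q ((s - t) / 2).
    apply: ge_inf => //; exists ((s - t) / 2) => //.
    by rewrite /I /= in_itv/= andbT; lra.
  have : q ((s - t) / 2) < q (s - t) by apply: qlt; [| |apply: lt0r_neq0..]; lra.
  move=> qq /le_lt_trans/(_ qq).
  by rewrite /q diff_quotE ltr_pdivlMr; lra.
Qed.

Lemma lderivP gamma t : in_Gamma gamma -> 0 < t -> exists D : R,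
  [/\ lderiv gamma t = D%:E, diff_quot gamma t e @[e --> 0^'-] --> D &
   forall s, 0 < s -> s != t ->
     fine (gamma t) + D * (s - t) < fine (gamma s)].
Proof.
move=> G t0; set q := diff_quot gamma t; pose p e := q (- e).
pose I := [set` `]0%R, t[ ] : set R.
have qlt e e' : - t < e -> e < e' -> e != 0 -> e' != 0 -> q e < q e'.
  exact: diff_quot_lt.
have ubp x : 0 < x -> ubound (p @` I) (q x).
  move=> x0 ? [e]; rewrite /I /= in_itv/= => /andP[e0 et] <-.
  apply/ltW/qlt; [| |apply: ltr0_neq0|apply: lt0r_neq0]; lra.
have hu : has_ubound (p @` I) by exists (q 1); apply: ubp.
have cq : q e @[e --> 0^'-] --> sup (p @` I).
  apply/cvg_at_leftNP; rewrite oppr0.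
  apply: nonincreasing_at_right_cvgr => //.
  move=> x y; rewrite !in_itv/= => /andP[x0 tx] /andP[y0 ty].
  rewrite le_eqVlt => /predU1P[->//|xy]; rewrite /p.
  by apply/ltW/qlt; [| |apply: ltr0_neq0..]; lra.
exists (sup (p @` I)); split => //.
  by rewrite /lderiv t0; congr EFin; apply: cvg_lim.
have Im x : - t < x -> x < 0 -> (p @` I) (q x).
  move=> tx x0; exists (- x); last by rewrite /p opprK.
  by rewrite /I /= in_itv/=; lra.
move=> s s0 st; have [lst|gst] : s < t \/ t < s.
  by case: (ltgtP s t) st; [left|right|].
- have : q ((s - t) / 2) <= sup (p @` I).
    by apply: ub_le_sup => //; apply: Im; lra.
  have : q (s - t) < q ((s - t) / 2) by apply: qlt; [| |apply: ltr0_neq0..]; lra.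
  move=> /lt_le_trans/[apply].
  by rewrite /q diff_quotE ltr_ndivrMr; lra.
- have : sup (p @` I) <= q ((s - t) / 2).
    apply: ge_sup; last by apply: ubp; lra.
    by exists (q (- (t / 2))); apply: Im; lra.
  have : q ((s - t) / 2) < q (s - t) by apply: qlt; [| |apply: lt0r_neq0..]; lra.
  move=> qq /le_lt_trans/(_ qq).
  by rewrite /q diff_quotE ltr_pdivlMr; lra.
Qed.

End OneSidedDerivatives.

Section StrictSubgradients.
Context {R : realType}.
Implicit Types (gamma : R -> \bar R) (s t r c l : R).

(** The value at 0 is known only as a right limit, possibly [+oo], so bounds at 0 have to come from
    affine bounds on an interval []0, e[]. *)
Lemma Gamma_ge_at0 gamma a b e : in_Gamma gamma -> 0 < e ->
  (forall s, 0 < s -> s < e -> a + b * s <= fine (gamma s)) ->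
  (a%:E <= gamma 0%R)%E.
Proof.
move=> G e0 H; apply/lee_addgt0Pr => d d0; rewrite -leeBlDr//.
apply: (cvge_to_ge (Gamma_cvg0 G)); near=> s.
have s0 : 0 < s by near: s; exact: nbhs_right_gt.
have se : s < e by near: s; exact: nbhs_right_lt.
have b0 : 0 < `|b| + 1 by rewrite ltr_wpDl.
have sd : s < d / (`|b| + 1) by near: s; apply: nbhs_right_lt; rewrite divr_gt0.
rewrite (Gamma_EFin G s0) -EFinB lee_fin; apply: le_trans (H s s0 se).
rewrite lerD2l lerNl.
move: sd; rewrite ltr_pdivlMr// => sd; apply: ltW; apply: le_lt_trans sd.
have nb : - b <= `|b| by rewrite -normrN ler_norm.
by nra.
Unshelve. all: by end_near. Qed.

Lemma Gamma_le_at0 gamma a b e : in_Gamma gamma -> 0 < e ->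
  (forall s, 0 < s -> s < e -> fine (gamma s) <= a + b * s) ->
  (gamma 0%R <= a%:E)%E.
Proof.
move=> G e0 H; apply/lee_addgt0Pr => d d0.
apply: (cvge_to_le (Gamma_cvg0 G)); near=> s.
have s0 : 0 < s by near: s; exact: nbhs_right_gt.
have se : s < e by near: s; exact: nbhs_right_lt.
have b0 : 0 < `|b| + 1 by rewrite ltr_wpDl.
have sd : s < d / (`|b| + 1) by near: s; apply: nbhs_right_lt; rewrite divr_gt0.
rewrite (Gamma_EFin G s0) -EFinD lee_fin; apply: le_trans (H s s0 se) _.
rewrite lerD2l.
move: sd; rewrite ltr_pdivlMr// => sd; apply: ltW; apply: le_lt_trans sd.
have nb : b <= `|b| by rewrite ler_norm.
by nra.
Unshelve. all: by end_near. Qed.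

(** A passage to the limit at 0 would lose strictness. At 0 the supporting line at [t / 2] lies
    strictly above the given line through the point at [t], and for it a weak inequality in the
    limit suffices. *)
Lemma strict_minorant_at0 gamma t D : in_Gamma gamma -> 0 < t ->
  (forall s, 0 < s -> s != t -> fine (gamma t) + D * (s - t) < fine (gamma s)) ->
  ((fine (gamma t) + D * (0 - t))%:E < gamma 0%R)%E.
Proof.
move=> G t0 H; have t20 : 0 < t / 2 by rewrite divr_gt0.
have [E [_ _ HE]] := rderivP G t20.
have tt2 : t / 2 != t by rewrite lt_eqF//; lra.
have h1 := H (t / 2) t20 tt2.
have h2 := HE t t0; rewrite eq_sym tt2 in h2; have {}h2 := h2 isT.
apply: (@lt_le_trans _ _ (fine (gamma (t / 2)) + E * (0 - t / 2))%:E).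
  rewrite lte_fin; lra.
apply: (@Gamma_ge_at0 _ _ E (t / 2)) => // s s0 st.
have := HE s s0; rewrite lt_eqF// => /(_ isT); lra.
Qed.

Definition strict_subgradient gamma t D :=
  forall s, 0 <= s -> s != t -> ((fine (gamma t) + D * (s - t))%:E < gamma s)%E.

Lemma strict_subgradientP gamma t D : in_Gamma gamma -> 0 < t ->
  (forall s, 0 < s -> s != t -> fine (gamma t) + D * (s - t) < fine (gamma s)) ->
  strict_subgradient gamma t D.
Proof.
move=> G t0 H s; rewrite le_eqVlt => /predU1P[<- _|s0 st].
  exact: strict_minorant_at0.
by rewrite (Gamma_EFin G s0) lte_fin H.
Qed.

Lemma rderiv_subgradient gamma t : in_Gamma gamma -> 0 < t ->
  exists2 D, rderiv gamma t = D%:E & strict_subgradient gamma t D.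
Proof.
move=> G t0; have [D [? _ H]] := rderivP G t0.
by exists D => //; apply: strict_subgradientP.
Qed.

Lemma lderiv_subgradient gamma t : in_Gamma gamma -> 0 < t ->
  exists2 D, lderiv gamma t = D%:E & strict_subgradient gamma t D.
Proof.
move=> G t0; have [D [? _ H]] := lderivP G t0.
by exists D => //; apply: strict_subgradientP.
Qed.

Lemma rderiv_nondecreasing gamma s t : in_Gamma gamma -> 0 < s -> s <= t ->
  (rderiv gamma s <= rderiv gamma t)%E.
Proof.
move=> G s0; rewrite le_eqVlt => /predU1P[->//|st].
have t0 : 0 < t := lt_trans s0 st.
have [D [-> _ HD]] := rderivP G s0; have [E [-> _ HE]] := rderivP G t0.
have := HD t t0; rewrite gt_eqF// => /(_ isT) h1.
have := HE s s0; rewrite lt_eqF// => /(_ isT) h2.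
have : D * (t - s) < E * (t - s) by lra.
by rewrite ltr_pM2r ?subr_gt0// => /ltW.
Qed.

(** Monotonicity of the right derivative makes the [lim] that defines [rderiv gamma 0] a genuine
    limit, possibly [-oo]. *)
Lemma rderiv0_cvg gamma : in_Gamma gamma ->
  rderiv gamma u @[u --> 0^'+] --> rderiv gamma 0.
Proof.
move=> G; rewrite [X in _ --> X]/rderiv ltxx eqxx.
pose f (u : R) := (lim (diff_quot gamma u e @[e --> 0^'+]))%:E.
have fE u : 0 < u -> rderiv gamma u = f u by rewrite /rderiv => ->.
have cf : f u @[u --> 0^'+] --> ereal_inf (f @` [set` `]0%R, +oo[]).
  apply: nondecreasing_at_right_cvge => // x y.
  rewrite !in_itv/= !andbT => x0 y0 xy.
  by rewrite -!fE//; exact: rderiv_nondecreasing.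
rewrite -/f (cvg_lim _ cf)//; apply: cvg_trans cf; apply: near_eq_cvg.
by near=> u; rewrite fE//; near: u; exact: nbhs_right_gt.
Unshelve. all: by end_near. Qed.

Lemma rderiv0_le gamma t : in_Gamma gamma -> 0 < t ->
  (rderiv gamma 0%R <= rderiv gamma t)%E.
Proof.
move=> G t0; apply: (cvge_to_le (rderiv0_cvg G)); near=> u.
have u0 : 0 < u by near: u; exact: nbhs_right_gt.
have ut : u <= t by near: u; exact: nbhs_right_le.
exact: rderiv_nondecreasing.
Unshelve. all: by end_near. Qed.

(** The supporting line at [u > 0] has slope at least [D]; letting [u] tend to 0 bounds [gamma 0] by
    [gamma s - D s]. Using this bound at [s / 2] gives strictness. *)
Lemma rderiv0_fin gamma D : in_Gamma gamma -> rderiv gamma 0 = D%:E ->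
  gamma 0 \is a fin_num /\ strict_subgradient gamma 0 D.
Proof.
move=> G D0.
have HD s u : 0 < u -> u < s -> fine (gamma u) + D * (s - u) < fine (gamma s).
  move=> u0 us; have s0 := lt_trans u0 us.
  have [E [EE _ HE]] := rderivP G u0.
  have := HE s s0; rewrite gt_eqF// => /(_ isT); apply: le_lt_trans.
  have DE : D <= E by have := rderiv0_le G u0; rewrite D0 EE lee_fin.
  by rewrite lerD2l ler_wpM2r// subr_ge0 ltW.
have h s : 0 < s -> (gamma 0%R <= (fine (gamma s) - D * s)%:E)%E.
  move=> s0; apply: (@Gamma_le_at0 _ _ D s) => // u u0 us.
  by have := HD s u u0 us; lra.
have g0 : gamma 0 \is a fin_num.
  by rewrite fin_numE gt_eqF ?(Gamma_gtNy G)//= lt_eqF// (le_lt_trans (h 1 ltr01))// ltry.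
split => // s s0 sn0; have {s0 sn0}s0 : 0 < s by rewrite lt_neqAle eq_sym sn0.
have s20 : 0 < s / 2 by rewrite divr_gt0.
have ss2 : s / 2 < s by lra.
have := h _ s20; rewrite -(fineK g0) (Gamma_EFin G s0) lte_fin lee_fin /= => {}h.
by have := HD _ _ s20 ss2; lra.
Qed.
End StrictSubgradients.

(** * Bregman distances and linear growth away from a point of contact *)

Section BregmanDistance.
Context {R : realType}.
Implicit Types (gamma : R -> \bar R) (s t r c l e f D : R).

Lemma Gamma_cvg_right gamma t : in_Gamma gamma -> 0 <= t ->
  gamma s @[s --> t^'+] --> gamma t.
Proof.
move=> G; rewrite le_eqVlt => /predU1P[<-|t0]; first exact: Gamma_cvg0.
have [D [_ _ HD]] := rderivP G t0.
rewrite [X in _ --> X](Gamma_EFin G t0); apply: cvg_EFin.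
  near=> s; apply: (Gamma_fin G); apply: lt_trans t0 _.
  by near: s; exact: nbhs_right_gt.
(* To the right of [t], increments are bounded below with slope [D] and above with the slope [C] of
   the chord to [t + 1]; hence the Lipschitz constant [L]. *)
pose C := fine (gamma (t + 1)) - fine (gamma t).
pose L := `|D| + `|C| + 1.
have L0 : 0 < L by rewrite /L ltr_wpDl// addr_ge0.
apply/cvgrPdist_le => e e0; near=> s.
have ts : t < s by near: s; exact: nbhs_right_gt.
have st1 : s < t + 1 by near: s; apply: nbhs_right_lt; rewrite ltrDl.
have se : s < t + e / L by near: s; apply: nbhs_right_lt; rewrite ltrDl divr_gt0.
have s0 : 0 < s := lt_trans t0 ts.
have h1 := HD s s0; rewrite gt_eqF// in h1; have {}h1 := h1 isT.
have h2 := Gamma_chord G t0 ts st1.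
have : (s - t) * L < e by rewrite -ltr_pdivlMr// ltrBlDl.
have hD : - `|D| <= D by rewrite lerNl -normrN ler_norm.
have hC := ler_norm C; have C0 := normr_ge0 C; have D0 := normr_ge0 D.
have h3 : fine (gamma s) < fine (gamma t) + C * (s - t) by rewrite /C; lra.
rewrite /L /= ler_norml => h; apply/andP; split; nra.
Unshelve. all: by end_near. Qed.

(** For [t > 0] both one-sided derivatives are strict subgradients; at [t = 0] the increment is
    nonnegative and selects the right one. *)
Lemma sgn_derivP gamma s t : in_Gamma gamma -> 0 <= s -> 0 <= t ->
  rderiv gamma t \is a fin_num ->
  exists D, [/\ sgn_deriv gamma (s - t) t = D%:E, gamma t \is a fin_num &
    s != t -> ((fine (gamma t) + D * (s - t))%:E < gamma s)%E].
Proof.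
move=> G s0; rewrite le_eqVlt => /predU1P[<-|t0] fr.
  rewrite subr0 /sgn_deriv s0 -(fineK fr).
  have [|g0 H] := @rderiv0_fin _ gamma (fine (rderiv gamma 0)) G.
    by rewrite fineK.
  exists (fine (rderiv gamma 0)); split => // sn0.
  by have := H s s0 sn0; rewrite subr0.
have gt : gamma t \is a fin_num by exact: (Gamma_fin G).
rewrite /sgn_deriv; case: ifPn => _.
  by have [D -> H] := rderiv_subgradient G t0; exists D; split => // /(H s s0).
by have [D -> H] := lderiv_subgradient G t0; exists D; split => // /(H s s0).
Qed.

Lemma Delta_neg gamma s t : s < 0 -> Delta gamma s t = +oo%E.
Proof. by move=> s0; rewrite /Delta s0. Qed.

Lemma DeltaE gamma s t : 0 <= s -> 0 <= t -> rderiv gamma t \is a fin_num ->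
  Delta gamma s t =
    (gamma s - gamma t - sgn_deriv gamma (s - t)%R t * (s - t)%:E)%E.
Proof. by move=> s0 t0 fr; rewrite /Delta !ltNge s0 t0/= fr. Qed.

Lemma rderiv_fin gamma t : in_Gamma gamma -> 0 < t ->
  rderiv gamma t \is a fin_num.
Proof. by move=> G /(rderiv_subgradient G)[D ->]. Qed.

Lemma Delta_diag gamma s : in_Gamma gamma -> 0 <= s -> Delta gamma s s = 0%E.
Proof.
move=> G s0; have [fr|] := boolP (rderiv gamma s \is a fin_num).
  have [D [sD gs _]] := sgn_derivP G s0 s0 fr.
  by rewrite DeltaE// sD subrr mule0 sube0 subee.
rewrite /Delta !ltNge s0/= => nf; rewrite (negbTE nf).
have [->|sn0] := eqVneq s 0; first by rewrite mul0e.
by case/negP: nf; apply: rderiv_fin => //; rewrite lt_neqAle eq_sym sn0.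
Qed.

Lemma Delta_gt0 gamma s t : in_Gamma gamma -> 0 <= s -> 0 <= t -> s != t ->
  (0 < Delta gamma s t)%E.
Proof.
move=> G s0 t0 st; have [fr|] := boolP (rderiv gamma t \is a fin_num).
  have [D [sD gt /(_ st)]] := sgn_derivP G s0 t0 fr.
  rewrite DeltaE// sD -(fineK gt) -EFinM /=.
  case: (gamma s) => [x| |]//=.
  - by rewrite -!EFinB !lte_fin => h; lra.
  - by rewrite !addye// ltry.
rewrite /Delta !ltNge s0 t0/= => nf; rewrite (negbTE nf).
have [tE|tn0] := eqVneq t 0; last first.
  by case/negP: nf; apply: rderiv_fin => //; rewrite lt_neqAle eq_sym tn0.
rewrite gt0_muley ?ltry// lte_fin lt_neqAle s0 andbT eq_sym.
by rewrite -tE.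
Qed.

Lemma Delta_ge0 gamma s t : in_Gamma gamma -> (0 <= Delta gamma s t)%E.
Proof.
move=> G; have [s0|s0] := ltP s 0; first by rewrite Delta_neg.
have [t0|t0] := ltP t 0; first by rewrite /Delta t0 orbT.
have [->|st] := eqVneq s t; first by rewrite Delta_diag.
exact/ltW/Delta_gt0.
Qed.

(** By strict convexity a supporting line at [f + e / 2] has slope [E > D]. Beyond [f + e] at least
    half of [t - f] is travelled past [f + e / 2], which leaves the surplus slope
    [m = (E - D) / 2]. *)
Lemma Gamma_growth_right gamma f D e : in_Gamma gamma -> 0 <= f -> 0 < e ->
  gamma f \is a fin_num ->
  (forall s, f <= s -> ((fine (gamma f) + D * (s - f))%:E <= gamma s)%E) ->
  exists2 m, 0 < m & forall t, f + e <= t ->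
    ((fine (gamma f) + D * (t - f) + m * (t - f))%:E <= gamma t)%E.
Proof.
move=> G f0 e0 gf H; pose p := f + e / 2.
have p0 : 0 < p by rewrite /p; lra.
have [E _ HE] := lderiv_subgradient G p0.
have fp : f != p by rewrite lt_eqF// /p; lra.
have := HE f f0 fp; rewrite -(fineK gf) lte_fin => h1.
have := H p; rewrite (Gamma_EFin G p0) lee_fin.
have fp' : f <= p by rewrite /p; lra.
move=> /(_ fp') h2.
have h3 : (E - D) * (e / 2) > 0 by rewrite /p in h1 h2 *; lra.
have ED : E - D > 0 by move: h3; rewrite pmulr_lgt0//; lra.
exists ((E - D) / 2) => [|t ft]; first by lra.
have tp : t != p by rewrite gt_eqF// /p; lra.
have t0 : 0 <= t by lra.
apply: le_trans (ltW (HE t t0 tp)); rewrite lee_fin.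
by rewrite /p in h1 h2 *; nra.
Qed.

Lemma Gamma_growth_left gamma f D e : in_Gamma gamma -> 0 <= f -> 0 < e ->
  gamma f \is a fin_num ->
  (forall s, 0 <= s -> s <= f -> ((fine (gamma f) + D * (s - f))%:E <= gamma s)%E) ->
  exists2 m, 0 < m & forall t, 0 <= t -> t <= f - e ->
    ((fine (gamma f) + D * (t - f) + m * (f - t))%:E <= gamma t)%E.
Proof.
move=> G f0 e0 gf H; pose p := f - e / 2.
have [p0|p0] := leP p 0.
  by exists 1 => // t t0 tf; rewrite /p in p0; exfalso; lra.
have [E _ HE] := rderiv_subgradient G p0.
have fp : f != p by rewrite gt_eqF// /p; lra.
have := HE f f0 fp; rewrite -(fineK gf) lte_fin => h1.
have fp' : p <= f by rewrite /p; lra.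
have := H p (ltW p0) fp'; rewrite (Gamma_EFin G p0) lee_fin => h2.
have h3 : (D - E) * (e / 2) > 0 by rewrite /p in h1 h2 *; lra.
have ED : D - E > 0 by move: h3; rewrite pmulr_lgt0//; lra.
exists ((D - E) / 2) => [|t t0 ft]; first by lra.
have tp : t != p by rewrite lt_eqF// /p; lra.
apply: le_trans (ltW (HE t t0 tp)); rewrite lee_fin.
by rewrite /p in h1 h2 *; nra.
Qed.

Lemma Gamma_growth gamma f D e : in_Gamma gamma -> 0 <= f -> 0 < e ->
  gamma f \is a fin_num ->
  (forall s, 0 <= s -> ((fine (gamma f) + D * (s - f))%:E <= gamma s)%E) ->
  exists2 m, 0 < m & forall t, 0 <= t -> e <= `|t - f| ->
    ((fine (gamma f) + D * (t - f) + m * `|t - f|)%:E <= gamma t)%E.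
Proof.
move=> G f0 e0 gf H.
have [|m m0 Hm] := @Gamma_growth_right gamma f D e G f0 e0 gf.
  by move=> s fs; apply: H; lra.
have [|n n0 Hn] := @Gamma_growth_left gamma f D e G f0 e0 gf.
  by move=> s s0 _; exact: H.
exists (Num.min m n) => [|t t0]; first by rewrite lt_min m0.
have mm : Num.min m n <= m by rewrite ge_min lexx.
have nn : Num.min m n <= n by rewrite ge_min lexx orbT.
have [tf|tf] := lerP f t.
- move=> et.
  have ft : f + e <= t by lra.
  apply: le_trans (Hm t ft); rewrite lee_fin lerD2l.
  by rewrite ler_wpM2r ?subr_ge0.
- move=> et.
  have ft : t <= f - e by lra.
  apply: le_trans (Hn t t0 ft); rewrite lee_fin lerD2l.
  by rewrite ler_wpM2r ?subr_ge0// ltW.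
Qed.
End BregmanDistance.

(** * Attainment in the conjugate and its differentiability *)

Section ConjugateTheory.
Context {R : realType}.
Implicit Types (gamma : R -> \bar R) (s t r c l e f D : R).

(** [Delta] subtracts different slopes on the two sides of [k], hence the two one-sided growth
    estimates. If the right derivative at [k] is infinite, then [k = 0] and [Delta] is [+oo] at
    every positive argument. The bound turns [Delta] tending to 0 into convergence to [k]. *)
Lemma Delta_growth gamma k e : in_Gamma gamma -> 0 <= k -> 0 < e ->
  exists2 m, 0 < m & forall t, 0 <= t -> e <= `|t - k| ->
    ((m * e)%:E <= Delta gamma t k)%E.
Proof.
move=> G k0 e0; have [fr|nf] := boolP (rderiv gamma k \is a fin_num); last first.
  have kE : k = 0.
    by apply/eqP; apply: contraNT nf => kn0; apply: rderiv_fin => //; rewrite lt_neqAle eq_sym kn0.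
  exists 1 => // t t0; rewrite kE subr0 ger0_norm// => et.
  rewrite /Delta !ltNge t0 lexx/= -kE (negbTE nf) gt0_muley ?leey// lte_fin.
  exact: lt_le_trans et.
have [Dr [DrE gk Hr]] := sgn_derivP G k0 k0 fr.
have {}DrE : rderiv gamma k = Dr%:E by move: DrE; rewrite subrr /sgn_deriv lexx.
have subR s : k <= s -> ((fine (gamma k) + Dr * (s - k))%:E <= gamma s)%E.
  move=> ks; have s0 : 0 <= s by lra.
  have [->|sk] := eqVneq s k; first by rewrite subrr mulr0 addr0 fineK.
  have [D [sD _ /(_ sk)/ltW]] := sgn_derivP G s0 k0 fr.
  by move: sD; rewrite /sgn_deriv subr_ge0 ks DrE => -[->].
have [m m0 Hm] := Gamma_growth_right G k0 e0 gk subR.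
have [n n0 Hn] : exists2 n, 0 < n & forall t, 0 <= t -> t <= k - e ->
    ((n * (k - t))%:E <= Delta gamma t k)%E.
  have [kp|kn] := ltP 0 k; last first.
    by exists 1 => // t t0 tk; exfalso; lra.
  have [D DE HD] := lderiv_subgradient G kp.
  have [|n n0 Hn] := @Gamma_growth_left _ gamma k D e G k0 e0 gk.
    move=> s s0 sk; have [->|nsk] := eqVneq s k; first by rewrite subrr mulr0 addr0 fineK.
    exact/ltW/HD.
  exists n => // t t0 tk; rewrite DeltaE// /sgn_deriv ifF; last first.
    by apply/negbTE; rewrite -ltNge; lra.
  rewrite DE -(fineK gk); move: (Hn t t0 tk); case: (gamma t) => [x| |]//=.
    by rewrite -!EFinD !lee_fin; lra.
  by move=> _; rewrite leey.
exists (Num.min m n) => [|t t0]; first by rewrite lt_min m0.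
have mm : Num.min m n <= m by rewrite ge_min lexx.
have nn : Num.min m n <= n by rewrite ge_min lexx orbT.
have mn0 : 0 < Num.min m n by rewrite lt_min m0.
have [tf|tf] := lerP k t => et.
- have ft : k + e <= t by lra.
  rewrite DeltaE// /sgn_deriv subr_ge0 tf DrE -(fineK gk).
  move: (Hm t ft); case: (gamma t) => [x| |]//=.
    by rewrite -!EFinD !lee_fin; nra.
  by move=> _; rewrite leey.
- have ft : t <= k - e by lra.
  by apply: le_trans (Hn t t0 ft); rewrite lee_fin; nra.
Qed.

(** Compactness by a supremum: [S] collects the [x] beyond which approximate solutions of
    [gamma t <= r t + c] exist for every tolerance, so such solutions accumulate at [f = sup S].
    Lower semicontinuity at [f] concludes; it comes from a supporting line if [f > 0] and from the
    right limit if [f = 0]. *)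
Lemma Gamma_minimizer gamma r c B : in_Gamma gamma ->
  (forall e, 0 < e -> exists t, [/\ 0 <= t, t <= B &
     (gamma t <= (r * t + c + e)%:E)%E]) ->
  exists2 f, 0 <= f & (gamma f <= (r * f + c)%:E)%E.
Proof.
move=> G H.
pose S := [set x | 0 <= x /\ forall e, 0 < e -> exists t, [/\ x <= t, t <= B &
     (gamma t <= (r * t + c + e)%:E)%E]].
have S0 : S 0 by split.
have Sb : ubound S B by move=> x [_ /(_ 1 ltr01)[t [xt tB _]]]; exact: le_trans tB.
have hS : has_sup S by split; [exists 0|exists B].
set f := sup S.
have f0 : 0 <= f by apply: ub_le_sup => //; case: hS.
have near_inf (d e : R) : 0 < d -> 0 < e -> exists t, [/\ 0 <= t, `|t - f| <= d &
     (gamma t <= (r * t + c + e)%:E)%E].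
  move=> d0 e0.
  have [e1 [e10 He1]] : exists e1, 0 < e1 /\ forall t, f + d <= t -> t <= B ->
      ~ (gamma t <= (r * t + c + e1)%:E)%E.
    apply: contrapT => /forallNP K.
    suff : S (f + d) by move=> /(ub_le_sup (proj2 hS)); rewrite -/f; lra.
    split => [|e' e'0]; first by lra.
    have := K e' => /not_andP[//|/existsNP[t /not_implyP[ft /not_implyP[tB /contrapT gt]]]].
    by exists t.
  have [x [x0 Sx] xf] : exists2 x, S x & f - d < x by apply: sup_adherent.
  have [t [xt tB gt]] := Sx (Num.min e e1) ltac:(by rewrite lt_min e0).
  have mi1 : Num.min e e1 <= e by rewrite ge_min lexx.
  have mi2 : Num.min e e1 <= e1 by rewrite ge_min lexx orbT.
  have gt1 : (gamma t <= (r * t + c + e1)%:E)%E.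
    by apply: le_trans gt _; rewrite lee_fin lerD2l.
  have tfd : t <= f + d.
    by rewrite leNgt; apply/negP => ft; apply: (He1 t _ tB gt1); exact: ltW.
  exists t; split; first exact: le_trans x0 xt.
    by rewrite ler_norml; apply/andP; split; lra.
  by apply: le_trans gt _; rewrite lee_fin lerD2l.
exists f => //; apply/lee_addgt0Pr => e e0; rewrite -EFinD.
have [fp|fn] := ltP 0 f.
  have [D _ HD] := rderiv_subgradient G fp.
  have L0 : 0 < `|D - r| + 1 by rewrite ltr_wpDl.
  have e20 : 0 < e / 2 by lra.
  have d0 : 0 < e / 2 / (`|D - r| + 1) by rewrite divr_gt0.
  have [t [t0 td gt]] := near_inf _ _ d0 e20.
  have tp : ((fine (gamma f) + D * (t - f))%:E <= gamma t)%E.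
    have [->|tf] := eqVneq t f; last exact/ltW/HD.
    by rewrite subrr mulr0 addr0 -Gamma_EFin.
  have := le_trans tp gt; rewrite (Gamma_EFin G fp) !lee_fin => h.
  rewrite ler_pdivlMr// in td.
  have h1 : `|D - r| * `|t - f| <= e / 2 by have := normr_ge0 (t - f); nra.
  have : - ((D - r) * (t - f)) <= e / 2.
    by apply: le_trans h1; rewrite -normrM -normrN ler_norm.
  lra.
have {fn}f0' : f = 0 by apply/eqP; rewrite eq_le fn.
rewrite f0' mulr0 add0r leNgt; apply/negP => hgt.
have cg : \forall s \near 0^'+, ((c + e)%:E < gamma s)%E.
  exact: (Gamma_cvg0 G (open_ereal_gt' hgt)).
have [d d0 Hd] : exists2 d, 0 < d & forall s, 0 <= s -> s < d -> ((c + e)%:E < gamma s)%E.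
  have [d/= d0 Hd] := cg; exists d => // s; rewrite le_eqVlt => /predU1P[<-//|s0] sd.
  by apply: Hd => //=; rewrite sub0r normrN gtr0_norm.
have L0 : 0 < `|r| + 1 by rewrite ltr_wpDl.
have d'0 : 0 < Num.min (d / 2) (e / 2 / (`|r| + 1)).
  by rewrite lt_min !divr_gt0.
have e20 : 0 < e / 2 by lra.
have [t [t0]] := near_inf _ _ d'0 e20.
rewrite f0' subr0 ger0_norm// le_min => /andP[td te] gt.
have td' : t < d by lra.
have := lt_le_trans (Hd t t0 td') gt; rewrite lte_fin => h.
rewrite ler_pdivlMr// in te; have := ler_norm r => h1.
nra.
Qed.

Lemma conjugate_ge gamma r t : ((r * t)%:E - gamma t <= conjugate gamma r)%E.
Proof. by apply: ereal_sup_ubound; exists t. Qed.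

Section Maximizer.
Variables (gamma : R -> \bar R) (r f : R).
Hypotheses (G : in_Gamma gamma) (f0 : 0 <= f) (gf : gamma f \is a fin_num).
Hypothesis fmax : forall s, 0 <= s ->
  ((fine (gamma f) + r * (s - f))%:E <= gamma s)%E.

Lemma conjugate_le q c : (forall s, 0 <= s -> ((q * s - c)%:E <= gamma s)%E) ->
  (conjugate gamma q <= c%:E)%E.
Proof.
move=> H; apply: ge_ereal_sup => _ [t _ <-].
have [t0|t0] := ltP t 0; first by rewrite (Gamma_neg G t0)/= leNye.
have := H t t0; have := Gamma_gtNy G t; case: (gamma t) => [x| |]//= _; last by rewrite leNye.
by rewrite -EFinB !lee_fin => h; lra.
Qed.

Lemma conjugate_max : conjugate gamma r = (r * f - fine (gamma f))%:E.
Proof.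
apply/eqP; rewrite eq_le; apply/andP; split.
  apply: conjugate_le => s s0; apply: le_trans (fmax s0).
  by rewrite lee_fin; lra.
by apply: le_trans (conjugate_ge gamma r f); rewrite EFinB fineK.
Qed.

(** At distance at least [e] from [f] the growth [m |s - f|] beats the tilt [(q - r) (s - f)];
    closer to [f] the tilt gains at most [e |q - r|]. So near [r] the conjugate is finite and
    squeezed onto an affine function of slope [f]. *)
Lemma conjugate_near e : 0 < e -> exists2 m, 0 < m & forall q, `|q - r| <= m ->
  ((q * f - fine (gamma f))%:E <= conjugate gamma q)%E /\
  (conjugate gamma q <= (q * f - fine (gamma f) + e * `|q - r|)%:E)%E.
Proof.
move=> e0; have [m m0 Hm] := Gamma_growth G f0 e0 gf fmax.
exists m => // q qm; split.
  by apply: le_trans (conjugate_ge gamma q f); rewrite EFinB fineK.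
apply: conjugate_le => s s0.
have n1 : (q - r) * (s - f) <= `|q - r| * `|s - f| by rewrite -normrM ler_norm.
have [es|es] := leP e `|s - f|.
  by apply: le_trans (Hm s s0 es); rewrite lee_fin; nra.
by apply: le_trans (fmax s0); rewrite lee_fin; have := normr_ge0 (q - r); nra.
Qed.

Lemma conjugate_derivable :
  ederivable (conjugate gamma) r /\ ederive1 (conjugate gamma) r = f.
Proof.
have c1 : (fun h => h^-1 *: ((fine \o conjugate gamma) (h + r) -
   (fine \o conjugate gamma) r)) @ 0^' --> f.
  apply/cvgrPdist_le => e e0; have [m m0 Hm] := conjugate_near e0.
  near=> h.
  have h0 : h != 0 by near: h; exact: nbhs_dnbhs_neq.
  have hm : `|h| <= m.
    near: h; apply: dnbhs0_le.
    done.
  have := Hm (h + r); rewrite addrK => /(_ hm) /=; rewrite conjugate_max/=.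
  case: (conjugate gamma (h + r)) => [x| |]//=; rewrite ?leye_eq ?leeNy_eq; try by case.
  rewrite !lee_fin => -[h1 h2].
  have hn : 0 < `|h| by rewrite normr_gt0.
  rewrite -(ler_pM2r hn) -normrM mulrBl /GRing.scale/= mulrAC mulVf// mul1r.
  rewrite ler_norml; apply/andP; split; nra.
have d1 : derivable (fine \o conjugate gamma) r 1.
  apply/cvg_ex; exists f; apply: cvg_trans c1; apply: near_eq_cvg.
  by near=> h; rewrite /= [h%:A]mulr1.
split; last first.
  by rewrite /ederive1 /derive1; apply/cvg_lim.
split => //; have [m m0 Hm] := conjugate_near ltr01.
near=> q; have qm : `|q - r| <= m.
  by near: q; exists m => //= q /ltW; rewrite distrC.
by have [] := Hm q qm; case: (conjugate gamma q) => [x| |]//=;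
  rewrite ?leye_eq ?leeNy_eq.
Unshelve. all: by end_near. Qed.

End Maximizer.

End ConjugateTheory.

(** * One-sided sequences and the positive rationals *)

Section SequentialLimits.
Context {R : realType}.

Lemma seq_cvg_at_right (p : R) (v : nat -> R) : (forall n, p < v n) ->
  v n @[n --> \oo] --> p -> v n @[n --> \oo] --> p^'+.
Proof.
move=> pv vp P /vp vP; have {}vP : \forall n \near \oo, p < v n -> P (v n) by [].
by apply: filterS vP => n /(_ (pv n)).
Qed.

Lemma seq_cvg_at_left (p : R) (v : nat -> R) : (forall n, v n < p) ->
  v n @[n --> \oo] --> p -> v n @[n --> \oo] --> p^'-.
Proof.
move=> pv vp P /vp vP; have {}vP : \forall n \near \oo, v n < p -> P (v n) by [].
by apply: filterS vP => n /(_ (pv n)).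
Qed.

Lemma harmonic_at_right : harmonic n @[n --> \oo] --> (0 : R)^'+.
Proof. by apply: seq_cvg_at_right => [n|]; [exact: harmonic_gt0|exact: cvg_harmonic]. Qed.

Lemma harmonicN_at_left : - harmonic n @[n --> \oo] --> (0 : R)^'-.
Proof.
apply: seq_cvg_at_left => [n|]; first by rewrite oppr_lt0 harmonic_gt0.
by rewrite -oppr0; apply: cvgN; exact: cvg_harmonic.
Qed.

(** Enumerates the positive rationals with repetitions, so that suprema over [t] become countable;
    an index that decodes to no pair is sent to 1. *)
Definition posrat (n : nat) : R :=
  if (unpickle n : option (nat * nat)) is Some p then p.1.+1%:R / p.2.+1%:R else 1.

Lemma posrat_gt0 n : 0 < posrat n.
Proof. by rewrite /posrat; case: unpickle => [p|//]; rewrite divr_gt0. Qed.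

Lemma posrat_dense (x y : R) : 0 <= x -> x < y -> exists n, x < posrat n /\ posrat n < y.
Proof.
move=> x0 xy; have yx : 0 < y - x by rewrite subr_gt0.
pose j := Num.truncn (y - x)^-1; pose i := Num.truncn (x * j.+1%:R).
have /andP[_ jy] : (j%:R <= (y - x)^-1 < j.+1%:R).
  by apply: Num.Theory.truncn_itv; rewrite invr_ge0 ltW.
have /andP[i1 i2] : (i%:R <= x * j.+1%:R < i.+1%:R).
  by apply: Num.Theory.truncn_itv; rewrite mulr_ge0.
exists (pickle (i, j)); rewrite /posrat pickleK /=; split.
  by rewrite ltr_pdivlMr.
rewrite ltr_pdivrMr// -addn1 natrD.
have : 1 < (y - x) * j.+1%:R by rewrite mulrC -ltr_pdivrMr// div1r.
lra.
Qed.

End SequentialLimits.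

(** * Recentering at [k] stays in the class Gamma *)

Section RecenteredGamma.
Context {R : realType}.
Implicit Types (gamma : R -> \bar R) (k s t : R).

Lemma Delta_fin gamma k t : in_Gamma gamma -> 0 <= k ->
  rderiv gamma k \is a fin_num -> 0 < t -> Delta gamma t k \is a fin_num.
Proof.
move=> G k0 fr t0; have [D [DE gk _]] := sgn_derivP G (ltW t0) k0 fr.
rewrite DeltaE//; last exact: ltW.
by rewrite DE (Gamma_EFin G t0) -(fineK gk).
Qed.

(** On each side of [k] the function is [gamma] minus an affine function, and strict convexity is
    inherited there. If [k] separates [s] and [t], the chord from [k], where the value is 0, to the
    end point on the side of the intermediate point already gives the bound; the other end point
    contributes a nonnegative term. *)
Lemma Delta_Gamma gamma k : in_Gamma gamma -> 0 <= k ->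
  rderiv gamma k \is a fin_num -> in_Gamma (Delta gamma ^~ k).
Proof.
move=> G k0 fr.
have [Dr [DrE gk _]] := sgn_derivP G k0 k0 fr.
have {}DrE : rderiv gamma k = Dr%:E by move: DrE; rewrite subrr /sgn_deriv lexx.
have DR t : k <= t -> 0 < t ->
    fine (Delta gamma t k) = fine (gamma t) - fine (gamma k) - Dr * (t - k).
  move=> kt t0; rewrite DeltaE// ?(ltW t0)// /sgn_deriv subr_ge0 kt DrE.
  by rewrite (Gamma_EFin G t0) -(fineK gk).
have [Dl DL] : exists Dl, forall t, t <= k -> 0 < t ->
    fine (Delta gamma t k) = fine (gamma t) - fine (gamma k) - Dl * (t - k).
  have [kp|kn] := ltP 0 k; last by exists 0 => t tk t0; exfalso; lra.
  have [D DE _] := lderiv_subgradient G kp; exists D => t.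
  rewrite le_eqVlt => /predU1P[-> _|tk t0]; first by rewrite Delta_diag// !subrr mulr0 subr0.
  rewrite DeltaE// ?(ltW t0)// /sgn_deriv subr_ge0 leNgt tk/= DE.
  by rewrite (Gamma_EFin G t0) -(fineK gk).
pose u t := fine (Delta gamma t k).
have u0 t : 0 <= u t by rewrite fine_ge0// Delta_ge0.
have up t : 0 < t -> t != k -> 0 < u t.
  move=> t0 tk; rewrite /u -lte_fin fineK ?Delta_fin//.
  by apply: Delta_gt0 => //; exact: ltW.
have conv s t l : 0 < s -> s < t -> 0 < l -> l < 1 ->
    u (l * s + (1 - l) * t) < l * u s + (1 - l) * u t.
  move=> s0 st l0 l1; set x := l * s + (1 - l) * t.
  have sx : s < x by rewrite /x; nra.
  have xt : x < t by rewrite /x; nra.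
  have x0 : 0 < x := lt_trans s0 sx.
  have t0 : 0 < t := lt_trans x0 xt.
  have cst : fine (gamma x) < l * fine (gamma s) + (1 - l) * fine (gamma t).
    have := Gamma_strictly_convex G s0 t0 _ l0 l1.
    by rewrite lt_eqF// => /(_ isT); rewrite (Gamma_EFin G s0) (Gamma_EFin G t0) -/x (Gamma_EFin G x0).
  have us := u0 s; have ut := u0 t.
  have [ks|ks] := leP k s.
    rewrite /u !DR//; [|lra..].
    by rewrite {2}/x; lra.
  have [tk|kt] := leP t k.
    rewrite /u !DL//; [|lra..].
    by rewrite {2}/x; lra.
  have us0 : 0 < u s by apply: up => //; rewrite lt_eqF.
  have ut0 : 0 < u t by apply: up => //; rewrite gt_eqF.
  have [xk|kx|xk] := ltgtP x k.
  - have := Gamma_chord G s0 sx xk => h.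
    have {}h : u x * (k - s) < u s * (k - x).
      by rewrite /u !DL//; [lra|lra|lra].
    have h2 : (k - x) <= l * (k - s) by rewrite /x; nra.
    have h3 : u s * (k - x) <= u s * (l * (k - s)) by rewrite ler_wpM2l.
    have h4 : u x * (k - s) < (l * u s) * (k - s) by lra.
    rewrite ltr_pM2r in h4; last by lra.
    by nra.
  - have kp : 0 < k by lra.
    have := Gamma_chord G kp kx xt => h.
    have {}h : u x * (t - k) < u t * (x - k).
      by rewrite /u !DR//; [lra|lra|lra].
    have h2 : (x - k) <= (1 - l) * (t - k) by rewrite /x; nra.
    have h3 : u t * (x - k) <= u t * ((1 - l) * (t - k)) by rewrite ler_wpM2l.
    have h4 : u x * (t - k) < ((1 - l) * u t) * (t - k) by lra.
    rewrite ltr_pM2r in h4; last by lra.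
    by nra.
  - by rewrite xk {1}/u Delta_diag//=; nra.
split.
- by move=> t; apply: lt_le_trans (Delta_ge0 t k G); rewrite ltNy0.
- by move=> t; exact: Delta_fin.
- move=> s t l s0 t0 st l0 l1.
  have x0 : 0 < l * s + (1 - l) * t by nra.
  rewrite -(fineK (Delta_fin G k0 fr x0)) -(fineK (Delta_fin G k0 fr s0)).
  rewrite -(fineK (Delta_fin G k0 fr t0)) -!EFinM -EFinD lte_fin -!/(u _).
  have [lst|gst|//] := ltgtP s t; first exact: conv.
    have -> : l * s + (1 - l) * t = (1 - l) * t + (1 - (1 - l)) * s by lra.
    rewrite [ltRHS]addrC -[X in X * u s](subKr 1).
    by apply: conv => //; lra.
  by move=> e; move: st; rewrite e eqxx.
- by move=> t t0; rewrite Delta_neg.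
(* Near 0 a single slope occurs: the left derivative at [k] if [k > 0], the right one if [k = 0]. *)
- have [D DE] : exists D, forall t, 0 <= t -> (t < k) || (k == 0) ->
      Delta gamma t k = (gamma t + (- (fine (gamma k)) - D * (t - k))%:E)%E.
    have [kp|kn] := ltP 0 k.
      have [D DE _] := lderiv_subgradient G kp; exists D => t t0.
      rewrite (gt_eqF kp) orbF => tk; rewrite DeltaE// /sgn_deriv subr_ge0 leNgt tk/= DE.
      by rewrite -(fineK gk) -addeA -EFinM -EFinN -EFinD.
    have kE : k = 0 by lra.
    exists Dr => t t0 _; rewrite DeltaE// /sgn_deriv subr_ge0 kE t0 -kE DrE.
    by rewrite -(fineK gk) -addeA -EFinM -EFinN -EFinD.
  rewrite DE//; last by move: k0; rewrite le_eqVlt eq_sym orbC.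
  apply: (@cvg_trans _ (gamma t + (- (fine (gamma k)) - D * (t - k))%:E @[t --> 0^'+])%E).
    have nk : \forall t \near 0^'+, (t < k) || (k == 0).
      have [kp|kn] := ltP 0 k.
        by near=> t; apply/orP; left; near: t; exact: nbhs_right_lt.
      by apply: nearW => t; rewrite [k == 0]eq_le kn k0 orbT.
    apply: near_eq_cvg; near=> t.
    have t0 : 0 < t by near: t; exact: nbhs_right_gt.
    by rewrite DE ?(ltW t0)//; near: t.
  apply: (cvgeD _ (Gamma_cvg0 G)); first by rewrite fin_num_adde_defl.
  apply: cvg_EFin; first exact: nearW.
  apply: cvg_at_right_filter; apply: cvgB; first exact: cvg_cst.
  by apply: cvgMr; apply: cvgB; [exact: cvg_id|exact: cvg_cst].
Unshelve. all: by end_near. Qed.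

End RecenteredGamma.

(** * Measurability *)

Section Measurability.
Context {R : realType} {disp : measure_display} {Z : measurableType disp}.
Implicit Types (alpha : Z -> R -> \bar R) (u k w : Z -> R).

(** Only sections at fixed [t] are measurable, but each [alpha z] is right-continuous on [[0, +oo[].
    So [u] is approximated by the countably valued grid functions [v n]; the added 1 keeps them
    strictly above [u], as a right limit demands. Where [u < 0], [v n] is eventually negative and
    both sides are [+oo]. *)
Lemma in_B_measurable_comp alpha u : in_B alpha -> measurable_fun [set: Z] u ->
  measurable_fun [set: Z] (fun z => alpha z (u z)).
Proof.
move=> [ma G] mu.
pose v n z : R := (Num.floor (u z * n.+1%:R) + 1)%:~R / n.+1%:R.
have uv n z : u z < v n z.
  by rewrite /v ltr_pdivlMr// Num.Theory.floorD1_gt// num_real.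
have vu n z : v n z <= u z + harmonic n.
  rewrite /v ler_pdivrMr// mulrDl /harmonic /= mulVf// intrD lerD2r.
  exact: Num.Theory.floor_le_tmp.
have cv z : v n z @[n --> \oo] --> u z.
  apply: (@squeeze_cvgr _ _ _ _ (fun=> u z) (fun n => u z + harmonic n)).
  - by apply: nearW => n; rewrite vu ltW.
  - exact: cvg_cst.
  - rewrite -[X in _ --> X]addr0; apply: cvgD; [exact: cvg_cst|exact: cvg_harmonic].
apply: (@emeasurable_fun_cvg _ _ _ _ (fun n z => alpha z (v n z))).
  move=> n _ Y mY; rewrite setTI.
  rewrite (_ : _ @^-1` _ = \bigcup_(i in [set: int])
    ((fun z => u z * n.+1%:R) @^-1` [set` `[i%:~R, (i + 1)%:~R[ ] `&`
     alpha ^~ ((i + 1)%:~R / n.+1%:R) @^-1` Y)); last first.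
    apply/seteqP; split => [z /= Yz|z [i _ /= [+ Yz]]].
      exists (Num.floor (u z * n.+1%:R)) => //; split => //=.
      by rewrite in_itv/= Num.Theory.floor_itv.
    by rewrite in_itv/= => iz; rewrite /v (Num.Theory.floor_def iz).
  apply: countable_bigcupT_measurable; first exact: countableP.
  move=> i; apply: measurableI; last by rewrite -[X in measurable X]setTI; exact: ma.
  rewrite -[X in measurable X]setTI; apply: measurable_funM => //.
move=> z _; have [u0|u0] := ltP (u z) 0; last first.
  apply: (cvg_comp (v ^~ z) (alpha z)); last exact: Gamma_cvg_right (G z) u0.
  by apply: seq_cvg_at_right => // n.
rewrite (Gamma_neg (G z))//; apply: cvg_near_cst; near=> n.
rewrite (Gamma_neg (G z))//; near: n.
by apply: (cvgr_lt _ (cv z)).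
Unshelve. all: by end_near. Qed.

Lemma measurable_diff_quot alpha k (e : R) : in_B alpha -> measurable_fun [set: Z] k ->
  measurable_fun [set: Z] (fun z => diff_quot (alpha z) (k z) e).
Proof.
move=> B mk; apply: measurable_funM => //; apply: measurable_funB.
  apply: measurableT_comp => //; apply: in_B_measurable_comp => //.
  exact: measurable_funD.
by apply: measurableT_comp => //; apply: in_B_measurable_comp.
Qed.

Lemma measurable_rderiv_cst alpha (c : R) : in_B alpha -> 0 < c ->
  measurable_fun [set: Z] (fun z => rderiv (alpha z) c).
Proof.
move=> B c0.
apply: (@emeasurable_fun_cvg _ _ _ _ (fun n z => (diff_quot (alpha z) c (harmonic n))%:E)).
  by move=> n; apply/measurable_EFinP; apply: measurable_diff_quot.
move=> z _; have [D [-> cD _]] := rderivP (B.2 z) c0.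
apply: cvg_EFin; first exact: nearW.
by apply: (cvg_comp _ _ harmonic_at_right cD).
Qed.

Lemma measurable_rderiv alpha k : in_B alpha -> measurable_fun [set: Z] k ->
  measurable_fun [set: Z] (fun z => rderiv (alpha z) (k z)).
Proof.
move=> B mk.
apply: (@emeasurable_fun_cvg _ _ _ _ (fun n z =>
  if 0 < k z then (diff_quot (alpha z) (k z) (harmonic n))%:E
  else if k z == 0 then rderiv (alpha z) (harmonic n) else -oo%E)).
  move=> n; apply: measurable_fun_ifT; first exact: measurable_fun_ltr.
    by apply/measurable_EFinP; apply: measurable_diff_quot.
  apply: measurable_fun_ifT => //; first exact: measurable_fun_eqr.
  by apply: measurable_rderiv_cst => //; exact: harmonic_gt0.
move=> z _; have [k0|k0] := ltP 0 (k z).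
  have [D [-> cD _]] := rderivP (B.2 z) k0.
  apply: cvg_EFin; first exact: nearW.
  by apply: (cvg_comp _ _ harmonic_at_right cD).
have [kE|kn0] := eqVneq (k z) 0.
  rewrite kE; exact: cvg_comp _ _ harmonic_at_right (rderiv0_cvg (B.2 z)).
by rewrite /rderiv ltNge k0/= (negbTE kn0); exact: cvg_cst.
Qed.

Lemma measurable_lderiv alpha k : in_B alpha -> measurable_fun [set: Z] k ->
  measurable_fun [set: Z] (fun z => lderiv (alpha z) (k z)).
Proof.
move=> B mk.
apply: (@emeasurable_fun_cvg _ _ _ _ (fun n z =>
  if 0 < k z then (diff_quot (alpha z) (k z) (- harmonic n))%:E else -oo%E)).
  move=> n; apply: measurable_fun_ifT => //; first exact: measurable_fun_ltr.
  by apply/measurable_EFinP; apply: measurable_diff_quot.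
move=> z _; have [k0|k0] := ltP 0 (k z).
  have [D [-> cD _]] := lderivP (B.2 z) k0.
  apply: cvg_EFin; first exact: nearW.
  by apply: (cvg_comp _ _ harmonicN_at_left cD).
by rewrite /lderiv ltNge k0/=; exact: cvg_cst.
Qed.

Lemma measurable_sgn_deriv alpha w k : in_B alpha -> measurable_fun [set: Z] w ->
  measurable_fun [set: Z] k ->
  measurable_fun [set: Z] (fun z => sgn_deriv (alpha z) (w z) (k z)).
Proof.
move=> B mw mk; apply: measurable_fun_ifT; first exact: measurable_fun_ler.
  exact: measurable_rderiv.
exact: measurable_lderiv.
Qed.

Lemma measurable_Delta alpha u k : in_B alpha -> measurable_fun [set: Z] u ->
  measurable_fun [set: Z] k ->
  measurable_fun [set: Z] (fun z => Delta (alpha z) (u z) (k z)).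
Proof.
move=> B mu mk; apply: measurable_fun_ifT => //.
  by apply: measurable_or; exact: measurable_fun_ltr.
have muk : measurable_fun [set: Z] (fun z => (u z - k z)) by exact: measurable_funB.
apply: measurable_fun_ifT.
- apply: (@measurable_fun_bool _ _ _ _ true).
  rewrite setTI (_ : _ @^-1` _ = [set: Z] `&` (fun z => rderiv (alpha z) (k z)) @^-1` [set x | x \is a fin_num]).
    by apply: measurable_rderiv => //; rewrite -[X in measurable X]setTI; exact: emeasurable_fin_num.
  by rewrite setTI; apply/seteqP; split => z.
- apply: emeasurable_funB.
    by apply: emeasurable_funB; apply: in_B_measurable_comp.
  apply: emeasurable_funM; first exact: measurable_sgn_deriv.
  exact/measurable_EFinP.
- by apply: emeasurable_funM => //; exact/measurable_EFinP.
Qed.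

(** By right-continuity every [t >= 0] is approached from above through positive rationals, and a
    negative [t] contributes [-oo]. *)
Lemma conjugate_posrat (gamma : R -> \bar R) (r : R) : in_Gamma gamma ->
  conjugate gamma r =
  ereal_sup (range (fun n => ((r * posrat n)%:E - gamma (posrat n))%E)).
Proof.
move=> G; apply/eqP; rewrite eq_le; apply/andP; split; last first.
  by apply: ge_ereal_sup => _ [n _ <-]; exact: conjugate_ge.
set S := ereal_sup _; apply: ge_ereal_sup => _ [t _ <-].
have [t0|t0] := ltP t 0; first by rewrite (Gamma_neg G t0)/= leNye.
have /choice[m Hm] n : exists i, t < @posrat R i /\ posrat i < t + @harmonic R n.
  by apply: posrat_dense => //; rewrite ltrDl harmonic_gt0.
have cm : posrat (m n) @[n --> \oo] --> t^'+.
  apply: seq_cvg_at_right => [n|]; first by case: (Hm n).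
  apply: (@squeeze_cvgr _ _ _ _ (fun=> t) (fun n => t + harmonic n)).
  - by apply: nearW => n; have [/ltW -> /ltW ->] := Hm n.
  - exact: cvg_cst.
  - rewrite -[X in _ --> X]addr0; apply: cvgD; [exact: cvg_cst|exact: cvg_harmonic].
have cS : ((r * posrat (m n))%:E - gamma (posrat (m n)))%E @[n --> \oo] -->
    ((r * t)%:E - gamma t)%E.
  apply: cvgeB; first by rewrite fin_num_adde_defr.
    apply: cvg_EFin; first exact: nearW.
    by apply: cvgMr; apply: cvg_trans cm _; exact: cvg_within.
  exact: cvg_comp _ _ cm (Gamma_cvg_right G t0).
apply: (cvge_to_le cS).
by apply: nearW => n; apply: ereal_sup_ubound; exists (m n).
Qed.

Lemma measurable_conjugate alpha w : in_B alpha -> measurable_fun [set: Z] w ->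
  measurable_fun [set: Z] (fun z => conjugate (alpha z) (w z)).
Proof.
move=> B mw.
pose f n z : \bar R := ((w z * posrat n)%:E - alpha z (posrat n))%E.
rewrite (_ : (fun z => _) = (fun z => esups (f ^~ z) 0)).
  apply: measurable_fun_esups => n; apply: emeasurable_funB; last exact: B.1.
  by apply/measurable_EFinP; exact: measurable_funM.
apply/funext => z; rewrite conjugate_posrat; last exact: B.2.
by rewrite /esups /sdrop/=; congr ereal_sup; apply/seteqP; split => _ [n _ <-]; exists n.
Qed.

(** [Delta_Gamma] asks for a finite right derivative at [k z]. At [k z = 0] the value [-oo] is
    excluded by hypothesis, and [+oo] by monotonicity, the right derivative at 1 being finite. *)
Lemma recenter_in_B beta k : in_B beta -> measurable_fun [set: Z] k ->
  (forall z, 0 <= k z) -> (forall z, rderiv (beta z) 0 = -oo%E -> 0 < k z) ->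
  in_B (recenter beta k).
Proof.
move=> B mk k0 kp; split => [t|z]; first exact: measurable_Delta.
apply: Delta_Gamma => //; first exact: B.2.
have [kz|kz] := ltP 0 (k z); first exact: rderiv_fin (B.2 z) kz.
have k00 : k z = 0 by apply/eqP; rewrite eq_le kz k0.
rewrite k00; have := rderiv0_le (B.2 z) ltr01.
have := rderiv_fin (B.2 z) ltr01; have := kp z; rewrite k00 ltxx.
by case: (rderiv _ 0) => [x| |] //; [case: (rderiv _ 1)|move=> /(_ erefl)].
Qed.

End Measurability.

(** * Convex cones and their faces *)

Section ConeSeparation.
Context {R : realType}.
Implicit Types (n : nat) (c : nat -> R).

(* A finite-dimensional Hahn-Banach theorem: the pairs (y, s) of G form the
   epigraph of a sublinear function of the first n coordinates of y. *)
Lemma cone_linear_minorant n (G : set ((nat -> R) * R)) :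
  (forall v w, G v -> G w -> G ((fun i => v.1 i + w.1 i), v.2 + w.2)) ->
  (forall (l : R) v, 0 < l -> G v -> G ((fun i => l * v.1 i), l * v.2)) ->
  (forall v, G v -> exists2 w, G w & forall i, (i < n)%N -> w.1 i = - v.1 i) ->
  (forall v, G v -> (forall i, (i < n)%N -> v.1 i = 0) -> 0 <= v.2) ->
  exists c, forall v, G v -> \sum_(i < n) c i * v.1 i <= v.2.
Proof.
elim: n G => [|n IH] G addG sclG symG posG.
  by exists (fun=> 0) => v Gv; rewrite big_ord0; apply: posG.
(* [N] is the part of [G] over the last coordinate axis. It decides which last coefficients [cn] are
   possible; once [G] is tilted by [cn], the induction hypothesis supplies the others. *)
pose N v := G v /\ forall i, (i < n)%N -> v.1 i = 0.
have posN v : N v -> v.1 n = 0 -> 0 <= v.2.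
  move=> [Gv v0] vn; apply: posG => // i; rewrite ltnS leq_eqVlt => /predU1P[->//|].
  exact: v0.
have symN v : N v -> exists2 w, N w & w.1 n = - v.1 n.
  move=> [Gv v0]; have [w Gw wv] := symG _ Gv; exists w; last exact: wv.
  by split => // i ilt; rewrite wv ?v0 ?oppr0// ltnS ltnW.
have crossN v w : N v -> N w -> v.1 n < 0 -> 0 < w.1 n ->
    v.2 / v.1 n <= w.2 / w.1 n.
  move=> [Gv v0] [Gw w0] vn wn.
  have vn' : 0 < - v.1 n by rewrite oppr_gt0.
  have := posN _ _ _; move=> /(_ ((fun i => w.1 n * v.1 i + (- v.1 n) * w.1 i),
     w.1 n * v.2 + (- v.1 n) * w.2)) /=.
  have h1 : N ((fun i => w.1 n * v.1 i + (- v.1 n) * w.1 i),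
     w.1 n * v.2 + (- v.1 n) * w.2).
    split; first exact: addG (sclG _ _ wn Gv) (sclG _ _ vn' Gw).
    by move=> i ilt /=; rewrite (v0 i ilt) (w0 i ilt); lra.
  move=> /(_ h1) h; have {}h := h ltac:(lra).
  rewrite ler_pdivlMr// mulrAC ler_ndivrMr//; lra.
have [cn Hcn] : exists cn, forall v, N v -> cn * v.1 n <= v.2.
  pose A := [set x | exists v, [/\ N v, 0 < v.1 n & x = v.2 / v.1 n]].
  have [[a0 Aa0]|A0] := pselect (A !=set0); last first.
    exists 0 => v Nv; rewrite mul0r; apply: posN => //.
    have [vn|vn|//] := ltgtP (v.1 n) 0; last first.
      by exfalso; apply: A0; exists (v.2 / v.1 n), v.
    have [w Nw wv] := symN _ Nv; exfalso; apply: A0.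
    by exists (w.2 / w.1 n), w; rewrite wv oppr_gt0.
  have hA : has_lbound A.
    have [v [Nv vn _]] := Aa0; have [w Nw wv] := symN _ Nv.
    have wn : w.1 n < 0 by rewrite wv oppr_lt0.
    exists (w.2 / w.1 n) => _ [x [Nx xn ->]]; exact: crossN.
  exists (inf A) => v Nv; have [vn|vn|vn] := ltgtP (v.1 n) 0.
  - rewrite -ler_ndivrMr//; apply: lb_le_inf; first by exists a0.
    by move=> _ [x [Nx xn ->]]; exact: crossN.
  - by rewrite -ler_pdivlMr//; apply: ge_inf => //; exists v.
  - by rewrite vn mulr0; exact: posN.
pose G' := [set (v.1, v.2 - cn * v.1 n) | v in G].
have [|||_ [v Gv <-] v0|c Hc] := IH G'.
- move=> _ _ [v Gv <-] [w Gw <-] /=.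
  by exists ((fun i => v.1 i + w.1 i), v.2 + w.2); [exact: addG|congr pair => /=; lra].
- move=> l _ l0 [v Gv <-] /=.
  by exists ((fun i => l * v.1 i), l * v.2); [exact: sclG|congr pair => /=; lra].
- move=> _ [v Gv <-] /=; have [w Gw wv] := symG _ Gv.
  exists (w.1, w.2 - cn * w.1 n); first by exists w.
  by move=> i ilt; apply: wv; rewrite ltnS ltnW.
- by rewrite /= subr_ge0; apply: Hcn.
exists (fun i => if (i < n)%N then c i else cn) => v Gv.
rewrite big_ord_recr/= ltnn.
have := Hc (v.1, v.2 - cn * v.1 n) (ex_intro2 _ _ v Gv erefl); rewrite /= => h.
under eq_bigr => i _ do rewrite ltn_ord.
by rewrite -lerBrDr.
Qed.

(** [k] witnesses that the projection of the cone to the first [n] coordinates is not symmetric,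
    hence not a subspace. If dropping one more coordinate leaves it asymmetric, induction applies.
    Otherwise the last coordinate keeps one sign over the origin, since with both signs any height
    could be reached, in particular that of [- k]; then [cone_linear_minorant] applies to the last
    coordinate up to sign. *)
Lemma cone_proper_separation n (G : set (nat -> R)) :
  (forall v w, G v -> G w -> G (fun i => v i + w i)) ->
  (forall (l : R) v, 0 < l -> G v -> G (fun i => l * v i)) ->
  (exists2 k, G k & forall w, G w -> exists2 i, (i < n)%N & w i != - k i) ->
  exists c, (forall v, G v -> \sum_(i < n) c i * v i <= 0) /\
    exists2 v, G v & \sum_(i < n) c i * v i < 0.
Proof.
move=> addG sclG; elim: n => [[k Gk /(_ _ Gk)[]//]|n IH [k Gk Hk]].
have [/IH[c [c1 [v Gv c2]]]|nIH] := pselect (exists2 k, G k &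
    forall w, G w -> exists2 i, (i < n)%N & w i != - k i).
  have E (w : nat -> R) : \sum_(i < n.+1) (if (i < n)%N then c i else 0) * w i = \sum_(i < n) c i * w i.
    rewrite big_ord_recr/= ltnn mul0r addr0.
    by apply: eq_bigr => i _; rewrite ltn_ord.
  exists (fun i => if (i < n)%N then c i else 0); split=> [w Gw|].
    by rewrite E; exact: c1.
  by exists v => //; rewrite E.
have symG v : G v -> exists2 w, G w & forall i, (i < n)%N -> w i = - v i.
  move=> Gv; apply: contrapT => nw; apply: nIH; exists v => // w Gw.
  apply: contrapT => ni; apply: nw; exists w => // i ilt.
  by apply/eqP; apply: contrapT => /negP wi; apply: ni; exists i.
have key (s : R) : s = 1 \/ s = - 1 ->
    (forall v, G v -> (forall i, (i < n)%N -> v i = 0) -> 0 <= s * v n) ->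
    exists c, (forall v, G v -> \sum_(i < n.+1) c i * v i <= 0) /\
    exists2 v, G v & \sum_(i < n.+1) c i * v i < 0.
  move=> s1 sv; pose G2 := [set (v, s * v n) | v in G].
  have [||||c Hc] := @cone_linear_minorant n G2.
  - move=> _ _ [v Gv <-] [w Gw <-]; exists (fun i => v i + w i); first exact: addG.
    by congr pair => /=; lra.
  - move=> l _ l0 [v Gv <-]; exists (fun i => l * v i); first exact: sclG.
    by congr pair => /=; lra.
  - move=> _ [v Gv <-]; have [w Gw wv] := symG _ Gv.
    by exists (w, s * w n) => //; exists w.
  - by move=> _ [v Gv <-] /=; exact: sv.
  pose c' i := if (i < n)%N then c i else - s.
  have E (v : nat -> R) : \sum_(i < n.+1) c' i * v i = \sum_(i < n) c i * v i - s * v n.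
    rewrite big_ord_recr/= /c' ltnn mulNr; congr (_ + _).
    by apply: eq_bigr => i _; rewrite ltn_ord.
  have c'0 v : G v -> \sum_(i < n.+1) c' i * v i <= 0.
    by move=> Gv; rewrite E subr_le0; apply: (Hc (v, s * v n)); exists v.
  (* If [c'] vanished on [G], the last coordinate would be a linear function of the others, and
     their symmetry would produce a point over [- k]. *)
  exists c'; split => //; apply: contrapT => nv.
  have c'E v : G v -> \sum_(i < n) c i * v i = s * v n.
    move=> Gv; apply/eqP; rewrite -subr_eq0 -E eq_le c'0//= leNgt.
    by apply/negP => vl; apply: nv; exists v.
  have [w Gw wk] := symG _ Gk; have [i + /negP[]] := Hk _ Gw.
  rewrite ltnS leq_eqVlt => /predU1P[->|/wk ->//].
  have : s * w n = - (s * k n).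
    rewrite -!c'E// -sumrN; apply: eq_bigr => j _; rewrite wk// mulrN//.
  by case: s1 => ->; rewrite ?mulN1r ?mul1r => h; apply/eqP; lra.
have [Hp|Hp] := pselect (forall v, G v -> (forall i, (i < n)%N -> v i = 0) -> 0 <= 1 * v n).
  by apply: (key 1) => //; left.
have [Hm|Hm] := pselect (forall v, G v -> (forall i, (i < n)%N -> v i = 0) -> 0 <= -1 * v n).
  by apply: (key (-1)) => //; right.
have {Hp}[v Gv [v0 vn]] : exists2 v, G v & (forall i, (i < n)%N -> v i = 0) /\ v n < 0.
  apply: contrapT => nv; apply: Hp => v Gv v0; rewrite mul1r leNgt; apply/negP => vn.
  by apply: nv; exists v.
have {Hm}[u Gu [u0 un]] : exists2 u, G u & (forall i, (i < n)%N -> u i = 0) /\ 0 < u n.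
  apply: contrapT => nu; apply: Hm => u Gu u0; rewrite mulN1r oppr_ge0 leNgt.
  by apply/negP => un; apply: nu; exists u.
have [w Gw wk] := symG _ Gk.
suff [x Gx xk] : exists2 x, G x & forall i, (i < n.+1)%N -> x i = - k i.
  by have [i /xk -> /negP[]] := Hk _ Gx.
(* A positive multiple of [x], which lies over the origin, moves the height of [w] to that of
   [- k]. *)
have shift x : G x -> (forall i, (i < n)%N -> x i = 0) -> 0 < (- k n - w n) / x n ->
    exists2 x, G x & forall i, (i < n.+1)%N -> x i = - k i.
  move=> Gx x0 l0; exists (fun i => w i + (- k n - w n) / x n * x i).
    exact: addG Gw (sclG _ _ l0 Gx).
  have xn : x n != 0 by apply: contraTneq l0 => ->; rewrite invr0 mulr0 ltxx.
  move=> i; rewrite ltnS leq_eqVlt => /predU1P[->|ilt]; last by rewrite (wk i ilt) (x0 i ilt) mulr0 addr0.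
  by rewrite divfK// addrC subrK.
have [wn|wn|wn] := ltgtP (w n) (- k n).
- by apply: (shift u) => //; rewrite divr_gt0 ?subr_gt0.
- apply: (shift v) => //; rewrite -mulrNN -invrN mulr_gt0 ?invr_gt0 ?oppr_gt0//.
  by rewrite subr_lt0.
- by exists w => // i; rewrite ltnS leq_eqVlt => /predU1P[->//|/wk].
Qed.

End ConeSeparation.

(** * Relative interiors and the face of a point *)

Section RowVectors.
Context {R : realType} {d : nat}.
Notation V := 'rV[R]_d.
Implicit Types (x y a : V) (C F : set V) (l e : R).

Lemma rV_normE x : `|x| = \big[Num.max/0]_ij `|x ij.1 ij.2|.
Proof. exact: mx_normrE. Qed.

Lemma rV_coord_le x i : `|x 0 i| <= `|x|.
Proof.
rewrite rV_normE.
by apply: (@le_trans _ _ (`|x (0, i).1 (0, i).2|)) => //; exact: le_bigmax.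
Qed.

Lemma rV_norm_lt x e : 0 < e -> (forall i, `|x 0 i| < e) -> `|x| < e.
Proof.
move=> e0 H; rewrite rV_normE; apply/bigmax_ltP; split => // -[i j] _ /=.
by rewrite ord1; exact: H.
Qed.

Lemma rV_norm_le x e : 0 <= e -> (forall i, `|x 0 i| <= e) -> `|x| <= e.
Proof.
move=> e0 H; rewrite rV_normE; apply/bigmax_leP; split => // -[i j] _ /=.
by rewrite ord1; exact: H.
Qed.

Lemma dotpD c x y : dotp c (x + y) = dotp c x + dotp c y.
Proof. by rewrite /dotp -big_split; apply: eq_bigr => i _; rewrite mxE mulrDr. Qed.

Lemma dotpZ c l x : dotp c (l *: x) = l * dotp c x.
Proof. by rewrite /dotp mulr_sumr; apply: eq_bigr => i _; rewrite mxE mulrCA. Qed.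

Lemma dotpB c x y : dotp c (x - y) = dotp c x - dotp c y.
Proof. by rewrite dotpD -scaleN1r dotpZ mulN1r. Qed.

Lemma dotp_norm_le c x : `|dotp c x| <= (\sum_(i < d) `|c 0 i|) * `|x|.
Proof.
rewrite /dotp mulr_suml; apply: le_trans (ler_norm_sum _ _ _) _.
by apply: ler_sum => i _; rewrite normrM ler_wpM2l// rV_coord_le.
Qed.

Lemma relative_interiorP C x : relative_interior C x <->
  C x /\ exists2 e, 0 < e & forall y, `|x - y| < e -> affine_hull C y -> C y.
Proof.
split=> [[Cx /nbhs_normP[e e0 He]]|[Cx [e e0 He]]]; split => //.
  by exists e.
by apply/nbhs_normP; exists e.
Qed.

Lemma relative_interior_extend C x y : relative_interior C x -> C y ->
  exists2 e, 0 < e & C (x - e *: (y - x)).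
Proof.
move=> /relative_interiorP[Cx [r r0 Hr]] Cy.
have n0 : 0 < `|y - x| + 1 by rewrite ltr_wpDl.
have e0 : 0 < r / (`|y - x| + 1) by rewrite divr_gt0.
exists (r / (`|y - x| + 1)) => //; set e := r / _ in e0 *; apply: Hr.
  rewrite opprB addrC subrK normrZ gtr0_norm// /e mulrAC ltr_pdivrMr//.
  by rewrite ltr_pM2l// ltrDl.
exists 2%N, (fun i => if i == ord0 then x else y).
exists (fun i => if i == ord0 then 1 + e else - e); split.
- by move=> i; case: ifP.
- by rewrite !big_ord_recl big_ord0/= addr0 addrK.
- rewrite !big_ord_recl big_ord0/= addr0; apply/rowP => i; rewrite !mxE.
  by lra.
Qed.

Lemma segmentP x y z : segment x y z <->
  exists l, [/\ 0 <= l, l <= 1 & z = l *: x + (1 - l) *: y].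
Proof.
split=> [[l _ <-]|[l [l0 l1 ->]]].
  by exists l%:num; split => //.
by exists (Itv01 l0 l1).
Qed.

Section ConvexCone.
Variable C : set V.
Hypothesis CD : forall x y, C x -> C y -> C (x + y).
Hypothesis CZ : forall l x, 0 <= l -> C x -> C (l *: x).

Lemma cone_conv l x y : 0 <= l -> l <= 1 -> C x -> C y -> C (l *: x + (1 - l) *: y).
Proof. by move=> l0 l1 Cx Cy; apply: CD; apply: CZ => //; rewrite subr_ge0. Qed.

Lemma cone_sum (n : nat) (p : 'I_n -> V) : C 0 -> (forall i, C (p i)) ->
  C (\sum_(i < n) p i).
Proof. by move=> C0 Cp; elim/big_ind : _. Qed.

(** [a] is relatively interior to the segment from [x] to [y], so the face property applies to that
    segment. The radius is read off a coordinate in which [x] and [y] differ, as it determines the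
    position on the line. *)
Lemma face_interior_point F a x y l : is_face C F -> relative_interior F a ->
  C x -> C y -> 0 < l -> l < 1 -> a = l *: x + (1 - l) *: y -> F x.
Proof.
move=> [_ _ _ faceF] [Fa _] Cx Cy l0 l1 aE.
have sC : segment x y `<=` C.
  by move=> _ /segmentP[t [t0 t1 ->]]; exact: cone_conv.
have sa : segment x y a by apply/segmentP; exists l; split => //; exact: ltW.
apply: (faceF x y sC) => //; last first.
  by apply/segmentP; exists 1; split => //; rewrite scale1r subrr scale0r addr0.
exists a; split => //; apply/relative_interiorP; split => //.
have hull z : affine_hull (segment x y) z -> exists T, z = T *: x + (1 - T) *: y.
  move=> [n [p [m [sp m1 ->]]]].
  have /choice[t Ht] i : exists t, p i = t *: x + (1 - t) *: y.
    by have /segmentP[t [_ _ ->]] := sp i; exists t.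
  exists (\sum_(i < n) m i * t i); rewrite -{1}m1 -sumrB !scaler_suml -big_split.
  apply: eq_bigr => i _; rewrite Ht scalerDr !scalerA; congr (_ + _ *: _).
  by rewrite mulrBr mulr1.
have [xy|xy] := eqVneq x y.
  exists 1 => // z _ /hull[T ->]; rewrite xy -scalerDl addrC subrK scale1r.
  by apply/segmentP; exists 1; split => //; rewrite scale1r subrr scale0r addr0.
have [j xj] : exists j, x 0 j != y 0 j.
  apply: contrapT => nj; move/eqP: xy; apply; apply/rowP => j.
  by apply/eqP; apply: contrapT => /negP xj; apply: nj; exists j.
have j0 : 0 < `|x 0 j - y 0 j| by rewrite normr_gt0 subr_eq0.
have m0 : 0 < Num.min l (1 - l) by rewrite lt_min l0 subr_gt0.
exists (Num.min l (1 - l) * `|x 0 j - y 0 j|); first exact: mulr_gt0.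
move=> z az /hull[T zE].
have : `|(a - z) 0 j| < Num.min l (1 - l) * `|x 0 j - y 0 j|.
  exact: le_lt_trans (rV_coord_le _ _) az.
have -> : (a - z) 0 j = (l - T) * (x 0 j - y 0 j) by rewrite aE zE !mxE; lra.
rewrite normrM ltr_pM2r// lt_min !ltr_norml => /andP[/andP[h1 h2] /andP[h3 h4]].
by apply/segmentP; exists T; split => //; lra.
Qed.

Variable a : V.
Hypothesis Ca : C a.

(* The points of C that can be subtracted from a without leaving the cone. *)
Let F0 : set V := [set b | C b /\ exists2 e, 0 < e & C (a - e *: b)].

Let C0 : C 0.
Proof. by rewrite -(scale0r a); exact: CZ. Qed.

Let step_le b e e' : C b -> 0 <= e' -> e' <= e -> C (a - e *: b) -> C (a - e' *: b).
Proof.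
move=> Cb e'0 ee Cab; have -> : a - e' *: b = (a - e *: b) + (e - e') *: b.
  by apply/rowP => i; rewrite !mxE; lra.
by apply: CD => //; apply: CZ => //; rewrite subr_ge0.
Qed.

Let F0_face : is_face C F0.
Proof.
split.
- exists a; split => //; exists 1 => //.
  by rewrite scale1r subrr.
- move=> x y l; rewrite !inE => -[Cx [e e0 Hx]] [Cy [e' e'0 Hy]].
  have m0 : 0 < Num.min e e' by rewrite lt_min e0.
  have l0 : 0 <= l%:num by [].
  have l1 : l%:num <= 1 by [].
  have -> : conv l (x : convex_lmodType V) y = l%:num *: x + (1 - l%:num) *: y by [].
  split; first exact: cone_conv.
  exists (Num.min e e') => //; set m := Num.min e e' in m0 *.
  have -> : a - m *: (l%:num *: x + (1 - l%:num) *: y) =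
      l%:num *: (a - m *: x) + (1 - l%:num) *: (a - m *: y).
    by apply/rowP => i; rewrite !mxE; lra.
  apply: cone_conv => //.
    by apply: step_le Hx => //; [exact: ltW|rewrite ge_min lexx].
  by apply: step_le Hy => //; [exact: ltW|rewrite ge_min lexx orbT].
- by move=> b [].
- move=> x y sC [p [rp [Cp [e e0 Cap]]]] q sq; split; first exact: sC.
  have [t t0 st] := relative_interior_extend rp sq.
  have t10 : 0 < 1 + t by lra.
  exists (e * t / (1 + t)); first by rewrite divr_gt0// mulr_gt0.
  have -> : a - (e * t / (1 + t)) *: q =
      (a - e *: p) + (e / (1 + t)) *: (p - t *: (q - p)).
    by apply/rowP => i; rewrite !mxE; field; rewrite gt_eqF.
  apply: CD => //; apply: CZ; first by rewrite divr_ge0 ?ltW.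
  exact: sC.
Qed.

(** Take a matrix [E] of maximal rank among those whose rows, and whose rows subtracted from [a],
    lie in [C]; its rows span [F0]. Small combinations of them added to [a] stay in [C]: [a] is cut
    into [k] equal shares, and each share absorbs one coefficient of either sign. For [y] in the
    affine hull and near [a], the coefficients of [y - a] are small because [K] bounds
    [pinvmx E]. *)
Let F0_relative_interior : relative_interior F0 a.
Proof.
pose P r := `[< exists k (E : 'M[R]_(k, d)), [/\ \rank E = r,
  forall j, C (row j E) & forall j, C (a - row j E)] >].
have P0 : exists r, P r.
  exists 0%N; apply/asboolP; exists 0%N, 0; split; first by rewrite mxrank0.
    by case.
  by case.
have Pd r : P r -> (r <= d)%N by move=> /asboolP[k [E [<- _ _]]]; exact: rank_leq_col.
have [r /asboolP[k [E [rE CE CaE]]] rmax] := ex_maxnP P0 Pd.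
(* By maximality of the rank, adjoining the row [e *: b] does not enlarge the row space of [E]. *)
have span b : F0 b -> (b <= E)%MS.
  move=> [Cb [e e0 Cab]].
  suff : (e *: b <= E)%MS.
    move=> /(scalemx_sub e^-1); rewrite scalerA mulVf ?scale1r//.
    by rewrite gt_eqF.
  have EB : (E <= col_mx E (e *: b))%MS by rewrite -addsmxE addsmxSl.
  suff : (col_mx E (e *: b) <= E)%MS by rewrite col_mx_sub => /andP[].
  rewrite -(mxrank_leqif_sup EB) rE eqn_leq; apply/andP; split.
    by rewrite -rE; exact: mxrankS.
  apply: rmax; apply/asboolP; exists (k + 1)%N, (col_mx E (e *: b)); split => //.
    move=> j; case: (split_ordP j) => i ->; rewrite ?rowKu ?rowKd//.
    by rewrite ord1 row_id; apply: CZ => //; exact: ltW.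
  move=> j; case: (split_ordP j) => i ->; rewrite ?rowKu ?rowKd//.
  by rewrite ord1 row_id.
have key : forall c : 'rV[R]_k, (forall j, k%:R * `|c 0 j| <= 1) ->
    C (a + \sum_j c 0 j *: row j E).
  case: k E CE CaE {rE span} => [|k] E CE CaE c Hc; first by rewrite big_ord0 addr0.
  have k0 : (0 : R) < k.+1%:R by [].
  have -> : a = \sum_(j < k.+1) (k.+1%:R^-1 *: a).
    by rewrite sumr_const card_ord -scaler_nat scalerA divff ?scale1r// gt_eqF.
  rewrite -big_split/=; apply: cone_sum => // j.
  have kc : `|c 0 j| <= k.+1%:R^-1 by rewrite -[leRHS]mulr1 ler_pdivlMl.
  have [cj|cj] := leP 0 (c 0 j).
    by apply: CD; apply: CZ => //; rewrite invr_ge0.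
  rewrite ltr0_norm// in kc; move: (k.+1%:R^-1) kc => q kc.
  have -> : q *: a + c 0 j *: row j E =
     (- c 0 j) *: (a - row j E) + (q + c 0 j) *: a.
    by apply/rowP => i; rewrite !mxE; lra.
  by apply: CD; apply: CZ => //; lra.
have Fa : F0 a by split => //; exists 1 => //; rewrite scale1r subrr.
apply/relative_interiorP; split => //.
pose K := \sum_i \sum_j `|pinvmx E i j|.
have K0 : 0 <= K by apply: sumr_ge0 => i _; apply: sumr_ge0.
have K10 : 0 < (K + 1) * k.+1%:R by rewrite mulr_gt0// ltr_wpDl.
exists ((K + 1) * k.+1%:R)^-1; first by rewrite invr_gt0.
move=> y ay [n [p [l [Fp l1 yE]]]].
have yaE : (y - a <= E)%MS.
  rewrite addmx_sub//; last by rewrite -scaleN1r scalemx_sub// span.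
  by rewrite yE summx_sub// => i _; rewrite scalemx_sub// span.
pose c := (y - a) *m pinvmx E.
have cE : y - a = \sum_j c 0 j *: row j E by rewrite -mulmx_sum_row mulmxKpV.
have cj j : k%:R * `|c 0 j| <= 1.
  have : `|c 0 j| <= K * `|a - y|.
    rewrite /c mxE distrC /K mulr_suml; apply: le_trans (ler_norm_sum _ _ _) _.
    apply: ler_sum => i _; rewrite normrM mulrC ler_pM//; last exact: rV_coord_le.
    by rewrite (bigD1 j)//= lerDl sumr_ge0.
  move=> cK; rewrite -[(_)^-1]mul1r ltr_pdivlMr// in ay.
  have k1 : (k%:R : R) <= k.+1%:R by rewrite ler_nat.
  have h1 : k%:R * `|c 0 j| <= k.+1%:R * (K * `|a - y|) by rewrite ler_pM.
  have h2 : k.+1%:R * (K * `|a - y|) <= `|a - y| * ((K + 1) * k.+1%:R).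
    have := normr_ge0 (a - y); have : (0 : R) <= k.+1%:R by []; nra.
  lra.
have yaE' : y = a + \sum_j c 0 j *: row j E by rewrite -cE addrC subrK.
split; first by rewrite yaE'; exact: key.
(* The bound on the coefficients is symmetric, so the reflection [2 a - y] lies in [C] as well, and
   [a - y / 2] is half of it. *)
exists (1 / 2); first by lra.
have -> : a - (1 / 2) *: y = (1 / 2) *: (a + \sum_j (- c) 0 j *: row j E).
  have -> : \sum_j (- c) 0 j *: row j E = - (y - a).
    by rewrite cE -sumrN; apply: eq_bigr => j _; rewrite mxE scaleNr.
  by apply/rowP => i; rewrite !mxE; lra.
apply: CZ; first by lra.
by apply: key => j; rewrite mxE normrN.
Qed.

Lemma face_of_pointP :
  is_face C (face_of_point C a) /\ relative_interior (face_of_point C a) a.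
Proof. by apply: (@xgetPex _ set0 [set F | is_face C F /\ relative_interior F a]); exists F0. Qed.

End ConvexCone.
End RowVectors.

(** * Integrals and moments *)

Section AlmostEverywhereIntegral.
Context {R : realType} {disp : measure_display} {Z : measurableType disp}.
Variable mu : {measure set Z -> \bar R}.

Import HBNNSimple.

(* The integral of a nonnegative function is a supremum over simple functions,
   so no measurability is required here. *)
Lemma ge0_ae_le_integral (f g : Z -> \bar R) :
  (forall z, (0 <= f z)%E) -> (forall z, (0 <= g z)%E) ->
  {ae mu, forall z, (f z <= g z)%E} ->
  (\int[mu]_z f z <= \int[mu]_z g z)%E.
Proof.
move=> f0 g0 [N [mN N0 sN]].
rewrite !ge0_integralTE//; apply: ge_ereal_sup => _ [h /= hf <-].
have mCN : measurable (~` N) by exact: measurableC.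
pose h' := proj_nnsfun h mCN.
have -> : sintegral mu h = sintegral mu h'.
  rewrite -!integralT_nnsfun; apply: ge0_ae_eq_integral => //.
  - exact/measurable_EFinP.
  - exact/measurable_EFinP.
  - by move=> z _; rewrite lee_fin fun_ge0.
  - by move=> z _; rewrite lee_fin fun_ge0.
  - exists N; split => // z /= hz; apply: contrapT => Nz; apply: hz => _.
    by rewrite mindicE mem_set ?mulr1.
apply: ereal_sup_ubound; exists h' => //= z.
have [Nz|Nz] := pselect (N z).
  by rewrite mindicE memNset ?mulr0 ?g0// => /(_ Nz).
rewrite mindicE mem_set// mulr1; apply: le_trans (hf z) _.
by apply: contrapT => nfg; apply: Nz; apply: sN.
Qed.

Lemma ge0_integral_ae_eq (D : set Z) (f g : Z -> \bar R) :
  (forall z, D z -> (0 <= f z)%E) -> (forall z, D z -> (0 <= g z)%E) ->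
  {ae mu, forall z, D z -> f z = g z} ->
  (\int[mu]_(z in D) f z = \int[mu]_(z in D) g z)%E.
Proof.
move=> f0 g0 fg; rewrite integral_mkcond [RHS]integral_mkcond.
have [N [mN N0 sN]] := fg.
apply/eqP; rewrite eq_le; apply/andP; split; apply: ge0_ae_le_integral => [z|z|];
  rewrite ?erestrict_ge0//; exists N; split => // z /= nz; apply: sN => /= fgz;
  apply: nz; rewrite !patchE; case: ifPn => // /set_mem /fgz ->//.
Qed.

(** Replaces an integrand known only up to a null set, such as that of the correction functional, by
    a nonnegative version; the negative part integrates to 0, so both branches of [cintegral] give
    the ordinary integral. *)
Lemma cintegral_ge0 (D : set Z) (f g : Z -> \bar R) :
  (forall z, D z -> (0 <= g z)%E) -> {ae mu, forall z, D z -> f z = g z} ->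
  cintegral mu D f = (\int[mu]_(z in D) g z)%E.
Proof.
move=> g0 fg.
have fp : (\int[mu]_(z in D) f^\+ z = \int[mu]_(z in D) g z)%E.
  apply: ge0_integral_ae_eq => //.
  by apply: filterS fg => z fz Dz; rewrite funeposE fz//; exact/max_idPl/g0.
have fn : (\int[mu]_(z in D) f^\- z = 0)%E.
  rewrite -(@integral0 _ _ _ mu D); apply: ge0_integral_ae_eq => //.
  apply: filterS fg => z fz Dz; rewrite funenegE fz//; apply/max_idPr.
  by rewrite leeNl oppe0 g0.
rewrite /cintegral fp; case: ifPn => [/eqP ->//|_].
by rewrite integralE fp fn sube0.
Qed.
End AlmostEverywhereIntegral.

Lemma measurable_set_of_bool {disp : measure_display} {Z : measurableType disp}
    (b : Z -> bool) : measurable_fun [set: Z] b -> measurable [set z | b z].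
Proof.
by move=> mb; rewrite -[X in measurable X]setTI; exact: (mb measurableT [set true]).
Qed.

Section Moments.
Context {R : realType} {disp : measure_display} {Z : measurableType disp}.
Variable mu : {sigma_finite_measure set Z -> \bar R}.
Context {d : nat}.
Notation V := 'rV[R]_d.
Variable phi : Z -> V.
Hypothesis mphi : forall i, measurable_fun [set: Z] (fun z => phi z 0 i).
Implicit Types (g h k : Z -> R) (a c x y : V) (F : set V) (A B : set Z).

Lemma bounded_integrable A (f : Z -> R) (K : R) : 0 <= K -> measurable A -> (mu A < +oo)%E ->
  measurable_fun [set: Z] f -> (forall z, `|f z| <= K * \1_A z) ->
  mu.-integrable [set: Z] (EFin \o f).
Proof.
move=> K0 mA fA mf fK; apply/integrableP; split; first exact/measurable_EFinP.
apply: (@le_lt_trans _ _ (\int[mu]_z (K * \1_A z)%:E)%E).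
  apply: ge0_le_integral => //.
  - by do 2 apply: measurableT_comp => //.
  - by apply/measurable_EFinP; apply: measurable_funM.
  - by move=> z _; rewrite lee_fin.
under eq_integral do rewrite EFinM.
rewrite ge0_integralZl//; last exact/measurable_EFinP.
by rewrite integral_indic// setIT lte_mul_pinfty.
Qed.

Lemma in_GD g k : in_G mu phi g -> in_G mu phi k -> in_G mu phi (fun z => g z + k z).
Proof.
move=> [mg ig] [mk ik]; split=> [|i]; first exact: measurable_funD.
have := integrableD measurableT (ig i) (ik i); apply: eq_integrable => // z _ /=.
by rewrite mulrDr EFinD.
Qed.

Lemma in_GZ (l : R) g : in_G mu phi g -> in_G mu phi (fun z => l * g z).
Proof.
move=> [mg ig]; split=> [|i]; first exact: measurable_funM.
have := integrableZl measurableT l (ig i); apply: eq_integrable => // z _ /=.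
by rewrite -EFinM mulrCA.
Qed.

Lemma in_G_le g k : in_G mu phi g -> measurable_fun [set: Z] k ->
  (forall z, `|k z| <= `|g z|) -> in_G mu phi k.
Proof.
move=> [mg ig] mk kg; split=> // i; apply: le_integrable (ig i) => //.
  by apply/measurable_EFinP; exact: measurable_funM.
by move=> z _ /=; rewrite lee_fin !normrM ler_wpM2l.
Qed.

Lemma in_G_bounded A (K : R) g : 0 <= K -> measurable A -> (mu A < +oo)%E ->
  measurable_fun [set: Z] g -> (forall z i, `|phi z 0 i * g z| <= K * \1_A z) ->
  in_G mu phi g.
Proof.
move=> K0 mA fA mg gK; split=> // i; apply: (bounded_integrable K0 mA fA) => //.
exact: measurable_funM.
Qed.

Lemma momentD g k : in_G mu phi g -> in_G mu phi k ->
  moment mu phi (fun z => g z + k z) = moment mu phi g + moment mu phi k.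
Proof.
move=> [mg ig] [mk ik]; apply/rowP => i; rewrite !mxE -RintegralD//; [|exact: ig|exact: ik].
by apply: eq_Rintegral => z _; rewrite mulrDr.
Qed.

Lemma momentZ (l : R) g : in_G mu phi g ->
  moment mu phi (fun z => l * g z) = l *: moment mu phi g.
Proof.
move=> [mg ig]; apply/rowP => i; rewrite !mxE -RintegralZl//; last exact: ig.
by apply: eq_Rintegral => z _; rewrite mulrCA.
Qed.

Lemma measurable_dotp c : measurable_fun [set: Z] (fun z => dotp c (phi z)).
Proof. by apply: measurable_sum => i; apply: measurable_funM. Qed.

Lemma integrable_dotp c g : in_G mu phi g ->
  mu.-integrable [set: Z] (fun z => (dotp c (phi z) * g z)%:E).
Proof.
move=> [mg ig].
have : mu.-integrable [set: Z]
    (fun z => \sum_(i < d) ((c 0 i)%:E * (phi z 0 i * g z)%:E)%E)%E.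
  by apply: integrable_sum => // i _; exact: integrableZl.
apply: eq_integrable => // z _ /=; rewrite /dotp mulr_suml sumEFin; congr EFin.
by apply: eq_bigr => i _; rewrite mulrA.
Qed.

Lemma integral_dotp c g : in_G mu phi g ->
  (\int[mu]_z (dotp c (phi z) * g z)%:E = (dotp c (moment mu phi g))%:E)%E.
Proof.
move=> [mg ig].
transitivity (\int[mu]_z (\sum_(i < d) ((c 0 i)%:E * (phi z 0 i * g z)%:E)%E))%E.
  apply: eq_integral => z _; rewrite /dotp mulr_suml sumEFin; congr EFin.
  by apply: eq_bigr => i _; rewrite mulrA.
rewrite integral_sum//; last by move=> i; exact: integrableZl.
rewrite /dotp -sumEFin; apply: eq_bigr => i _.
by rewrite integralZl// mxE EFinM fineK// integrable_fin_num.
Qed.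

Lemma moment_coneD x y : moment_cone mu phi x -> moment_cone mu phi y ->
  moment_cone mu phi (x + y).
Proof.
move=> [g [Gg g0] <-] [k [Gk k0] <-]; exists (fun z => g z + k z); last exact: momentD.
by split => [|z]; [exact: in_GD|exact: addr_ge0].
Qed.

Lemma moment_coneZ (l : R) x : 0 <= l -> moment_cone mu phi x ->
  moment_cone mu phi (l *: x).
Proof.
move=> l0 [g [Gg g0] <-]; exists (fun z => l * g z); last exact: momentZ.
by split => [|z]; [exact: in_GZ|exact: mulr_ge0].
Qed.

(* The means of phi over the parts of g on A and off A are the ends of a
   segment through a. *)
Lemma face_mean F a g A : is_face (moment_cone mu phi) F ->
  relative_interior F a -> Gplus_at mu phi a g -> measurable A ->
  mu.-integrable [set: Z] (fun z => (g z * \1_A z)%:E) ->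
  0 < (\int[mu]_z (g z * \1_A z))%R ->
  F ((\int[mu]_z (g z * \1_A z))%R^-1 *: moment mu phi (fun z => g z * \1_A z)).
Proof.
move=> faceF riF [[Gg g0] ga] mA iA; set m := (X in 0 < X); move=> m0.
set g1 := fun z => g z * \1_A z; pose g2 z := g z * \1_(~` A) z.
have i01 (B : set Z) (z : Z) : 0 <= (\1_B z : R) /\ (\1_B z : R) <= 1.
  by rewrite indicE; case: (_ \in _).
have Gi (B : set Z) : measurable B -> Gplus mu phi (fun z => g z * \1_B z).
  move=> mB; split; last first.
    by move=> z; rewrite mulr_ge0//; case: (i01 B z).
  apply: (in_G_le Gg); first by apply: measurable_funM => //; exact: Gg.1.
  move=> z; have [b0 b1] := i01 B z.
  by rewrite normrM (ger0_norm b0) ler_piMr.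
have G1 := Gi _ mA; have G2 := Gi _ (measurableC mA).
have gE : a = moment mu phi g1 + moment mu phi g2.
  rewrite -(momentD G1.1 G2.1) -ga; congr (moment mu phi _); apply/funext => z.
  by rewrite -mulrDr !indicE in_setC; case: (_ \in _); rewrite /= ?addr0 ?add0r mulr1.
have c1 : moment_cone mu phi (moment mu phi g1) by exists g1.
have c2 : moment_cone mu phi (moment mu phi g2) by exists g2.
have m10 : 0 < 1 + m by lra.
(* The other end is chosen so that the weights [m / (1 + m)] and [1 / (1 + m)] recombine the two
   ends to the sum of the two moments, which is [a]. *)
apply: (@face_interior_point R d (moment_cone mu phi) _ _ F a _
   (m *: moment mu phi g1 + (1 + m) *: moment mu phi g2) (m / (1 + m))) => //.
- exact: moment_coneD.
- exact: moment_coneZ.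
- by apply: moment_coneZ => //; rewrite invr_ge0 ltW.
- by apply: moment_coneD; apply: moment_coneZ => //; exact: ltW.
- by rewrite divr_gt0.
- by rewrite ltr_pdivrMr//; lra.
- rewrite gE -/m; move: (moment mu phi g1) (moment mu phi g2) => u v.
  by apply/rowP => i; rewrite !mxE; field; rewrite !gt_eqF.
Qed.

End Moments.

(** * Densities with moment [a] vanish off the closed face *)

Section FaceSupport.
Context {R : realType} {disp : measure_display} {Z : measurableType disp}.
Variable mu : {sigma_finite_measure set Z -> \bar R}.
Context {d : nat}.
Notation V := 'rV[R]_d.
Variable phi : Z -> V.
Hypothesis mphi : forall i, measurable_fun [set: Z] (fun z => phi z 0 i).
Implicit Types (g h k : Z -> R) (a c x y : V) (F : set V) (A B : set Z).

Lemma measurable_box c (e : R) : 0 < e -> measurable [set z | `|phi z - c| < e].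
Proof.
move=> e0; rewrite (_ : mkset _ = \bigcap_(i in [set: 'I_d])
    ((fun z => `|phi z 0 i - c 0 i|) @^-1` [set` `]-oo, e[ ])).
  apply: fin_bigcap_measurable => // i _; rewrite -[X in measurable X]setTI.
  by apply: measurableT_comp => //; exact: measurable_funB.
apply/seteqP; split => [z /= ze i _ /=|z ze /=].
  by rewrite in_itv/=; have := rV_coord_le (phi z - c) i; rewrite !mxE; lra.
apply: rV_norm_lt => // i; have := ze i I; rewrite /= in_itv/= !mxE//.
Qed.

(** A countable base of boxes: it reduces the complement of a closure to a countable union, both for
    measurability and for null sets. *)
Definition rat_box (p : 'rV[rat]_d * nat) : set V :=
  [set x | `|x - map_mx ratr p.1| < harmonic p.2].

(** The factor 2 leaves a margin of one radius between the box and [F]: a mean of [phi] over the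
    box, being within one radius of the centre, cannot belong to [F]. *)
Definition avoids F (p : 'rV[rat]_d * nat) :=
  forall y, F y -> 2 * harmonic p.2 <= `|y - map_mx ratr p.1|.

Lemma setC_closure F x : ~ closure F x <-> exists2 p, avoids F p & rat_box p x.
Proof.
split=> [|[[c n] /= Fp xp] clx]; last first.
  have nb : \forall y \near x, `|x - y| < harmonic n.
    by apply/nbhs_normP; exists (harmonic n) => //; exact: harmonic_gt0.
  have [y [Fy xy]] := clx _ nb.
  have := Fp y Fy; rewrite /rat_box/= in xp xy *.
  have := ler_distD x y (map_mx ratr c); rewrite [`|y - x|]distrC.
  by move: (_^-1) xp xy => e xp xy; lra.
move=> /existsNP[B /not_implyP[/nbhs_normP[r /= r0 rB] FB]].
have [n nr] : exists n, @harmonic R n < r / 3.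
  have [n] := @ltr_add_invr R 0 (r / 3) ltac:(by rewrite divr_gt0).
  by rewrite add0r; exists n.
have e0 := @harmonic_gt0 R n.
have /choice[q qx] (i : 'I_d) : exists q : rat, `|x 0 i - ratr q| < harmonic n.
  move: (harmonic n) e0 => e e0.
  have [|q] := @rat_in_itvoo R (x 0 i - e) (x 0 i + e); first by lra.
  by rewrite in_itv/= => /andP[h1 h2]; exists q; rewrite ltr_norml; lra.
have xc : `|x - map_mx ratr (\row_i q i)| < harmonic n.
  by apply: rV_norm_lt; [exact: harmonic_gt0|move=> i; rewrite !mxE].
exists (\row_i q i, n) => //= y Fy /=; rewrite leNgt; apply/negP => yc.
apply: FB; exists y; split => //; apply: rB => /=.
have {}yc : `|y - map_mx ratr (\row_i q i)| < 2 * harmonic n := yc.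
move: (harmonic n) nr xc yc => e nr xc yc.
have := ler_distD (map_mx ratr (\row_i q i)) x y; rewrite [X in _ <= _ + X]distrC.
lra.
Qed.

Lemma measurable_on_closure F : measurable (on_closure phi F).
Proof.
rewrite -[on_closure _ _]setCK; apply: measurableC.
rewrite (_ : ~` _ = \bigcup_p (if `[< avoids F p >] then phi @^-1` rat_box p else set0)).
  apply: countable_bigcupT_measurable => // p; case: ifP => // _.
  by apply: measurable_box; exact: harmonic_gt0.
apply/seteqP; split => [z /setC_closure[p Fp xp]|z [p _]].
  by exists p => //; rewrite asboolT.
by case: asboolP => // Fp xp; apply/setC_closure; exists p.
Qed.

Lemma mean_in_box g A c (e : R) : in_G mu phi g -> (forall z, 0 <= g z) ->
  measurable A -> mu.-integrable [set: Z] (fun z => (g z * \1_A z)%:E) ->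
  0 < (\int[mu]_z (g z * \1_A z))%R -> 0 < e ->
  (forall z, A z -> `|phi z - c| < e) ->
  `|(\int[mu]_z (g z * \1_A z))%R^-1 *: moment mu phi (fun z => g z * \1_A z) - c| <= e.
Proof.
move=> Gg g0 mA iA m0 e0 Ae.
have i1 (z : Z) : 0 <= (\1_A z : R) /\ (\1_A z : R) <= 1.
  by rewrite indicE; case: (_ \in _).
have [_ iG1] : in_G mu phi (fun z => g z * \1_A z).
  apply: (in_G_le _ Gg) => //; first by apply: measurable_funM => //; exact: Gg.1.
  by move=> z; have [b0 b1] := i1 z; rewrite normrM (ger0_norm b0) ler_piMr.
set m := (\int[mu]_z (g z * \1_A z))%R in m0 *.
apply: rV_norm_le => [|i]; first exact: ltW.
have icA : mu.-integrable [set: Z] (EFin \o (fun z => - c 0 i * (g z * \1_A z))).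
  exact: (integrableZl measurableT (- c 0 i) iA).
have E : ((m^-1 *: moment mu phi (fun z => g z * \1_A z) - c) 0 i) =
    m^-1 * \int[mu]_z (phi z 0 i * (g z * \1_A z) + - c 0 i * (g z * \1_A z)).
  rewrite RintegralD//; last exact: iG1.
  rewrite RintegralZl// -/m !mxE; field.
  by rewrite gt_eqF.
rewrite E normrM gtr0_norm ?invr_gt0// ler_pdivrMl//.
have iS : mu.-integrable [set: Z] (EFin \o
    (fun z => phi z 0 i * (g z * \1_A z) + - c 0 i * (g z * \1_A z))).
  exact: (integrableD measurableT (iG1 i) icA).
apply: le_trans (le_normr_Rintegral _ iS) _ => //.
rewrite mulrC -RintegralZl//; apply: le_Rintegral => //.
- exact: (integrable_abse iS).
- exact: (integrableZl measurableT e iA).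
move=> z _; rewrite -mulrDl normrM.
have [Az|nAz] := pselect (A z); last by rewrite indicE memNset// !mulr0 normr0 mulr0.
rewrite (ger0_norm (mulr_ge0 (g0 z) (i1 z).1)) ler_wpM2r ?mulr_ge0//.
by apply: ltW; apply: le_lt_trans (Ae z Az); have := rV_coord_le (phi z - c) i; rewrite !mxE.
Qed.

(** Countably many boxes that avoid [F] cover the complement of its closure. If [g] had positive
    mass on such a box, the mean of [phi] there would lie in [F] by [face_mean] and within one
    radius of the centre by [mean_in_box]. The truncations by [S k] and [g <= k] keep the mass
    finite. *)
Lemma Gplus_at_vanish F a g : is_face (moment_cone mu phi) F ->
  relative_interior F a -> Gplus_at mu phi a g ->
  {ae mu, forall z, ~ on_closure phi F z -> g z = 0}.
Proof.
move=> faceF riF Gga; have [[Gg g0] ga] := Gga; have mg := Gg.1.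
have /sigma_finiteP[S [ST ndS fS]] := sigma_finiteT mu.
pose A p (k : nat) : set Z := phi @^-1` rat_box p `&` [set z | 0 < g z] `&` S k `&` [set z | g z <= k%:R].
have mA p (k : nat) : measurable (A p k).
  apply: measurableI; last exact: measurable_set_of_bool (measurable_fun_ler _ _).
  apply: measurableI; last by case: (fS k).
  apply: measurableI; first by apply: measurable_box; exact: harmonic_gt0.
  exact: measurable_set_of_bool (measurable_fun_ltr _ _).
have nA p (k : nat) : avoids F p -> mu.-negligible (A p k).
  move=> Fp; apply/negligibleP => //.
  have mgA : measurable_fun [set: Z] (fun z => g z * \1_(A p k) z).
    by apply: measurable_funM.
  have gA0 z : 0 <= g z * \1_(A p k) z by rewrite mulr_ge0.
  have iA : mu.-integrable [set: Z] (EFin \o (fun z => g z * \1_(A p k) z)).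
    apply: (@bounded_integrable _ _ _ mu (S k) _ k%:R) => //; [by case: (fS k)..|].
    move=> z; rewrite ger0_norm// !indicE.
    have [Az|Az] := pselect (A p k z); last by rewrite memNset// mulr0 mulr_ge0.
    have [[_ Sz] gk] := Az; by rewrite (mem_set Az) (mem_set Sz) !mulr1.
  have [m0|m0] := ltP 0 (\int[mu]_z (g z * \1_(A p k) z))%R.
    exfalso; have Fy := face_mean mphi faceF riF Gga (mA p k) iA m0.
    have := mean_in_box Gg g0 (mA p k) iA m0 (@harmonic_gt0 R p.2) (fun z Az => Az.1.1.1).
    by have := Fp _ Fy; have := @harmonic_gt0 R p.2; lra.
  have : (\int[mu]_z `|(g z * \1_(A p k) z)%:E| = 0)%E.
    under eq_integral do rewrite gee0_abs ?lee_fin//.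
    have iF := integrable_fin_num measurableT iA.
    rewrite -(fineK iF); congr EFin; apply/eqP; rewrite eq_le m0/=.
    by apply: fine_ge0; apply: integral_ge0 => z _; rewrite lee_fin.
  have mE : measurable_fun [set: Z] (fun z => (g z * \1_(A p k) z)%:E).
    exact/measurable_EFinP.
  move/(ae_eq_integral_abs mu measurableT mE) => [N [mN N0 sN]].
  apply/negligibleP => //; exists N; split => // z Az; apply: sN => /= /(_ I) [].
  rewrite indicE mem_set// mulr1 => gz; have := Az.1.1.2.
  by rewrite /= gz ltxx.
pose N n := if unpickle n is Some q then
  (if `[< avoids F q.1 >] then A q.1 q.2 else set0) else set0.
have : mu.-negligible (\bigcup_n N n).
  apply: negligible_bigcup => n; rewrite /N; case: unpickle => [q|]; last exact: negligible_set0.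
  by case: asboolP => [/nA//|_]; exact: negligible_set0.
apply: negligibleS => z /= /not_implyP[/setC_closure[p Fp zp] gz].
have gz0 : 0 < g z by rewrite lt_neqAle eq_sym g0 andbT; apply/eqP.
have : [set: Z] z by []; rewrite ST => -[k1 _ Sk1].
pose k := maxn k1 (Num.truncn (g z)).+1.
exists (pickle (p, k)); first exact: I.
rewrite /N pickleK asboolT//; split; last first.
  have /andP[_ /ltW] := Num.Theory.truncn_itv (g0 z).
  by move=> /le_trans; apply; rewrite ler_nat leq_maxr.
have /subsetPset SS := ndS k1 k (leq_maxl _ _).
by split => //; exact: SS.
Qed.

End FaceSupport.

(** Averaging the supporting line at the intermediate point covers the end point 0 and infinite
    values, which the strict inequality in [in_Gamma] leaves out. *)
Lemma Gamma_convex {R : realType} (gamma : R -> \bar R) (s t l : R) :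
  in_Gamma gamma -> 0 <= s -> 0 <= t -> 0 <= l -> l <= 1 ->
  (gamma (l * s + (1 - l) * t)%R <= l%:E * gamma s + (1 - l)%:E * gamma t)%E.
Proof.
move=> G s0 t0; have gNy := Gamma_gtNy G.
rewrite le_eqVlt => /predU1P[<- _|l0].
  by rewrite mul0r subr0 mul1r add0r mul0e mul1e add0e.
rewrite le_eqVlt => /predU1P[->|l1].
  by rewrite subrr mul1r mul0r addr0 mul1e mul0e adde0.
have [<-|st] := eqVneq s t.
  rewrite -mulrDl addrC subrK mul1r -ge0_muleDl ?lee_fin//; [|lra..].
  by rewrite -EFinD addrC subrK mul1e.
set x := l * s + (1 - l) * t.
have x0 : 0 < x.
  rewrite lt_neqAle eq_sym; apply/andP; split; last by rewrite /x; nra.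
  apply: contraNneq st => x0; apply/eqP; rewrite /x in x0; nra.
have [D _ HD] := rderiv_subgradient G x0.
have sub y : 0 <= y -> ((fine (gamma x) + D * (y - x))%:E <= gamma y)%E.
  move=> y0; have [->|yx] := eqVneq y x; last exact/ltW/HD.
  by rewrite subrr mulr0 addr0 -Gamma_EFin.
have h1 := sub s s0; have h2 := sub t t0.
rewrite (Gamma_EFin G x0).
case: (gamma s) (gNy s) h1 => [us| |]// _; last first.
  rewrite gt0_muley ?lte_fin// addye ?leey//.
  case: (gamma t) (gNy t) => [ut| |]//= _; rewrite gt0_muley// lte_fin; lra.
case: (gamma t) (gNy t) h2 => [ut| |]// _; last first.
  by rewrite gt0_muley ?lte_fin ?subr_gt0// addey ?leey.
rewrite -!EFinM -EFinD !lee_fin => h2 h1; rewrite {2}/x in h1; rewrite {2}/x in h2.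
have : l * (fine (gamma x) + D * (s - x)) <= l * us by rewrite ler_wpM2l// ltW.
have : (1 - l) * (fine (gamma x) + D * (t - x)) <= (1 - l) * ut.
  by rewrite ler_wpM2l// subr_ge0 ltW.
by rewrite /x; nra.
Qed.

Lemma lt_natr_truncn {R : realType} (x : R) (n : nat) : 0 <= x ->
  (Num.truncn x < n)%N -> x < n%:R.
Proof.
move=> /Num.Theory.truncn_itv/andP[_ h] n1; apply: lt_le_trans h _.
by rewrite ler_nat.
Qed.

Section IntegralLemmas.
Context {R : realType} {disp : measure_display} {Z : measurableType disp}.
Variable mu : {sigma_finite_measure set Z -> \bar R}.

Lemma ae_integral_le0 (D : set Z) (f : Z -> \bar R) :
  {ae mu, forall z, D z -> (f z <= 0)%E} -> (\int[mu]_(z in D) f z <= 0)%E.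
Proof.
move=> f0; rewrite integralE.
have -> : (\int[mu]_(z in D) f^\+ z = 0)%E.
  rewrite -(@integral0 _ _ _ mu D); apply: ge0_integral_ae_eq => //.
  by apply: filterS f0 => z fz Dz; rewrite funeposE; exact/max_idPr/fz.
by rewrite sub0e leeNl oppe0; exact: integral_ge0.
Qed.

Lemma null_of_integral_le0 (A : set Z) (f : Z -> R) : measurable A ->
  measurable_fun [set: Z] f -> (forall z, A z -> 0 < f z) ->
  (\int[mu]_z (f z * \1_A z)%:E <= 0)%E -> mu A = 0.
Proof.
move=> mA mf f0 I0.
have mE : measurable_fun [set: Z] (fun z => (f z * \1_A z)%:E).
  by apply/measurable_EFinP; apply: measurable_funM.
have fA0 z : 0 <= f z * \1_A z.
  rewrite indicE; have [Az|Az] := pselect (A z); last by rewrite memNset// mulr0.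
  by rewrite mem_set// mulr1 ltW// f0.
have : (\int[mu]_z `|(f z * \1_A z)%:E| = 0)%E.
  under eq_integral do rewrite gee0_abs ?lee_fin//.
  by apply/eqP; rewrite eq_le I0/=; apply: integral_ge0 => z _; rewrite lee_fin.
move/(ae_eq_integral_abs mu measurableT mE) => [N [mN N0 sN]].
apply/negligibleP => //; exists N; split => // z Az; apply: sN => /= /(_ I) [].
rewrite indicE mem_set// mulr1 => fz; have := f0 z Az.
by rewrite fz ltxx.
Qed.

(** The bounds sum to at most 1, so the series has a finite integral, is finite almost everywhere,
    and its terms tend to 0 there. *)
Lemma ae_cvg0_of_summable (D : set Z) (f : nat -> Z -> \bar R) : measurable D ->
  (forall n, measurable_fun D (f n)) -> (forall n z, D z -> (0 <= f n z)%E) ->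
  (forall n, (\int[mu]_(z in D) f n z <= (1 / (2 ^ n.+1)%:R)%:E)%E) ->
  {ae mu, forall z, D z -> f n z @[n --> \oo] --> 0%E}.
Proof.
move=> mD mf f0 fI.
have mS : measurable_fun D (fun z => (\sum_(n <oo) f n z)%E).
  by apply: ge0_emeasurable_sum => // n z Dz _; exact: f0.
have S0 z : D z -> (0 <= \sum_(n <oo) f n z)%E.
  by move=> Dz; apply: nneseries_ge0 => n _ _; exact: f0.
have Sfin : (\int[mu]_(z in D) \sum_(n <oo) f n z < +oo)%E.
  rewrite integral_nneseries//.
  apply: (@le_lt_trans _ _ (\sum_(n <oo) (1 / (2 ^ n.+1)%:R : R)%:E)%E).
    by apply: lee_nneseries => // n _ _; apply: integral_ge0 => z; exact: f0.
  by apply: le_lt_trans (epsilon_trick0 xpredT ler01) _; rewrite ltry.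
have iS : mu.-integrable D (fun z => (\sum_(n <oo) f n z)%E).
  apply/integrableP; split => //.
  by under eq_integral => z /set_mem Dz do rewrite gee0_abs ?S0//.
have := integrable_ae mD iS; apply: filterS => z Sz Dz.
have Sz' : (\sum_(n <oo) f n z < +oo)%E by rewrite ltey_eq (Sz Dz).
have ct := nneseries_tail_cvg Sz' (fun n _ => f0 n z Dz).
apply: (@squeeze_cvge _ _ _ _ (fun=> 0%E) _ (fun N => \sum_(N <= k <oo) f k z)%E _ _ _ ct).
  apply: nearW => n; rewrite f0//=.
  have := @nneseries_lim_ge R (f ^~ z) xpredT n n.+1 (fun k _ _ => f0 k z Dz).
  by rewrite big_nat1.
exact: cvg_cst.
Qed.

End IntegralLemmas.

(** * Duality *)

Section ExistenceOfSubgradient.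
Context {R : realType} {disp : measure_display} {Z : measurableType disp}.
Variable mu : {sigma_finite_measure set Z -> \bar R}.
Context {d : nat}.
Notation V := 'rV[R]_d.
Variable phi : Z -> V.
Hypothesis mphi : forall i, measurable_fun [set: Z] (fun z => phi z 0 i).
Variable alpha : Z -> R -> \bar R.
Hypothesis B : in_B alpha.
Hypothesis alpha_ge0 : forall z t, (0 <= alpha z t)%E.
Variables (F : set V) (a : V).
Hypotheses (faceF : is_face (moment_cone mu phi) F) (riF : relative_interior F a).
Implicit Types (g k : Z -> R) (c theta x y : V).

Let M := on_closure phi F.

Definition face_integral g := (\int[mu]_(z in M) alpha z (g z))%E.

Definition face_value := ereal_inf [set face_integral g | g in Gplus_at mu phi a].

(** The moment is left free: these are the densities that span the epigraph to be separated. They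
    vanish everywhere off [M], not just almost everywhere, so that moments become integrals over
    [M]. *)
Definition face_admissible g :=
  [/\ Gplus mu phi g, forall z, ~ M z -> g z = 0 & (face_integral g < +oo)%E].

Hypothesis face_value_fin : (face_value < +oo)%E.

Let jm := fine face_value.

Let mM : measurable M.
Proof. exact: measurable_on_closure. Qed.

Lemma measurable_alpha_comp g : measurable_fun [set: Z] g ->
  measurable_fun M (fun z => alpha z (g z)).
Proof. by move=> mg; apply: measurable_funTS; exact: in_B_measurable_comp. Qed.

Lemma face_valueE : face_value = jm%:E.
Proof.
rewrite fineK// ge0_fin_numE//; apply: le_ereal_inf_tmp => _ [g _ <-].
by apply: integral_ge0.
Qed.

Lemma face_value_le g : Gplus_at mu phi a g -> (jm%:E <= face_integral g)%E.
Proof. by move=> Gg; rewrite -face_valueE; apply: ereal_inf_lbound; exists g. Qed.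

Lemma in_G_ae g k : in_G mu phi g -> measurable_fun [set: Z] k ->
  {ae mu, forall z, k z = g z} ->
  in_G mu phi k /\ moment mu phi k = moment mu phi g.
Proof.
move=> [mg ig] mk kg; have mpk i : measurable_fun [set: Z] (fun z => (phi z 0 i * k z)%:E).
  by apply/measurable_EFinP; apply: measurable_funM.
have mpg i : measurable_fun [set: Z] (fun z => (phi z 0 i * g z)%:E).
  by apply/measurable_EFinP; apply: measurable_funM.
split; last first.
  apply/rowP => i; rewrite !mxE /Rintegral; congr fine.
  by apply: ae_eq_integral => //; apply: filterS kg => z -> .
split => // i; apply/integrableP; split => //.
have /integrableP[_] := ig i; congr (_ < _)%E; apply: ge0_ae_eq_integral => //.
- exact: measurableT_comp.
- exact: measurableT_comp.
- by apply: filterS kg => z -> .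
Qed.

Lemma integral_dotp_face c g : Gplus mu phi g -> (forall z, ~ M z -> g z = 0) ->
  (\int[mu]_(z in M) (dotp c (phi z) * g z)%:E = (dotp c (moment mu phi g))%:E)%E.
Proof.
move=> [Gg _] g0; rewrite -integral_dotp// integral_mkcond.
apply: eq_integral => z _; rewrite patchE; case: ifPn => // /negP Mz.
by rewrite g0 ?mulr0// => Mz'; apply: Mz; rewrite inE.
Qed.

(** A density of finite value is altered on a null set: to 1 where [alpha] is infinite, because
    [alpha z] is finite on positive arguments, and to 0 off [M]. The result serves as base point of
    all perturbations. *)
Lemma exists_finite_density : exists g, [/\ face_admissible g,
  moment mu phi g = a & forall z, M z -> alpha z (g z) \is a fin_num].
Proof.
have [_ [g Gga <-] gfin] := ereal_inf_lt face_value_fin.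
have [[Gg g0] ga] := Gga; have mg := Gg.1.
have mag := measurable_alpha_comp mg.
have ia : mu.-integrable M (fun z => alpha z (g z)).
  apply/integrableP; split => //.
  by under eq_integral do rewrite gee0_abs//.
have [N1 [mN1 N10 sN1]] := integrable_ae mM ia.
pose g' z := if z \in M then (if z \in N1 then 1 else g z) else 0.
have mb (A : set Z) : measurable A -> measurable_fun [set: Z] (fun z => z \in A).
  by move=> mA; apply: (@measurable_fun_bool _ _ _ _ true); rewrite setTI preimage_mem_true.
have mg' : measurable_fun [set: Z] g'.
  apply: measurable_fun_ifT => //; first exact: mb.
  by apply: measurable_fun_ifT => //; exact: mb.
have gg' : {ae mu, forall z, g' z = g z}.
  have ae1 : {ae mu, forall z, ~ N1 z} by exists N1; split => // z /= /contrapT.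
  have ae2 := Gplus_at_vanish mphi faceF riF Gga.
  apply: filterS2 ae1 ae2 => z z1 z2; rewrite /g'.
  case: ifPn => [_|/negP Mz]; first by rewrite memNset.
  by apply/esym/z2 => Mz'; apply: Mz; rewrite inE.
have [Gg' mg'E] := in_G_ae Gg mg' gg'.
exists g'; split; last 1 first.
- move=> z Mz; rewrite /g' mem_set//; case: ifPn => [_|/negP nz].
    exact: Gamma_fin (B.2 z) _ ltr01.
  by apply: contrapT => az; apply: nz; rewrite inE; apply: sN1 => /= /(_ Mz).
- split.
  + split => // z; rewrite /g'; case: ifP => // _; case: ifP => // _.
  + by move=> z Mz; rewrite /g' memNset.
  + rewrite /face_integral (@ge0_ae_eq_integral _ _ _ mu M _ (fun z => alpha z (g z)))//.
      exact: measurable_alpha_comp.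
    by apply: filterS gg' => z -> .
- by rewrite mg'E.
Qed.

Lemma face_admissible_conv g k (l : R) : 0 <= l -> l <= 1 ->
  face_admissible g -> face_admissible k ->
  face_admissible (fun z => l * g z + (1 - l) * k z) /\
  (face_integral (fun z => l * g z + (1 - l) * k z)%R <=
   l%:E * face_integral g + (1 - l)%:E * face_integral k)%E.
Proof.
move=> l0 l1 [[Gg g0] gM gfin] [[Gk k0] kM kfin].
have l1' : 0 <= 1 - l by rewrite subr_ge0.
have Gc : in_G mu phi (fun z => l * g z + (1 - l) * k z).
  by apply: in_GD => //; exact: in_GZ.
have mg := measurable_alpha_comp Gg.1; have mk := measurable_alpha_comp Gk.1.
have le : (face_integral (fun z => l * g z + (1 - l) * k z)%R <=
   l%:E * face_integral g + (1 - l)%:E * face_integral k)%E.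
  rewrite /face_integral -!ge0_integralZl//=.
  rewrite -ge0_integralD//; first last.
  - exact: measurable_funeM.
  - by move=> z _; rewrite mule_ge0.
  - exact: measurable_funeM.
  - by move=> z _; rewrite mule_ge0.
  apply: ge0_le_integral => //.
  - by apply: measurable_alpha_comp; exact: Gc.1.
  - by apply: emeasurable_funD; exact: measurable_funeM.
  - by move=> z _; apply: Gamma_convex => //; exact: B.2.
split => //; split => //.
- by split => // z; rewrite addr_ge0// mulr_ge0.
- by move=> z Mz; rewrite gM// kM// !mulr0 addr0.
- apply: le_lt_trans le _; rewrite lte_add_pinfty// lte_mul_pinfty//.
Qed.

End ExistenceOfSubgradient.

(** * Excluding a vertical hyperplane *)

Section Subgradient.
Context {R : realType} {disp : measure_display} {Z : measurableType disp}.
Variable mu : {sigma_finite_measure set Z -> \bar R}.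
Context {d : nat}.
Notation V := 'rV[R]_d.
Variable phi : Z -> V.
Hypothesis mphi : forall i, measurable_fun [set: Z] (fun z => phi z 0 i).
Variable alpha : Z -> R -> \bar R.
Hypothesis B : in_B alpha.
Hypothesis alpha_ge0 : forall z t, (0 <= alpha z t)%E.
Variables (F : set V) (a : V).
Hypotheses (faceF : is_face (moment_cone mu phi) F) (riF : relative_interior F a).
Implicit Types (g k u : Z -> R) (c theta x y : V).

Let M := on_closure phi F.
Let I := face_integral mu phi alpha F.
Let adm := face_admissible mu phi alpha F.

Let mM : measurable M.
Proof. exact: measurable_on_closure. Qed.

Let w c z := dotp c (phi z).

Section NormalVector.
Variables (c : V) (g0 : Z -> R).
Hypothesis Hc : forall g, adm g -> dotp c (moment mu phi g) <= dotp c a.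
Hypotheses (Dg0 : adm g0) (mg0 : moment mu phi g0 = a).

(* Adding u on A to g0 keeps the value finite, while its gain <c, phi> * u is
   positive on A: by the maximality of <c, a>, A must be null. *)
Let perturb_null u (A : set Z) (n : R) : measurable A -> A `<=` M -> (mu A < +oo)%E ->
  measurable_fun [set: Z] u -> (forall z, 0 <= g0 z + u z * \1_A z) ->
  in_G mu phi (fun z => u z * \1_A z) ->
  (forall z, A z -> (alpha z (g0 z + u z)%R <= n%:E)%E) -> 0 <= n ->
  (forall z, A z -> 0 < w c z * u z) -> mu A = 0.
Proof.
move=> mA AM fA muu u0 Gu An n0 wu; have [[Gg0 _] g0M I0] := Dg0.
pose k z := g0 z + u z * \1_A z.
have Gk : in_G mu phi k by exact: in_GD.
have mw : measurable_fun [set: Z] (w c) by exact: measurable_dotp.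
have Dk : adm k.
  split => [//|z Mz|].
    by rewrite /k g0M// indicE memNset ?mulr0 ?addr0// => /AM.
  apply: (@le_lt_trans _ _ (I g0 + \int[mu]_(z in M) (n%:E * (\1_A z)%:E))%E).
    rewrite /I /face_integral -ge0_integralD//; first last.
    - exact/measurable_funeM/measurable_EFinP/measurable_indic.
    - by move=> z _; rewrite mule_ge0// lee_fin.
    - by apply: measurable_alpha_comp => //; exact: Gg0.1.
    apply: ge0_le_integral => //.
    - by apply: measurable_alpha_comp => //; exact: Gk.1.
    - apply: emeasurable_funD; first by apply: measurable_alpha_comp => //; exact: Gg0.1.
      exact/measurable_funeM/measurable_EFinP/measurable_indic.
    move=> z Mz; rewrite /k indicE; have [Az|Az] := pselect (A z).
      rewrite mem_set// mulr1 mule1; apply: le_trans (An z Az) _.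
      by rewrite leeDr.
    by rewrite memNset// mulr0 mule0 addr0 adde0.
  rewrite lte_add_pinfty// ge0_integralZl//; last exact/measurable_EFinP/measurable_indic.
  rewrite integral_indic// lte_mul_pinfty//; apply: le_lt_trans fA.
  by apply: le_measure; rewrite ?inE//; exact: measurableI.
have := Hc Dk; rewrite momentD// mg0 dotpD gerDl -lee_fin -integral_dotp// => h.
apply: (null_of_integral_le0 mA _ wu); first exact: measurable_funM.
by under eq_integral do rewrite -mulrA.
Qed.

Let measurable_w_gt0 : measurable [set z | 0 < w c z].
Proof. by apply: measurable_set_of_bool; apply: measurable_fun_ltr => //; exact: measurable_dotp. Qed.

(** Perturbation by [u = 1] where [<c, phi>] is positive. The pieces [A n] bound the measure, [phi]
    and the new value of [alpha], so the perturbed density is admissible; they exhaust the set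
    because [alpha z] is finite at [g0 z + 1 > 0]. *)
Lemma normal_le0 : {ae mu, forall z, M z -> dotp c (phi z) <= 0}.
Proof.
have [[Gg0 g00] g0M I0] := Dg0.
have /sigma_finiteP[S [ST ndS fS]] := sigma_finiteT mu.
pose A n := M `&` S n `&` [set z | 0 < w c z] `&` [set z | `|phi z - 0| < n.+1%:R] `&`
  [set z | (alpha z (g0 z + 1)%R <= n%:R%:E)%E].
have mA n : measurable (A n).
  apply: measurableI; last first.
    apply: measurable_set_of_bool; apply: measurable_fun_lee => //.
    by apply: in_B_measurable_comp => //; apply: measurable_funD => //; exact: Gg0.1.
  apply: measurableI; last exact: measurable_box.
  apply: measurableI => //; apply: measurableI => //.
  by case: (fS n).
have A0 n : mu.-negligible (A n).
  apply/negligibleP => //; apply: (@perturb_null (fun=> 1) (A n) n%:R) => //.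
  - by move=> z [[[[]]]].
  - apply: le_lt_trans (fS n).2; apply: le_measure; rewrite ?inE//; first by case: (fS n).
    by move=> z [[[[]]]].
  - by move=> z; rewrite addr_ge0// mul1r.
  - apply: (@in_G_bounded _ _ _ _ _ _ mphi (A n) n.+1%:R) => //.
    + by apply: le_lt_trans (fS n).2; apply: le_measure; rewrite ?inE//; [case: (fS n)|move=> z [[[[]]]]].
    + by apply: measurable_funM.
    + move=> z i; rewrite mul1r normrM [X in _ * X]ger0_norm// indicE.
      have [Az|Az] := pselect (A n z); last by rewrite memNset// !mulr0.
      rewrite mem_set// !mulr1; have [[_ pz] _] := Az.
      by apply: ltW; apply: le_lt_trans pz; rewrite subr0 rV_coord_le.
  - by move=> z [].
  - by move=> z [[[_ wz] _] _]; rewrite mulr1.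
apply: negligibleS (negligible_bigcup A0) => z /= /not_implyP[Mz /negP].
rewrite -ltNge => wz; have : [set: Z] z by []; rewrite ST => -[k1 _ Sk1].
have az : alpha z (g0 z + 1) \is a fin_num.
  by apply: (Gamma_fin (B.2 z)); rewrite ltr_wpDl.
pose n := maxn k1 (maxn (Num.truncn `|phi z - 0|) (Num.truncn (fine (alpha z (g0 z + 1)))).+1).
have /subsetPset SS := ndS k1 n (leq_maxl _ _).
exists n; first by [].
split; last first.
  rewrite /= -(fineK az) lee_fin ltW// lt_natr_truncn ?fine_ge0//.
  by rewrite /n !leq_max leqnn !orbT.
split; last first.
  by rewrite /= lt_natr_truncn// ltnS /n !leq_max leqnn !orbT.
by split => //; split => //; exact: SS.
Qed.

(** Perturbation by [u = - g0 / 2]: only half of [g0] is removed, as [alpha z] may be infinite at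
    0. *)
Lemma normal_ge0 : {ae mu, forall z, M z -> 0 < g0 z -> 0 <= dotp c (phi z)}.
Proof.
have [[Gg0 g00] g0M I0] := Dg0.
have /sigma_finiteP[S [ST ndS fS]] := sigma_finiteT mu.
pose A n := M `&` S n `&` [set z | w c z < 0] `&` [set z | 0 < g0 z] `&`
  [set z | (alpha z (g0 z + - (g0 z / 2))%R <= n%:R%:E)%E].
have mh : measurable_fun [set: Z] (fun z => - (g0 z / 2)).
  by apply: measurableT_comp => //; apply: measurable_funM => //; exact: Gg0.1.
have mA n : measurable (A n).
  apply: measurableI; last first.
    apply: measurable_set_of_bool; apply: measurable_fun_lee => //.
    by apply: in_B_measurable_comp => //; apply: measurable_funD => //; exact: Gg0.1.
  apply: measurableI; last first.
    by apply: measurable_set_of_bool; apply: measurable_fun_ltr => //; exact: Gg0.1.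
  apply: measurableI; last first.
    by apply: measurable_set_of_bool; apply: measurable_fun_ltr => //; exact: measurable_dotp.
  by apply: measurableI => //; case: (fS n).
have A0 n : mu.-negligible (A n).
  apply/negligibleP => //; apply: (@perturb_null (fun z => - (g0 z / 2)) (A n) n%:R) => //.
  - by move=> z [[[[]]]].
  - apply: le_lt_trans (fS n).2; apply: le_measure; rewrite ?inE//; first by case: (fS n).
    by move=> z [[[[]]]].
  - move=> z; rewrite indicE; case: (_ \in _); rewrite ?mulr1 ?mulr0 ?addr0//.
    by have := g00 z; rewrite /=; lra.
  - apply: (in_G_le mphi Gg0); first exact: measurable_funM.
    move=> z; rewrite indicE; case: (_ \in _); rewrite ?mulr1 ?mulr0 ?normr0//.
    by rewrite normrN !ger0_norm ?divr_ge0//; have := g00 z; rewrite /=; lra.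
  - by move=> z [].
  - by move=> z [[[_ wz] gz] _]; rewrite /= in wz gz; nra.
apply: negligibleS (negligible_bigcup A0) => z /= /not_implyP[Mz /not_implyP[gz /negP]].
rewrite -ltNge => wz; have : [set: Z] z by []; rewrite ST => -[k1 _ Sk1].
have az : alpha z (g0 z + - (g0 z / 2)) \is a fin_num.
  by apply: (Gamma_fin (B.2 z)); lra.
pose n := maxn k1 (Num.truncn (fine (alpha z (g0 z + - (g0 z / 2))))).+1.
have /subsetPset SS := ndS k1 n (leq_maxl _ _).
exists n; first by [].
split; last first.
  rewrite /= -(fineK az) lee_fin ltW// lt_natr_truncn ?fine_ge0//.
  by rewrite /n !leq_max leqnn !orbT.
by do 3 (split => //); exact: SS.
Qed.

(** A vertical hyperplane with normal [c] contains the moments of all admissible densities, which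
    will contradict proper separation. The two sign lemmas make [<c, phi> g0] vanish almost
    everywhere, so [<c, a> = 0]; a strictly smaller value at [g] would contradict the relative
    interior position of [a]. *)
Lemma normal_eq g : adm g -> dotp c (moment mu phi g) = dotp c a.
Proof.
move=> Dg; have [[Gg0 g00] g0M I0] := Dg0; have [[Gg gg0] gM _] := Dg.
have mw : measurable_fun [set: Z] (w c) by exact: measurable_dotp.
have w0 := normal_le0; have w1 := normal_ge0.
have ca0 : dotp c a = 0.
  apply/eqP; rewrite -mg0 -eqe -integral_dotp//.
  rewrite (@ae_eq_integral _ _ _ mu _ (cst 0%E))//.
  - by rewrite integral0.
  - by apply/measurable_EFinP; apply: measurable_funM => //; exact: Gg0.1.
  apply: filterS2 w0 w1 => z wz0 wz1 _; congr EFin.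
  have [Mz|Mz] := pselect (M z); last by rewrite g0M// mulr0.
  have := g00 z; rewrite le_eqVlt => /predU1P[<-|gz]; first by rewrite mulr0.
  apply/eqP; rewrite mulf_eq0; apply/orP; left.
  by rewrite eq_le wz0// wz1.
apply/eqP; rewrite eq_le Hc//= ca0 leNgt; apply/negP => cg.
have [z Mz wz] : exists2 z, M z & w c z < 0.
  apply: contrapT => nz; move: cg; rewrite ltNge => /negP; apply.
  rewrite -lee_fin -integral_dotp//; apply: integral_ge0 => z _; rewrite lee_fin.
  have [Mz|Mz] := pselect (M z); last by rewrite gM// mulr0.
  by rewrite mulr_ge0// leNgt; apply/negP => wz; apply: nz; exists z.
(* Otherwise some y in F has <c, y> < 0; pushing a away from y inside F then
   produces a moment g2 with <c, moment g2> > 0. *)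
have [y Fy cy] : exists2 y, F y & dotp c y < 0.
  pose K := \sum_(i < d) `|c 0 i|.
  have K0 : 0 < K + 1 by rewrite ltr_wpDl// sumr_ge0.
  have nb : \forall y \near phi z, `|phi z - y| < - w c z / (K + 1).
    apply/nbhs_normP; exists (- w c z / (K + 1)) => //=.
    by rewrite divr_gt0// oppr_gt0.
  have [y [Fy zy]] := Mz _ nb; exists y => //.
  rewrite /= ltr_pdivlMr// in zy.
  have := dotp_norm_le c (y - phi z); rewrite dotpB (distrC y) -/K -/(w c z).
  move: (dotp c y) (w c z) (ler_norm (dotp c y - w c z)) (normr_ge0 (phi z - y)) zy.
  by move: (`|phi z - y|) => n dy wz' h1 h2 h3 h4; nra.
have [e e0 Fe] := relative_interior_extend riF Fy.
have [_ _ FC _] := faceF.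
have [g2 [Gg2 g20] g2E] := FC _ Fe; have [g3 [Gg3 g30] g3E] := FC _ Fy.
have e10 : 0 < 1 + e by lra.
(* [g2] does not have moment [a], but this mixture does; since the mixture vanishes almost
   everywhere off [M], so does [g2], and [normal_le0] applies to it. *)
have Gc : Gplus_at mu phi a (fun z => (1 + e)^-1 * (g2 z + e * g3 z)).
  split; first split.
  - by apply: in_GZ => //; apply: in_GD => //; exact: in_GZ.
  - by move=> x; rewrite mulr_ge0 ?invr_ge0 ?addr_ge0 ?mulr_ge0// ltW.
  - rewrite momentZ//; last by apply: in_GD => //; exact: in_GZ.
    rewrite momentD//; last exact: in_GZ.
    rewrite momentZ// g2E g3E; apply/rowP => i; rewrite !mxE; field.
    by rewrite gt_eqF.
have v2 := Gplus_at_vanish mphi faceF riF Gc.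
have : (\int[mu]_z (w c z * g2 z)%:E <= 0)%E.
  apply: ae_integral_le0; apply: filterS2 w0 v2 => x wx vx _; rewrite lee_fin.
  have [Mx|Mx] := pselect (M x); first by rewrite mulr_le0_ge0// wx.
  have := vx Mx; move/eqP; rewrite mulf_eq0 invr_eq0 (gt_eqF e10)/= => /eqP.
  have := g20 x; have := mulr_ge0 (ltW e0) (g30 x) => h1 h2 h3.
  have -> : g2 x = 0 by lra.
  by rewrite mulr0.
rewrite integral_dotp// g2E lee_fin dotpB dotpZ dotpB ca0.
by nra.
Qed.

End NormalVector.
End Subgradient.

(** * Separation of the epigraph of the value function *)

Section SubgradientExistence.
Context {R : realType} {disp : measure_display} {Z : measurableType disp}.
Variable mu : {sigma_finite_measure set Z -> \bar R}.
Context {d : nat}.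
Notation V := 'rV[R]_d.
Variable phi : Z -> V.
Hypothesis mphi : forall i, measurable_fun [set: Z] (fun z => phi z 0 i).
Variable alpha : Z -> R -> \bar R.
Hypothesis B : in_B alpha.
Hypothesis alpha_ge0 : forall z t, (0 <= alpha z t)%E.
Variables (F : set V) (a : V).
Hypotheses (faceF : is_face (moment_cone mu phi) F) (riF : relative_interior F a).
Hypothesis Jfin : (face_value mu phi alpha F a < +oo)%E.

Let I := face_integral mu phi alpha F.
Let adm := face_admissible mu phi alpha F.
Let jm := fine (face_value mu phi alpha F a).

Let I_ge0 g : (0 <= I g)%E.
Proof. exact: integral_ge0. Qed.

Let I_EFin g : adm g -> I g = (fine (I g))%:E.
Proof. by move=> [_ _ fg]; rewrite fineK// ge0_fin_numE. Qed.

Lemma face_subgradient : exists theta, forall g, adm g ->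
  ((jm - dotp theta a + dotp theta (moment mu phi g))%:E <= I g)%E.
Proof.
have [g0 [Dg0 mg0 fg0]] := exists_finite_density mphi B alpha_ge0 faceF riF Jfin.
(* The cone generated by the epigraph, translated so that its point [(a, jm)] becomes the origin;
   index [d] carries the value coordinate. *)
pose Q : set (nat -> R) := [set v : nat -> R | exists (t : R) (g : Z -> R) (s : R),
  [/\ 0 < t, adm g, (I g <= s%:E)%E,
  (forall i : 'I_d, v i = t * (moment mu phi g - a) 0 i) & v d = t * (s - jm)]].
have Ig0 := I_EFin Dg0.
have jm_le g : Gplus_at mu phi a g -> (jm%:E <= I g)%E.
  exact: face_value_le.
have [|||c [c_le [v [t [g1 [s [t0 Dg1 Is vi vd]]]] c_lt]]] := @cone_proper_separation R d.+1 Q.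
- move=> v v' [t [g [s [t0 Dg Igs vi vd]]]] [t' [g' [s' [t'0 Dg' Igs' vi' vd']]]].
  have tt : 0 < t + t' by lra.
  have l0 : 0 <= t / (t + t') by rewrite divr_ge0 ?ltW.
  have l1 : t / (t + t') <= 1 by rewrite ler_pdivrMr//; lra.
  have l1' : 1 - t / (t + t') = t' / (t + t') by field; rewrite gt_eqF.
  have [Dc Ic] := face_admissible_conv mphi B alpha_ge0 l0 l1 Dg Dg'.
  have [[Gg _] _ _] := Dg; have [[Gg' _] _ _] := Dg'.
  exists (t + t'), (fun z => t / (t + t') * g z + (1 - t / (t + t')) * g' z).
  exists (t / (t + t') * s + (1 - t / (t + t')) * s'); split => //.
  + apply: le_trans Ic _; rewrite [leRHS]EFinD (EFinM _ s) (EFinM _ s').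
    by rewrite leeD// lee_wpmul2l// lee_fin// subr_ge0.
  + move=> i; rewrite vi vi' momentD; [|exact: in_GZ..].
    rewrite !momentZ// !mxE; field; by rewrite gt_eqF.
  + by rewrite vd vd'; field; rewrite gt_eqF.
- move=> l v l0 [t [g [s [t0 Dg Igs vi vd]]]]; exists (l * t), g, s; split => //.
  + exact: mulr_gt0.
  + by move=> i; rewrite vi mulrA.
  + by rewrite vd mulrA.
(* The upward unit vector lies in [Q]; its opposite would yield a density of moment [a] with value
   below [jm]. *)
- pose s := Num.max (fine (I g0)) jm + 1.
  have sI : fine (I g0) <= s by rewrite /s ler_wpDr// le_max lexx.
  have sj : 0 < s - jm.
    by have : jm <= Num.max (fine (I g0)) jm; [rewrite le_max lexx orbT|rewrite /s; lra].
  exists (fun i => if (i < d)%N then 0 else 1).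
    exists (s - jm)^-1, g0, s; split => //.
    + by rewrite invr_gt0.
    + by rewrite Ig0 lee_fin.
    + by move=> i; rewrite ltn_ord mg0 subrr mxE mulr0.
    + by rewrite ltnn mulVf// gt_eqF.
  move=> v [t [g [s' [t0 Dg Igs vi vd]]]]; apply: contrapT => nv.
  have vE i : (i < d.+1)%N -> v i = - (if (i < d)%N then 0 else 1).
    by move=> id; apply/eqP; apply: contrapT => /negP h; apply: nv; exists i.
  have ga : moment mu phi g = a.
    apply/rowP => i; have := vE i (ltnW (ltn_ord i)); rewrite ltn_ord oppr0 vi.
    move/eqP; rewrite mulf_eq0 (gt_eqF t0)/= !mxE subr_eq0 => /eqP.
    by [].
  have [Gg _ _] := Dg.
  have := le_trans (jm_le g (conj Gg ga)) Igs; rewrite lee_fin => js.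
  have := vE d (ltnSn d); rewrite ltnn vd => h.
  have : 0 <= t * (s' - jm) by apply: mulr_ge0; [exact: ltW|rewrite subr_ge0].
  by rewrite h; lra.
pose cv : V := \row_i c i.
have sumE (t' : R) g s' (v' : nat -> R) : (forall i : 'I_d, v' i = t' * (moment mu phi g - a) 0 i) ->
    v' d = t' * (s' - jm) -> \sum_(i < d.+1) c i * v' i =
    t' * (dotp cv (moment mu phi g) - dotp cv a + c d * (s' - jm)).
  move=> h1 h2; rewrite big_ord_recr/= h2 [RHS]mulrDr [c d * (t' * _)]mulrCA; congr (_ + _).
  rewrite -dotpB /dotp mulr_sumr; apply: eq_bigr => i _.
  by rewrite /= h1 [cv _ _]mxE mulrCA.
have key g s' : adm g -> (I g <= s'%:E)%E ->
    dotp cv (moment mu phi g) - dotp cv a + c d * (s' - jm) <= 0.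
  move=> Dg Is'.
  pose v' (i : nat) : R := if insub i is Some j then (moment mu phi g - a) 0 (j : 'I_d) else s' - jm.
  have h1 (i : 'I_d) : v' i = 1 * (moment mu phi g - a) 0 i.
    by rewrite /v' valK mul1r.
  have h2 : v' d = 1 * (s' - jm) by rewrite /v' insubF ?ltnn// mul1r.
  have := c_le v' _; rewrite (sumE _ _ _ _ h1 h2) mul1r; apply.
  by exists 1, g, s'.
have cd0 : c d <= 0.
  pose s' := Num.max (fine (I g0)) jm + 1.
  have sI : fine (I g0) <= s' by rewrite /s' ler_wpDr// le_max lexx.
  have sj : 0 < s' - jm.
    by have : jm <= Num.max (fine (I g0)) jm; [rewrite le_max lexx orbT|rewrite /s'; lra].
  have := key g0 s' Dg0; rewrite Ig0 lee_fin => /(_ sI); rewrite mg0 subrr add0r.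
  by rewrite pmulr_lle0.
move: cd0; rewrite le_eqVlt => /predU1P[cd0|cd0]; last first.
  have dZ x : dotp ((- c d)^-1 *: cv) x = (- c d)^-1 * dotp cv x.
    by rewrite /dotp mulr_sumr; apply: eq_bigr => i _; rewrite mxE mulrA.
  exists ((- c d)^-1 *: cv) => g Dg; rewrite (I_EFin Dg) lee_fin !dZ.
  have := key g (fine (I g)) Dg; rewrite -I_EFin// => /(_ (lexx _)) h.
  have cn : 0 < - c d by rewrite oppr_gt0.
  rewrite -addrA -lerBrDl [X in X <= _]addrC -mulrBr ler_pdivrMl//.
  by lra.
have Hc g : adm g -> dotp cv (moment mu phi g) <= dotp cv a.
  move=> Dg; have := key g (fine (I g)) Dg; rewrite -I_EFin// => /(_ (lexx _)).
  by rewrite cd0 mul0r addr0 subr_le0.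
(* With [c d = 0] the functional would vanish at the point [v] too, where proper separation made it
   negative. *)
have eq1 := normal_eq mphi B alpha_ge0 faceF riF Hc Dg0 mg0 Dg1.
by move: c_lt; rewrite (sumE _ _ _ _ vi vd) eq1 cd0 subrr mul0r addr0 mulr0 ltxx.
Qed.
End SubgradientExistence.

(** * Weak and strong duality on the face *)

Section Duality.
Context {R : realType} {disp : measure_display} {Z : measurableType disp}.
Variable mu : {sigma_finite_measure set Z -> \bar R}.
Context {d : nat}.
Notation V := 'rV[R]_d.
Variable phi : Z -> V.
Hypothesis mphi : forall i, measurable_fun [set: Z] (fun z => phi z 0 i).
Variable alpha : Z -> R -> \bar R.
Hypothesis B : in_B alpha.
Hypothesis alpha_ge0 : forall z t, (0 <= alpha z t)%E.
Variables (F : set V) (a : V).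
Hypotheses (faceF : is_face (moment_cone mu phi) F) (riF : relative_interior F a).
Hypothesis Jfin : (face_value mu phi alpha F a < +oo)%E.
Implicit Types (g : Z -> R) (theta : V).

Let M := on_closure phi F.
Let I := face_integral mu phi alpha F.
Let jm := fine (face_value mu phi alpha F a).

Let mM : measurable M.
Proof. exact: measurable_on_closure. Qed.

Let JE : face_value mu phi alpha F a = jm%:E.
Proof. exact: face_valueE. Qed.

Lemma integrable_dotp_face theta g : Gplus_at mu phi a g ->
  mu.-integrable M (fun z => (dotp theta (phi z) * g z)%:E).
Proof.
move=> [[Gg _] _]; apply: (@integrableS _ _ _ mu [set: Z]) => //.
exact: integrable_dotp.
Qed.

Lemma integral_dotp_face_ae theta g : Gplus_at mu phi a g ->
  (\int[mu]_(z in M) (dotp theta (phi z) * g z)%:E = (dotp theta a)%:E)%E.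
Proof.
move=> Gg; have [[Gg1 g0] ga] := Gg.
rewrite -ga -integral_dotp// integral_mkcond.
have mf : measurable_fun [set: Z] (fun z => (dotp theta (phi z) * g z)%:E).
  by apply/measurable_EFinP; apply: measurable_funM; [exact: measurable_dotp|exact: Gg1.1].
apply: ae_eq_integral => //.
  by apply/(measurable_restrictT _ mM); exact: measurable_funTS.
apply: filterS (Gplus_at_vanish mphi faceF riF Gg) => z gz _.
rewrite patchE; case: ifPn => // /negP Mz.
by rewrite gz ?mulr0// => Mz'; apply: Mz; rewrite inE.
Qed.

Lemma integrable_face g : Gplus_at mu phi a g -> (I g < +oo)%E ->
  mu.-integrable M (fun z => alpha z (g z)).
Proof.
move=> [[Gg _] _] gfin; apply/integrableP; split.
  by apply: measurable_alpha_comp => //; exact: Gg.1.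
by under eq_integral do rewrite gee0_abs//.
Qed.

Let gain theta (z : Z) (t : R) := ((dotp theta (phi z) * t)%:E - alpha z t)%E.

Lemma integral_gain theta g : Gplus_at mu phi a g -> (I g < +oo)%E ->
  mu.-integrable M (fun z => gain theta z (g z)) /\
  (\int[mu]_(z in M) gain theta z (g z) = (dotp theta a)%:E - I g)%E.
Proof.
move=> Gg gfin; have i1 := integrable_dotp_face theta Gg.
have i2 := integrable_face Gg gfin.
split; first exact: integrableB.
by rewrite integralB// integral_dotp_face_ae.
Qed.

Let p theta z := conjugate (alpha z) (dotp theta (phi z)).

Lemma measurable_conj_face theta : measurable_fun M (p theta).
Proof. by apply: measurable_funTS; apply: measurable_conjugate => //; exact: measurable_dotp. Qed.

Let exists_fin : exists2 g, Gplus_at mu phi a g & (I g < +oo)%E.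
Proof. by have [_ [g Gg <-] gfin] := ereal_inf_lt Jfin; exists g. Qed.

(** A value below [+oo] bounds the positive part. The negative part is dominated by that of the gain
    of any density of finite value, because the conjugate dominates the gain. *)
Lemma dual_K_lty theta : (dual_K mu phi F alpha theta < +oo)%E ->
  mu.-integrable M (p theta) /\
  dual_K mu phi F alpha theta = (\int[mu]_(z in M) p theta z)%E.
Proof.
rewrite /dual_K /cintegral; case: ifPn => // pfin Kfin; split => //.
have mp := measurable_conj_face theta.
have [g Gg gfin] := exists_fin.
have [ig _] := integral_gain theta Gg gfin.
have pf : (\int[mu]_(z in M) (p theta)^\+ z < +oo)%E by rewrite ltey.
have nf : (\int[mu]_(z in M) (p theta)^\- z < +oo)%E.
  have ign : (\int[mu]_(z in M) (fun z => gain theta z (g z))^\- z < +oo)%E.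
    exact: (integral_funeneg_lt_pinfty mM ig).
  apply: le_lt_trans ign.
  apply: ge0_le_integral => //.
  - exact: measurable_funeneg.
  - by apply: measurable_funeneg; case/integrableP: ig.
  - move=> z _; rewrite !funenegE le_max2// leeN2; exact: conjugate_ge.
apply/integrableP; split => //.
rewrite (eq_integral (fun z => ((p theta)^\+ z + (p theta)^\- z)%E)); last first.
  by move=> z _; rewrite -[LHS]/((abse \o p theta) z) fune_abse.
rewrite ge0_integralD//; [|exact: measurable_funepos|exact: measurable_funeneg].
exact: lte_add_pinfty.
Qed.

Lemma weak_duality theta : (dual_objective mu phi F alpha a theta <= jm%:E)%E.
Proof.
rewrite -JE; apply: le_ereal_inf_tmp => _ [g Gg <-].
have [gfin|] := ltP (I g) +oo%E; last first.
  by rewrite leye_eq => /eqP gy; rewrite -/I -/(I g) gy leey.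
have [Kfin|] := ltP (dual_K mu phi F alpha theta) +oo%E; last first.
  by rewrite leye_eq /dual_objective => /eqP ->; rewrite leNye.
have [ip KE] := dual_K_lty Kfin; have [ig gE] := integral_gain theta Gg gfin.
have : ((dotp theta a)%:E - I g <= dual_K mu phi F alpha theta)%E.
  by rewrite -gE KE; apply: le_integral => // z _; exact: conjugate_ge.
have Ifin : I g \is a fin_num by rewrite ge0_fin_numE//; apply: integral_ge0.
rewrite /dual_objective -/(I g) KE.
have := integrable_fin_num mM ip.
rewrite -(fineK Ifin); case: (\int[mu]_(z in M) _)%E => [x| |]//= _.
by rewrite -!EFinD !lee_fin; lra.
Qed.

Lemma strong_duality : exists theta,
  (dual_K mu phi F alpha theta <= (dotp theta a - jm)%:E)%E.
Proof.
have [theta Htheta] := face_subgradient mphi B alpha_ge0 faceF riF Jfin.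
exists theta; set r := fun z => dotp theta (phi z).
have [g0 [Dg0 mg0 fg0]] := exists_finite_density mphi B alpha_ge0 faceF riF Jfin.
have [[Gg0 g00] g0M Ig0] := Dg0.
have Gg0a : Gplus_at mu phi a g0 by [].
have mg : measurable_fun [set: Z] g0 := Gg0.1.
have mr : measurable_fun [set: Z] r by exact: measurable_dotp.
have [ig gE] := integral_gain theta Gg0a Ig0.
(* v n z maximizes the gain over g0 z and the first n positive rationals; cut
   down to the exhausting sets A n it is a density of finite moment, to which
   the subgradient inequality applies. *)
pose v := fix v n z := if n is n'.+1 then
  (if (gain theta z (v n' z) < gain theta z (posrat n'))%E then posrat n' else v n' z)
  else g0 z.
have mgain k : measurable_fun [set: Z] k -> measurable_fun [set: Z] (fun z => gain theta z (k z)).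
  move=> mk; apply: emeasurable_funB; last exact: in_B_measurable_comp.
  by apply/measurable_EFinP; exact: measurable_funM.
have mv n : measurable_fun [set: Z] (v n).
  elim: n => [//|n IH]; apply: measurable_fun_ifT => //.
  by apply: measurable_fun_lte; exact: mgain.
have v_ge0 n z : 0 <= v n z.
  by elim: n => [|n IH] /=; [exact: g00|case: ifP => // _; exact/ltW/posrat_gt0].
have v_le n z : v n z <= g0 z + \sum_(i < n) posrat i.
  elim: n => [|n IH] /=; first by rewrite big_ord0 addr0.
  have s0 : 0 <= \sum_(i < n) @posrat R i by apply: sumr_ge0 => i _; exact/ltW/posrat_gt0.
  have := g00 z; have := @posrat_gt0 R n; rewrite big_ord_recr/=.
  by case: ifP => _; lra.
have gain_step n z : (gain theta z (v n z) <= gain theta z (v n.+1 z))%E.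
  by rewrite /=; case: ifPn => [/ltW|].
have gain_posrat n z : (gain theta z (posrat n) <= gain theta z (v n.+1 z))%E.
  by rewrite /=; case: ifPn => //; rewrite -leNgt.
have gain_nd z : nondecreasing_seq (fun n => gain theta z (v n z)).
  by apply/nondecreasing_seqP => n; exact: gain_step.
have /sigma_finiteP[S [ST ndS fS]] := sigma_finiteT mu.
pose A n := M `&` S n `&` [set z | `|phi z - 0| < n.+1%:R].
have mA n : measurable (A n).
  apply: measurableI; last exact: measurable_box.
  by apply: measurableI => //; case: (fS n).
have A_nd n m z : (n <= m)%N -> A n z -> A m z.
  move=> nm [[Mz Sz] pz]; have /subsetPset SS := ndS n m nm.
  split; first by split => //; exact: SS.
  by apply: lt_le_trans pz _; rewrite ler_nat ltnS.
have A_ex z : M z -> exists N, forall n, (N <= n)%N -> A n z.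
  move=> Mz; have : [set: Z] z by []; rewrite ST => -[k1 _ Sk1].
  exists (maxn k1 (Num.truncn `|phi z - 0|)) => n; rewrite geq_max => /andP[k1n tn].
  split; last by rewrite /= lt_natr_truncn.
  by split => //; have /subsetPset SS := ndS k1 n k1n; exact: SS.
pose v' n z := if z \in A n then v n z else g0 z.
have mv' n : measurable_fun [set: Z] (v' n).
  apply: measurable_fun_ifT => //.
  by apply: (@measurable_fun_bool _ _ _ _ true); rewrite setTI preimage_mem_true.
have Gv' n : in_G mu phi (v' n).
  pose C := \sum_(i < n) @posrat R i.
  have C0 : 0 <= C by apply: sumr_ge0 => i _; exact/ltW/posrat_gt0.
  have GC : in_G mu phi (fun z => g0 z + C * \1_(A n) z).
    apply: in_GD => //; apply: in_GZ => //.
    have fA : (mu (A n) < +oo)%E.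
      apply: le_lt_trans (fS n).2; apply: le_measure; rewrite ?inE//; first by case: (fS n).
      by move=> z [[]].
    apply: (@in_G_bounded _ _ _ _ _ _ mphi (A n) n.+1%:R) => // z i.
    rewrite normrM [X in _ * X]ger0_norm// indicE.
    have [Az|Az] := pselect (A n z); last by rewrite memNset// !mulr0.
    rewrite mem_set// !mulr1; have [_ pz] := Az.
    by apply: ltW; apply: le_lt_trans pz; rewrite subr0 rV_coord_le.
  apply: (in_G_le mphi GC) => // z; rewrite !ger0_norm.
  - by rewrite /v' indicE; case: ifPn => Az; rewrite ?(negbTE Az) ?Az /= ?mulr1 ?mulr0 ?addr0.
  - by rewrite addr_ge0// mulr_ge0.
  - by rewrite /v'; case: ifP.
have gain_v' n z : (gain theta z (g0 z) <= gain theta z (v' n z))%E.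
  by rewrite /v'; case: ifP => // _; exact: (gain_nd z 0%N n).
have gain_lty z t : (gain theta z t < +oo)%E.
  by rewrite /gain; have := alpha_ge0 z t; case: (alpha z t) => [x| |]//= _; rewrite ltry.
have gain_fin n z : M z -> gain theta z (v' n z) \is a fin_num.
  move=> Mz; rewrite fin_numE; apply/andP; split; last by rewrite lt_eqF// gain_lty.
  rewrite gt_eqF//; apply: lt_le_trans (gain_v' n z).
  by have := fg0 z Mz; rewrite /gain; case: (alpha z (g0 z)) => [x| |]//= _; rewrite ltNyr.
have idot n : mu.-integrable M (fun z => (r z * v' n z)%:E).
  by apply: (@integrableS _ _ _ mu [set: Z]) => //; exact: integrable_dotp.
(* As [v' n] gains at least as much as [g0], [alpha z (v' n z)] is at most [r z * v' n z] minus the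
   gain of [g0], which is integrable; this makes [v' n] admissible. *)
have ia n : mu.-integrable M (fun z => alpha z (v' n z)).
  have i0 : mu.-integrable M
     (fun z => ((r z * v' n z)%:E - gain theta z (g0 z))%E).
    exact: integrableB.
  apply: (le_integrable mM _ _ i0); first exact: measurable_alpha_comp.
  move=> z Mz; rewrite gee0_abs//; apply: le_trans (lee_abs _).
  have := gain_v' n z; have := gain_fin n z Mz; rewrite /gain -/(r z).
  have := fg0 z Mz; case: (alpha z (g0 z)) => [x| |]//= _.
  case: (alpha z (v' n z)) => [y| |]//= _.
  by rewrite !lee_fin; lra.
have Dv' n : face_admissible mu phi alpha F (v' n).
  split; [split => // z|move=> z Mz|].
  - by rewrite /v'; case: ifP.
  - by rewrite /v' memNset ?g0M// => -[[]].
  - have /integrableP[_] := ia n; rewrite /face_integral.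
    by under eq_integral do rewrite gee0_abs//.
have gain_int n : mu.-integrable M (fun z => gain theta z (v' n z)) /\
    (\int[mu]_(z in M) gain theta z (v' n z) <= (dotp theta a - jm)%:E)%E.
  split; first exact: integrableB.
  rewrite /gain integralB//; have [Gp Mp Ip] := Dv' n; rewrite integral_dotp_face//.
  have := Htheta _ (Dv' n).
  rewrite -/(face_integral mu phi alpha F (v' n)).
  have : face_integral mu phi alpha F (v' n) \is a fin_num.
    by rewrite ge0_fin_numE//; exact: integral_ge0.
  case: (face_integral mu phi alpha F (v' n)) => [x| |]//= _.
  by rewrite -!EFinD !lee_fin -/jm; lra.
(* Subtracting the integrable base gain makes the increasing sequence nonnegative, as monotone
   convergence requires. *)
pose b z := gain theta z (g0 z).
have bfin z : M z -> b z \is a fin_num.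
  by move=> Mz; rewrite /b /gain; have := fg0 z Mz; case: (alpha z (g0 z)).
pose wn n z := (gain theta z (v' n z) - b z)%E.
have wn0 n z : M z -> (0 <= wn n z)%E.
  by move=> Mz; rewrite /wn sube_ge0 ?bfin//; exact: gain_v'.
have mwn n : measurable_fun M (wn n).
  by apply: measurable_funTS; apply: emeasurable_funB; exact: mgain.
have wn_nd z : M z -> nondecreasing_seq (wn ^~ z).
  move=> Mz n m nm; rewrite /wn leeD2r//.
  rewrite /v'; case: ifPn => [/set_mem Az|nAz].
    by rewrite mem_set; [exact: gain_nd|exact: A_nd Az].
  by case: ifP => // _; exact: (gain_nd z 0%N m).
have wn_cvg z : M z -> wn n z @[n --> \oo] --> (p theta z - b z)%E.
  move=> Mz; apply: cvgeB; [by rewrite fin_num_adde_defl// fin_numN bfin| |exact: cvg_cst].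
  have [N HN] := A_ex z Mz.
  have -> : p theta z = ereal_sup (range (fun n => gain theta z (v n z))).
    apply/eqP; rewrite eq_le; apply/andP; split.
      rewrite /p conjugate_posrat; last exact: B.2.
      apply: ge_ereal_sup => _ [n _ <-]; apply: le_trans (gain_posrat n z) _.
      by apply: ereal_sup_ubound; exists n.+1.
    by apply: ge_ereal_sup => _ [n _ <-]; exact: conjugate_ge.
  apply: cvg_trans (ereal_nondecreasing_cvgn (gain_nd z)).
  apply: near_eq_cvg; exists N => // n /= Nn.
  by rewrite /v' mem_set//; exact: HN.
have bE : (\int[mu]_(z in M) b z = (dotp theta a)%:E - I g0)%E by exact: gE.
have Ig0fin : I g0 \is a fin_num by rewrite ge0_fin_numE//; exact: integral_ge0.
have wnI n : (\int[mu]_(z in M) wn n z <= (fine (I g0) - jm)%:E)%E.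
  have [i1 i2] := gain_int n; rewrite /wn integralB// bE -(fineK Ig0fin)/=.
  move: i2; have := integrable_fin_num mM i1.
  case: (\int[mu]_(z in M) gain theta z (v' n z))%E => [x| |]//= _.
  by rewrite -!EFinD !lee_fin; lra.
have limE : (\int[mu]_(z in M) (p theta z - b z) <= (fine (I g0) - jm)%:E)%E.
  have cI := cvg_monotone_convergence mM mwn wn0 wn_nd.
  rewrite (eq_integral (fun z => limn (wn ^~ z))); last first.
    by move=> z /set_mem Mz; apply/esym/cvg_lim => //; exact: wn_cvg.
  by apply: (cvge_to_le (cI mu)); apply: nearW.
have pb0 z : M z -> (0 <= p theta z - b z)%E.
  by move=> Mz; rewrite sube_ge0 ?bfin//; exact: conjugate_ge.
have ib : mu.-integrable M b by [].
have ipb : mu.-integrable M (fun z => (p theta z - b z)%E).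
  apply/integrableP; split.
    by apply: emeasurable_funB; [exact: measurable_conj_face|case/integrableP: ib].
  under eq_integral => z /set_mem Mz do rewrite gee0_abs ?pb0//.
  by apply: le_lt_trans limE _; rewrite ltry.
have pE z : M z -> p theta z = ((p theta z - b z) + b z)%E.
  by move=> Mz; rewrite subeK// bfin.
have ip : mu.-integrable M (p theta).
  have := integrableD mM ipb ib; apply: eq_integrable => // z /set_mem Mz /=.
  by rewrite -pE.
rewrite /dual_K /cintegral ifF; last first.
  by apply/negbTE; rewrite -ltey; exact: (integral_funepos_lt_pinfty mM ip).
rewrite (eq_integral (fun z => (p theta z - b z) + b z)%E); last first.
  by move=> z /set_mem Mz; exact: pE.
rewrite integralD// bE -(fineK Ig0fin).
move: limE; have := integrable_fin_num mM ipb.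
case: (\int[mu]_(z in M) (p theta z - b z))%E => [x| |]//= _.
by rewrite -!EFinD !lee_fin; lra.
Qed.

Lemma dual_valueE : dual_value mu phi F alpha a = jm%:E.
Proof.
apply/eqP; rewrite eq_le; apply/andP; split.
  by apply: ge_ereal_sup => _ [theta _ <-]; exact: weak_duality.
have [theta Kle] := strong_duality.
apply: (@le_trans _ _ (dual_objective mu phi F alpha a theta)); last first.
  by apply: ereal_sup_ubound; exists theta.
rewrite /dual_objective; move: Kle; case: (dual_K _ _ _ _ _) => [x| |]//=; last by rewrite leey.
by rewrite -EFinB !lee_fin; lra.
Qed.

Lemma dual_solution_exists : exists theta, dual_solution mu phi F alpha a theta.
Proof.
have [theta Kle] := strong_duality; exists theta; split; first by rewrite dual_valueE.
apply/eqP; rewrite eq_le dual_valueE weak_duality/=.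
rewrite /dual_objective; move: Kle; case: (dual_K _ _ _ _ _) => [x| |]//=; last by rewrite leey.
by rewrite -EFinB !lee_fin; lra.
Qed.

Lemma dual_solution_K theta : dual_solution mu phi F alpha a theta ->
  mu.-integrable M (p theta) /\
  (\int[mu]_(z in M) p theta z = (dotp theta a - jm)%:E)%E.
Proof.
move=> [_]; rewrite dual_valueE /dual_objective => obj.
have KE : dual_K mu phi F alpha theta = (dotp theta a - jm)%:E.
  move: obj; case: (dual_K _ _ _ _ _) => [x| |]//=.
  by rewrite -EFinB => -[<-]; congr EFin; lra.
have [|ip <-] := @dual_K_lty theta; first by rewrite KE ltry.
by split.
Qed.

End Duality.

(** * Pointwise duality at a fixed [z] *)

Section PointwiseDuality.
Context {R : realType}.
Implicit Types (gamma : R -> \bar R) (f r s t : R).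

Lemma rderiv_ge_slope gamma f r : in_Gamma gamma -> 0 <= f -> gamma f \is a fin_num ->
  (forall s, f <= s -> ((fine (gamma f) + r * (s - f))%:E <= gamma s)%E) ->
  (r%:E <= rderiv gamma f)%E.
Proof.
move=> G; rewrite le_eqVlt => /predU1P[<- gf H|f0 gf H].
  apply: (cvge_to_ge (rderiv0_cvg G)); near=> u.
  have u0 : 0 < u by near: u; exact: nbhs_right_gt.
  have [D -> HD] := rderiv_subgradient G u0.
  have nu : 0 != u by rewrite lt_eqF.
  have := HD 0 (lexx 0) nu; have := H u (ltW u0).
  rewrite -(fineK gf) (Gamma_EFin G u0) !lee_fin lte_fin /= => h1 h2.
  have : r * u < D * u by lra.
  by rewrite ltr_pM2r// => /ltW.
have [D [-> cD _]] := rderivP G f0; rewrite lee_fin.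
rewrite -(cvg_lim _ cD)//; apply: limr_ge; first by apply/cvg_ex; exists D.
near=> e; have e0 : 0 < e by near: e; exact: nbhs_right_gt.
have fe0 : 0 < f + e by lra.
have fe : f <= f + e by lra.
have := H (f + e) fe; rewrite (Gamma_EFin G fe0) lee_fin => h.
by rewrite /diff_quot ler_pdivlMl//; lra.
Unshelve. all: by end_near. Qed.

Lemma lderiv_le_slope gamma f r : in_Gamma gamma -> 0 < f ->
  (forall s, 0 < s -> s <= f -> ((fine (gamma f) + r * (s - f))%:E <= gamma s)%E) ->
  (lderiv gamma f <= r%:E)%E.
Proof.
move=> G f0 H; have [D [-> cD _]] := lderivP G f0; rewrite lee_fin.
rewrite -(cvg_lim _ cD)//; apply: limr_le; first by apply/cvg_ex; exists D.
near=> e; have e0 : e < 0 by near: e; exact: nbhs_left_lt.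
have ef : - f < e by near: e; apply: nbhs_left_gt; rewrite oppr_lt0.
have fe0 : 0 < f + e by lra.
have fe : f + e <= f by lra.
have := H (f + e) fe0 fe; rewrite (Gamma_EFin G fe0) lee_fin => h.
by rewrite /diff_quot ler_ndivrMl//; lra.
Unshelve. all: by end_near. Qed.

(* f attains the supremum defining conjugate gamma r. *)
Definition conjugate_point gamma r f :=
  [/\ 0 <= f, gamma f \is a fin_num & forall s, 0 <= s ->
    ((fine (gamma f) + r * (s - f))%:E <= gamma s)%E].

(** At [f = 0] the right derivative is bounded below by the slope [r] and above by the right
    derivative at 1; so [Delta] at [f] is given by its first formula. *)
Lemma conjugate_point_rderiv gamma r f : in_Gamma gamma -> conjugate_point gamma r f ->
  rderiv gamma f \is a fin_num.
Proof.
move=> G [f0 gf H].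
have : (r%:E <= rderiv gamma f)%E.
  by apply: rderiv_ge_slope => // s fs; apply: H; exact: le_trans fs.
have := f0; rewrite le_eqVlt => /predU1P[<-|fp _]; last exact: rderiv_fin.
have := rderiv0_le G ltr01; have := rderiv_fin G ltr01.
by case: (rderiv gamma 1) => [x| |]//= _; case: (rderiv gamma 0).
Qed.

(** [r] lies between the one-sided derivatives at [f] (at [f = 0], below the right one), and the
    sign of [t - f] selects the one for which the product is nonnegative. The identity is algebra
    once the conjugate is [r f - gamma f]. *)
Lemma pythagoras_pointwise gamma r f t : in_Gamma gamma -> conjugate_point gamma r f ->
  0 <= t ->
  (0 <= (sgn_deriv gamma (t - f)%R f - r%:E) * (t - f)%:E)%E /\
  (conjugate gamma r - ((r * t)%:E - gamma t) =
    Delta gamma t f + (sgn_deriv gamma (t - f)%R f - r%:E) * (t - f)%:E)%E.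
Proof.
move=> G cf t0; have fr := conjugate_point_rderiv G cf; have [f0 gf H] := cf.
have [D [DE _ _]] := sgn_derivP G t0 f0 fr.
rewrite (conjugate_max G gf H) (DeltaE t0 f0 fr) DE -EFinB -EFinM lee_fin; split.
  have [ft|tf] := leP f t.
    move: DE; rewrite /sgn_deriv subr_ge0 ft => DE.
    have : (r%:E <= rderiv gamma f)%E.
      by apply: rderiv_ge_slope => // s fs; apply: H; exact: le_trans fs.
    by rewrite DE lee_fin => rD; rewrite mulr_ge0// subr_ge0.
  have fp : 0 < f := le_lt_trans t0 tf.
  move: DE; rewrite /sgn_deriv subr_ge0 leNgt tf/= => DE.
  have : (lderiv gamma f <= r%:E)%E.
    by apply: lderiv_le_slope => // s s0 _; apply: H; exact: ltW.
  by rewrite DE lee_fin => Dr; rewrite mulr_le0// subr_le0 // ltW.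
rewrite -[in RHS](fineK gf) -!EFinM; have := Gamma_gtNy G t.
case: (gamma t) => [x| |]//= _.
by rewrite -!EFinD; congr EFin; ring.
Qed.

(** A vanishing defect alone would let [t n] escape to infinity. The bound on [gamma] along a
    subsequence, with the growth of [gamma] away from its minimizer [k], confines that subsequence
    and yields a maximizer [f]; the growth about [f] then makes the whole sequence converge. *)
Lemma minimizing_seq_cvg gamma r k (t : nat -> R) (C : R) : in_Gamma gamma ->
  (forall s, (0 <= gamma s)%E) -> 0 <= k -> gamma k = 0%E ->
  (forall n, 0 <= t n) -> conjugate gamma r \is a fin_num ->
  (conjugate gamma r - ((r * t n)%:E - gamma (t n)))%E @[n --> \oo] --> 0%E ->
  (forall N, exists2 n, (N <= n)%N & (gamma (t n) <= C%:E)%E) ->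
  exists2 f, conjugate_point gamma r f & t n @[n --> \oo] --> f.
Proof.
move=> G g0 k0 gk t0 cfin ct Ct.
have [c cE] : exists c, conjugate gamma r = c%:E by exists (fine (conjugate gamma r)); rewrite fineK.
have psiP n e : (conjugate gamma r - ((r * t n)%:E - gamma (t n)) < e%:E)%E ->
    (gamma (t n) < (r * t n - c + e)%:E)%E.
  rewrite cE; case: (gamma (t n)) (Gamma_gtNy G (t n)) => [x| |]//= _.
  by rewrite -!EFinD !lte_fin; lra.
have ev e : 0 < e -> exists N, forall n, (N <= n)%N -> (gamma (t n) < (r * t n - c + e)%:E)%E.
  move=> e0; have e0' : (0%R < e%:E)%E by rewrite lte_fin.
  have [N _ HN] := ct _ (open_ereal_lt' e0').
  by exists N => n Nn; apply: psiP; exact: HN.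
have gkf : gamma k \is a fin_num by rewrite gk.
have [|m m0 Hm] := @Gamma_growth _ gamma k 0 1 G k0 ltr01 gkf.
  by move=> s _; rewrite gk mul0r addr0; exact: g0.
(* From distance 1 on, [gamma s] is at least [m |s - k|], so [gamma s <= C] keeps [s] below [b]. *)
pose b := k + 1 + `|C| / m.
have bP s : 0 <= s -> (gamma s <= C%:E)%E -> s <= b.
  move=> s0 gs; rewrite leNgt; apply/negP => bs.
  have C0 : 0 <= `|C| / m by rewrite divr_ge0// ltW.
  have {}bs : k + 1 + `|C| / m < s := bs.
  have sk0 : 0 <= s - k by lra.
  have sk : 1 <= `|s - k| by rewrite (ger0_norm sk0); lra.
  have := le_trans (Hm s s0 sk) gs.
  rewrite gk mul0r add0r add0r lee_fin (ger0_norm sk0) => h.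
  have : `|C| < m * (s - k) by rewrite mulrC -ltr_pdivrMr//; lra.
  by have := ler_norm C; lra.
have [f f0 fle] : exists2 f, 0 <= f & (gamma f <= (r * f + - c)%:E)%E.
  apply: (@Gamma_minimizer _ gamma r (- c) b G) => e e0.
  have [N HN] := ev e e0; have [n Nn gn] := Ct N.
  exists (t n); split => //; first exact: bP.
  exact/ltW/HN.
have gf : gamma f \is a fin_num.
  by rewrite ge0_fin_numE// (le_lt_trans fle)// ltry.
have ge s : (c%:E >= (r * s)%:E - gamma s)%E by rewrite -cE; exact: conjugate_ge.
have fE : fine (gamma f) = r * f - c.
  have := ge f; rewrite -(fineK gf) -EFinB lee_fin => h.
  by move: fle; rewrite -(fineK gf) lee_fin => h'; lra.
have cf : conjugate_point gamma r f.
  split => // s _; rewrite fE; have := ge s.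
  case: (gamma s) (Gamma_gtNy G s) => [x| |]//= _; last by rewrite leey.
  by rewrite -EFinB !lee_fin; lra.
exists f => //; apply/cvgrPdist_lt => e e0.
have [_ _ fmax] := cf; have [n n0 Hn] := Gamma_growth G f0 e0 gf fmax.
have ne0 : 0 < n * e by exact: mulr_gt0.
have [N HN] := ev _ ne0; exists N => // i /= Ni.
rewrite ltNge distrC; apply/negP => ef.
have := le_lt_trans (Hn _ (t0 i) ef) (HN i Ni); rewrite lte_fin fE.
by nra.
Qed.

End PointwiseDuality.

(** * The effective dual solution and the Pythagorean identity *)

Section EffectiveDualSolution.
Context {R : realType} {disp : measure_display} {Z : measurableType disp}.
Variable mu : {sigma_finite_measure set Z -> \bar R}.
Context {d : nat}.
Notation V := 'rV[R]_d.
Variable phi : Z -> V.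
Hypothesis mphi : forall i, measurable_fun [set: Z] (fun z => phi z 0 i).
Variable alpha : Z -> R -> \bar R.
Hypothesis B : in_B alpha.
Hypothesis alpha_ge0 : forall z t, (0 <= alpha z t)%E.
Variable h : Z -> R.
Hypotheses (h_ge0 : forall z, 0 <= h z) (alpha_h : forall z, alpha z (h z) = 0%E).
Variables (F : set V) (a : V).
Hypotheses (faceF : is_face (moment_cone mu phi) F) (riF : relative_interior F a).
Hypothesis Jfin : (face_value mu phi alpha F a < +oo)%E.
Implicit Types (g k : Z -> R) (theta : V).

Let M := on_closure phi F.
Let I := face_integral mu phi alpha F.
Let jm := fine (face_value mu phi alpha F a).

Let mM : measurable M.
Proof. exact: measurable_on_closure. Qed.

Lemma minimizing_sequence : exists gn : nat -> Z -> R, forall n,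
  Gplus_at mu phi a (gn n) /\ (I (gn n) <= (jm + 1 / (2 ^ n.+1)%:R)%:E)%E.
Proof.
suff /choice[gn Hgn] : forall n, exists g, Gplus_at mu phi a g /\
  (I g <= (jm + 1 / (2 ^ n.+1)%:R)%:E)%E by exists gn.
move=> n; have : (face_value mu phi alpha F a < (jm + 1 / (2 ^ n.+1)%:R)%:E)%E.
  rewrite (face_valueE _ Jfin)// lte_fin ltrDl divr_gt0// ltr0n expn_gt0//.
by move=> /ereal_inf_lt[_ [g Gg <-] /ltW gle]; exists g.
Qed.

Variable gn : nat -> Z -> R.
Hypothesis Hgn : forall n,
  Gplus_at mu phi a (gn n) /\ (I (gn n) <= (jm + 1 / (2 ^ n.+1)%:R)%:E)%E.

Let mgn n : measurable_fun [set: Z] (gn n).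
Proof. by have [[[[]]]] := Hgn n. Qed.

Let gn_ge0 n z : 0 <= gn n z.
Proof. by have [[[_]]] := Hgn n. Qed.

Let Ign n : (I (gn n) < +oo)%E.
Proof. by apply: le_lt_trans (Hgn n).2 _; rewrite ltry. Qed.

(** By Fatou's lemma the lower limit of [alpha] along the sequence has integral at most [jm + 1],
    hence is finite almost everywhere. *)
Lemma frequently_bounded : {ae mu, forall z, M z ->
  exists C : R, forall N, exists2 n, (N <= n)%N & (alpha z (gn n z) <= C%:E)%E}.
Proof.
pose u n z := alpha z (gn n z).
have mu_ n : measurable_fun M (u n) by exact: measurable_alpha_comp.
have le : (\int[mu]_(z in M) limn_einf (u ^~ z) <= (jm + 1)%:E)%E.
  apply: le_trans (fatou _ mM mu_ _) _; first by move=> n z _; exact: alpha_ge0.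
  rewrite limn_einf_lim; apply: lime_le; first exact: is_cvg_einfs.
  apply: nearW => n; apply: le_trans (ereal_inf_lbound _) (_ : I (gn n) <= _)%E.
    by exists n => //=.
  apply: le_trans (Hgn n).2 _; rewrite lee_fin lerD2l ler_pdivrMr ?ltr0n ?expn_gt0//.
  by rewrite mul1r ler1n expn_gt0.
have me : measurable_fun M (fun z => limn_einf (u ^~ z)).
  rewrite /limn_einf; apply: measurableT_comp => //.
  apply: (@measurable_fun_limn_esup _ _ _ _ (fun n z => (- u n z)%E)) => n.
  by apply: measurableT_comp => //; exact: mu_.
have e0 z : (0 <= limn_einf (u ^~ z))%E.
  rewrite limn_einf_lim; apply: lime_ge; first exact: is_cvg_einfs.
  by apply: nearW => n; apply: le_ereal_inf_tmp => _ [m _ <-]; exact: alpha_ge0.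
have ie : mu.-integrable M (fun z => limn_einf (u ^~ z)).
  apply/integrableP; split => //; under eq_integral do rewrite gee0_abs//.
  by apply: le_lt_trans le _; rewrite ltry.
have := integrable_ae mM ie; apply: filterS => z zfin Mz.
exists (fine (limn_einf (u ^~ z)) + 1) => N; apply: contrapT => nN.
have : ((fine (limn_einf (u ^~ z)) + 1)%:E <= limn_einf (u ^~ z))%E.
  rewrite [leRHS]limn_einf_lim; apply: (@le_trans _ _ (einfs (u ^~ z) N)).
    apply: le_ereal_inf_tmp => _ [m /= Nm <-]; rewrite leNgt; apply/negP => um.
    by apply: nN; exists m => //; exact: ltW.
  apply: (@le_trans _ _ (ereal_sup (range (einfs (u ^~ z))))).
    by apply: ereal_sup_ubound; exists N.
  by rewrite (cvg_lim _ (@cvg_einfs_sup _ (u ^~ z))).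
by rewrite -[leRHS](fineK (zfin Mz)) lee_fin; lra.
Qed.

Let r theta z := dotp theta (phi z).
(* The defect in Young's inequality, whose integral is the excess of the primal
   value of g over the optimum. *)
Let gap theta g z := (conjugate (alpha z) (r theta z) -
  ((r theta z * g z)%:E - alpha z (g z)))%E.

(** Where [alpha z (g z)] is [+oo] the conjugate must differ from [-oo]; the point [h z], of value
    0, ensures this. *)
Lemma gap_ge0 theta g z : (0 <= gap theta g z)%E.
Proof.
rewrite /gap; have := conjugate_ge (alpha z) (r theta z) (g z).
have := alpha_ge0 z (g z); case: (alpha z (g z)) => [x| |]//= _.
  rewrite -EFinB; case: (conjugate (alpha z) (r theta z)) => [y| |]//=.
  - by rewrite -EFinB !lee_fin; lra.
  - by rewrite addye ?leey.
have := conjugate_ge (alpha z) (r theta z) (h z); rewrite alpha_h sube0 => + _.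
by case: (conjugate (alpha z) (r theta z)) => //= *; rewrite addey ?leey.
Qed.

Lemma measurable_gap theta g : measurable_fun [set: Z] g ->
  measurable_fun M (gap theta g).
Proof.
move=> mg; apply: emeasurable_funB; first exact: measurable_conj_face.
apply: measurable_funTS; apply: emeasurable_funB; last exact: in_B_measurable_comp.
by apply/measurable_EFinP; apply: measurable_funM => //; exact: measurable_dotp.
Qed.

Lemma integral_gap theta g : dual_solution mu phi F alpha a theta ->
  Gplus_at mu phi a g -> (I g < +oo)%E ->
  (I g = jm%:E + \int[mu]_(z in M) gap theta g z)%E.
Proof.
move=> dth Gg gfin.
have [ip pE] := dual_solution_K mphi B alpha_ge0 faceF riF Jfin dth.
have [ig gE] := integral_gain mphi B alpha_ge0 faceF riF theta Gg gfin.
rewrite /gap integralB// gE pE -/jm.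
have : I g \is a fin_num by rewrite ge0_fin_numE//; exact: integral_ge0.
rewrite /I; case: (face_integral _ _ _ _ _) => [x| |]//= _.
by rewrite -!EFinD; congr EFin; ring.
Qed.

Lemma gap_cvg0 theta : dual_solution mu phi F alpha a theta ->
  {ae mu, forall z, M z -> gap theta (gn n) z @[n --> \oo] --> 0%E}.
Proof.
move=> dth; apply: ae_cvg0_of_summable => //.
- by move=> n; exact: measurable_gap.
- by move=> n z _; exact: gap_ge0.
- move=> n; have := integral_gap dth (Hgn n).1 (Ign n).
  have := (Hgn n).2 => /[swap] ->; have := @integral_ge0 _ _ _ mu M (gap theta (gn n)) (fun z _ => gap_ge0 theta (gn n) z).
  case: (\int[mu]_(z in M) gap theta (gn n) z)%E => [x| |]//= _.
  by rewrite -EFinD !lee_fin lerD2l.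
Qed.

Lemma dual_limit theta : dual_solution mu phi F alpha a theta ->
  {ae mu, forall z, M z -> exists2 f, conjugate_point (alpha z) (r theta z) f &
    gn n z @[n --> \oo] --> f}.
Proof.
move=> dth; have [ip _] := dual_solution_K mphi B alpha_ge0 faceF riF Jfin dth.
have pf := integrable_ae mM ip.
apply: filterS3 pf frequently_bounded (gap_cvg0 dth) => z pz bz gz Mz.
have [C HC] := bz Mz.
exact: (minimizing_seq_cvg (B.2 z) (alpha_ge0 z) (h_ge0 z) (alpha_h z)
  (fun n => gn_ge0 n z) (pz Mz) (gz Mz) HC).
Qed.

(** An upper limit is measurable without knowledge of convergence, and no dual solution enters, so
    one function serves every [theta]. *)
Definition limit_density z := fine (limn_esup (fun n => (gn n z)%:E)).

Lemma measurable_limit_density : measurable_fun [set: Z] limit_density.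
Proof.
apply: measurableT_comp => //; apply: measurable_fun_limn_esup => n.
by apply/measurable_EFinP.
Qed.

Lemma limit_densityE z f : gn n z @[n --> \oo] --> f -> limit_density z = f.
Proof.
move=> gf; have cE : (gn n z)%:E @[n --> \oo] --> f%:E.
  by apply: cvg_EFin => //; exact: nearW.
by rewrite /limit_density is_cvg_limn_esupE ?(cvg_lim _ cE)//; apply/cvg_ex; exists f%:E.
Qed.

(** On [M] the limit maximizes [r t - alpha z t], so the conjugate is differentiable at [r] with the
    limit as derivative; off [M] both functions are 0. *)
Lemma limit_density_ae theta : dual_solution mu phi F alpha a theta ->
  {ae mu, forall z, [/\ gn n z @[n --> \oo] --> limit_density z,
    (M z -> conjugate_point (alpha z) (r theta z) (limit_density z)),
    (~ M z -> limit_density z = 0) &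
    dual_density phi F alpha theta z = limit_density z]}.
Proof.
move=> dth.
have v : {ae mu, forall z, forall n, ~ M z -> gn n z = 0}.
  by apply/ae_foralln => n; exact: (Gplus_at_vanish mphi faceF riF (Hgn n).1).
apply: filterS2 v (dual_limit dth) => z vz lz.
have [Mz|Mz] := pselect (M z).
  have [f cf gf] := lz Mz; rewrite (limit_densityE gf); split => //.
  have [f0 gfin fmax] := cf.
  have [de dE] := conjugate_derivable (B.2 z) f0 gfin fmax.
  by rewrite /dual_density asboolT.
have c0 : gn n z @[n --> \oo] --> (0 : R).
  by apply: cvg_near_cst; apply: nearW => n; exact: vz.
rewrite (limit_densityE c0); split => //.
by rewrite /dual_density asboolF// => -[].
Qed.

End EffectiveDualSolution.

(** * The identity and the uniqueness of the density *)

Section PythagoreanIdentity.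
Context {R : realType} {disp : measure_display} {Z : measurableType disp}.
Variable mu : {sigma_finite_measure set Z -> \bar R}.
Context {d : nat}.
Notation V := 'rV[R]_d.
Variable phi : Z -> V.
Hypothesis mphi : forall i, measurable_fun [set: Z] (fun z => phi z 0 i).
Variable alpha : Z -> R -> \bar R.
Hypothesis B : in_B alpha.
Hypothesis alpha_ge0 : forall z t, (0 <= alpha z t)%E.
Variable h : Z -> R.
Hypotheses (h_ge0 : forall z, 0 <= h z) (alpha_h : forall z, alpha z (h z) = 0%E).
Variables (F : set V) (a : V).
Hypotheses (faceF : is_face (moment_cone mu phi) F) (riF : relative_interior F a).
Implicit Types (g k : Z -> R) (theta : V).

Let M := on_closure phi F.
Let I := face_integral mu phi alpha F.
Let jm := fine (face_value mu phi alpha F a).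
Let A g : \bar R := (\int[mu]_z alpha z (g z))%E.
(* Densities in the class vanish off M, so this part does not depend on g. *)
Let rest : \bar R := (\int[mu]_(z in ~` M) alpha z 0)%E.

Let mM : measurable M.
Proof. exact: measurable_on_closure. Qed.

Lemma integral_face_split g : Gplus_at mu phi a g -> A g = (I g + rest)%E.
Proof.
move=> Gg; have [[[mg _] g0] _] := Gg.
rewrite /A -(setUv M) ge0_integral_setU//.
- congr (_ + _)%E; apply: ge0_integral_ae_eq => //.
  have := Gplus_at_vanish mphi faceF riF Gg.
  by apply: filterS => z gz Mz; rewrite gz.
- exact: measurableC.
- by apply: measurable_funTS; exact: in_B_measurable_comp.
- exact/disj_setPCl.
Qed.

Hypothesis Afin : (ereal_inf [set A g | g in Gplus_at mu phi a] < +oo)%E.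

Let rest_ge0 : (0 <= rest)%E.
Proof. exact: integral_ge0. Qed.

Let I_ge0 g : (0 <= I g)%E.
Proof. exact: integral_ge0. Qed.

Lemma face_value_lty : (face_value mu phi alpha F a < +oo)%E.
Proof.
have /ereal_inf_lt[_ [g Gg <-]] := Afin.
rewrite integral_face_split// => gfin.
apply: le_lt_trans (ereal_inf_lbound _) (le_lt_trans _ gfin); first by exists g.
exact: leeDl.
Qed.

Let Jfin := face_value_lty.

Lemma rest_fin_num : rest \is a fin_num.
Proof.
rewrite ge0_fin_numE//; have /ereal_inf_lt[_ [g Gg <-]] := Afin.
rewrite integral_face_split// => gfin.
exact: le_lt_trans (leeDr _ (I_ge0 g)) gfin.
Qed.

Lemma total_valueE :
  ereal_inf [set A g | g in Gplus_at mu phi a] = (jm%:E + rest)%E.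
Proof.
apply/eqP; rewrite eq_le; apply/andP; split; last first.
  apply: le_ereal_inf_tmp => _ [g Gg <-]; rewrite integral_face_split//.
  by apply: leeD => //; exact: face_value_le.
apply/lee_addgt0Pr => e e0.
have : (face_value mu phi alpha F a < (jm + e)%:E)%E.
  by rewrite (face_valueE _ Jfin)// lte_fin ltrDl.
move=> /ereal_inf_lt[_ [g Gg <-] /ltW gle].
apply: le_trans (ereal_inf_lbound _) _; first by exists g.
by rewrite integral_face_split// (addeAC jm%:E) leeD2r.
Qed.

Variable gn : nat -> Z -> R.
Hypothesis Hgn : forall n,
  Gplus_at mu phi a (gn n) /\ (I (gn n) <= (jm + 1 / (2 ^ n.+1)%:R)%:E)%E.
Variable theta : V.
Hypothesis dth : dual_solution mu phi F alpha a theta.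

Let gt := limit_density gn.
Let mgt : measurable_fun [set: Z] gt := measurable_limit_density Hgn.
Let aegt := limit_density_ae mphi B alpha_ge0 h_ge0 alpha_h faceF riF Jfin Hgn dth.

Let r z := dotp theta (phi z).
Let gap g z := (conjugate (alpha z) (r z) - ((r z * g z)%:E - alpha z (g z)))%E.
Let D g z := Delta (alpha z) (g z) (gt z).
(** The absolute value makes this nonnegative everywhere; almost everywhere on [M] it is the
    correction integrand. *)
Let cc g z :=
  `|(sgn_deriv (alpha z) (g z - gt z)%R (gt z) - (r z)%:E) * (g z - gt z)%:E|%E.

Let mD g : measurable_fun [set: Z] g -> measurable_fun [set: Z] (D g).
Proof. by move=> mg; exact: measurable_Delta. Qed.

Let mcc g : measurable_fun [set: Z] g -> measurable_fun [set: Z] (cc g).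
Proof.
move=> mg; apply: measurableT_comp => //; apply: emeasurable_funM.
  apply: emeasurable_funB; last by apply/measurable_EFinP; exact: measurable_dotp.
  by apply: measurable_sgn_deriv => //; exact: measurable_funB.
by apply/measurable_EFinP; exact: measurable_funB.
Qed.

Let D_ge0 g z : (0 <= D g z)%E.
Proof. exact: Delta_ge0 (B.2 z). Qed.

Let cc_ge0 g z : (0 <= cc g z)%E.
Proof. exact: abse_ge0. Qed.

Let gap_g0 g z : (0 <= gap g z)%E.
Proof. exact: (gap_ge0 phi alpha_ge0 alpha_h theta g z). Qed.

Lemma correctionE g : Gplus_at mu phi a g ->
  correction mu phi F alpha theta g = (\int[mu]_(z in M) cc g z)%E.
Proof.
move=> [[[mg _] g0] _]; apply: cintegral_ge0 => //.
move: aegt; apply: filterS => z [_ cp _ ->] Mz.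
by rewrite /cc gee0_abs// (pythagoras_pointwise (B.2 z) (cp Mz) (g0 z)).1.
Qed.

(** For infinite value: [alpha] at [g] is the gap plus [r g] minus the conjugate, and the last two
    are integrable on [M], so a gap of finite integral would make the value finite. *)
Lemma integral_gapE g : Gplus_at mu phi a g ->
  I g = (jm%:E + \int[mu]_(z in M) gap g z)%E.
Proof.
move=> Gg; have [gfin|] := ltP (I g) +oo%E.
  exact: (integral_gap mphi B alpha_ge0 faceF riF Jfin dth Gg gfin).
rewrite leye_eq => /eqP gy; rewrite gy; suff -> : (\int[mu]_(z in M) gap g z = +oo)%E by [].
have [[[mg _] g0] _] := Gg.
apply/eqP; rewrite -leye_eq leNgt; apply/negP => gapy.
have igap : mu.-integrable M (gap g).
  apply/integrableP; split; first exact: measurable_gap.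
  by under eq_integral do rewrite gee0_abs//.
have [ip _] := dual_solution_K mphi B alpha_ge0 faceF riF Jfin dth.
have irg := @integrable_dotp_face _ _ _ mu _ phi mphi F a theta g Gg.
have := integrableD mM igap (integrableB mM irg ip) => /integrableP[_].
apply/negP; rewrite -leNgt -gy le_eqVlt; apply/orP; left; apply/eqP.
apply: ge0_integral_ae_eq => //.
have := integrable_ae mM ip; apply: filterS => z /[swap] Mz /(_ Mz).
rewrite -/(r z) /gap; have := alpha_ge0 z (g z).
case: (conjugate (alpha z) (r z)) => [p| |]//.
case: (alpha z (g z)) => [x| |]//= x0 _.
by congr EFin; rewrite ger0_norm; move: x0; rewrite lee_fin; lra.
Qed.

Lemma face_pythagoras g : Gplus_at mu phi a g ->
  I g = (jm%:E + \int[mu]_(z in M) D g z + correction mu phi F alpha theta g)%E.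
Proof.
move=> Gg; rewrite integral_gapE// correctionE// -addeA; congr (_ + _)%E.
have [[[mg _] g0] _] := Gg.
rewrite -ge0_integralD//; last 2 first.
- by apply: measurable_funTS; exact: mD.
- by apply: measurable_funTS; exact: mcc.
apply: ge0_integral_ae_eq => //.
  by move=> z _; exact: adde_ge0.
move: aegt; apply: filterS => z [_ cp _ _] Mz.
have [c0 gE] := pythagoras_pointwise (B.2 z) (cp Mz) (g0 z).
by rewrite /cc gee0_abs.
Qed.

Lemma integral_Delta_face g : Gplus_at mu phi a g ->
  (\int[mu]_z D g z = \int[mu]_(z in M) D g z)%E.
Proof.
move=> Gg; have [[[mg _] g0] _] := Gg.
rewrite -(setUv M) ge0_integral_setU//.
- rewrite [X in (_ + X)%E](_ : _ = 0%E) ?adde0//.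
  rewrite -(@integral0 _ _ _ mu (~` M)); apply: ge0_integral_ae_eq => //.
  have := Gplus_at_vanish mphi faceF riF Gg.
  move: aegt; apply: filterS2 => z [_ _ vt _] vg Mz.
  by rewrite /D /gt vt// vg// Delta_diag//; exact: B.2.
- exact: measurableC.
- by apply: measurable_funTS; exact: mD.
- exact/disj_setPCl.
Qed.

Lemma total_pythagoras g : Gplus_at mu phi a g ->
  A g = (ereal_inf [set A g | g in Gplus_at mu phi a] +
    \int[mu]_z D g z + correction mu phi F alpha theta g)%E.
Proof.
move=> Gg; rewrite total_valueE integral_face_split// face_pythagoras//.
by rewrite integral_Delta_face// (addeAC jm%:E rest) [RHS]addeAC.
Qed.

(* Along a minimizing sequence the identity bounds the Bregman distances to k
   by a summable sequence, so they vanish a.e. in the limit and identify k. *)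
Lemma total_pythagoras_unique k : measurable_fun [set: Z] k ->
  (forall g, Gplus_at mu phi a g ->
    A g = (ereal_inf [set A g | g in Gplus_at mu phi a] +
      \int[mu]_z Delta (alpha z) (g z) (k z) +
      correction mu phi F alpha theta g)%E) ->
  k = gt %[ae mu].
Proof.
move=> mk kP.
have mDk n : measurable_fun [set: Z] (fun z => Delta (alpha z) (gn n z) (k z)).
  by have [[[[mg _] _] _] _] := Hgn n; exact: measurable_Delta.
have Dk_ge0 n z : (0 <= Delta (alpha z) (gn n z) (k z))%E by exact: Delta_ge0 (B.2 z).
have /ae_cvg0_of_summable : forall n,
    (\int[mu]_z Delta (alpha z) (gn n z) (k z) <= (1 / (2 ^ n.+1)%:R)%:E)%E.
  move=> n; have [Gg gle] := Hgn n.
  have := kP _ Gg; rewrite total_valueE integral_face_split// correctionE//.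
  have : (0 <= \int[mu]_(z in M) cc (gn n) z)%E by exact: integral_ge0.
  have : (0 <= \int[mu]_z Delta (alpha z) (gn n z) (k z))%E by exact: integral_ge0.
  move: gle (I_ge0 (gn n)) rest_fin_num.
  case: (I (gn n)) => [x| |]//; case: rest => [c| |]//.
  case: (\int[mu]_z _)%E => [y| |]//; case: (\int[mu]_(z in M) _)%E => [w| |]//=.
  by rewrite !lee_fin => + _ _ + + [] => *; lra.
move=> /(_ measurableT mDk (fun n z _ => Dk_ge0 n z)).
move: aegt; apply: filterS2 => z [gz _ _ _] kz _; move/(_ Logic.I): kz => kz.
have k0 : 0 <= k z.
  rewrite leNgt; apply/negP => k0.
  move: kz; under eq_fun do rewrite /Delta k0 orbT.
  by move=> /cvg_lim => /(_ (@ereal_hausdorff R))/eqP; rewrite lim_cst//; exact: ereal_hausdorff.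
apply/eqP; rewrite -subr_eq0 -normr_le0 leNgt; apply/negP => e0.
set e := `|_| in e0.
(* If [k z] and the limit were at distance [e > 0], then [gn n z] would eventually stay at least
   [e / 2] away from [k z], where [Delta] is bounded below by a positive constant. *)
have e20 : 0 < e / 2 by rewrite divr_gt0.
have [m m0 mP] := Delta_growth (B.2 z) k0 e20.
have me0 : (0%R < (m * (e / 2))%:E)%E by rewrite lte_fin mulr_gt0.
have [N1 _ HN1] := kz _ (open_ereal_lt' me0).
move/cvgrPdist_lt: gz => /(_ _ e20)[N2 _ HN2].
pose n := maxn N1 N2.
have gnk := HN1 n (leq_maxl _ _); have gnt := HN2 n (leq_maxr _ _).
have [[[_ gn0] _] _] := Hgn n.
move: gnk; apply/negP; rewrite -leNgt mP//.
have := ler_distD (gn n z) (gt z) (k z); rewrite -/(gt z) in gnt *.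
rewrite (distrC (gt z) (k z)) -/e => ?; lra.
Qed.

End PythagoreanIdentity.

(** [gt] is quantified before [theta], so all dual solutions have almost everywhere the same
    density. Uniqueness is stated for each dual solution separately, since the correction is
    computed from it. *)
Theorem theorem8p3 (R : realType) (disp : measure_display)
    (Z : measurableType disp) (mu : {sigma_finite_measure set Z -> \bar R})
    (d : nat) (phi : Z -> 'rV[R]_d)
    (mphi : forall i : 'I_d, measurable_fun [set: Z] (fun z => phi z 0 i))
    (beta : Z -> R -> \bar R) (betaB : in_B beta)
    (h : Z -> R) (mh : measurable_fun [set: Z] h) (h_ge0 : forall z, 0 <= h z)
    (h_gt0 : forall z, rderiv (beta z) 0 = -oo%E -> 0 < h z)
    (a : 'rV[R]_d) (adom : domJ mu phi beta h a) :
  let beta_h := recenter beta h in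
  let F := face_at mu phi a in
  let pythagorean theta k := forall g, Gplus_at mu phi a g ->
    bregman mu beta g h =
    (value_J mu phi beta h a + bregman mu beta_h g k
       + correction mu phi F beta_h theta g)%E in
  (exists theta, dual_solution mu phi F beta_h a theta) /\
  exists gt : Z -> R, measurable_fun [set: Z] gt /\
    forall theta, dual_solution mu phi F beta_h a theta ->
      [/\ pythagorean theta gt,
          forall k : Z -> R, measurable_fun [set: Z] k ->
            pythagorean theta k -> k = gt %[ae mu] &
          gt = dual_density phi F beta_h theta %[ae mu]].
Proof.
move=> beta_h F pythagorean.
have B : in_B beta_h by exact: recenter_in_B.
have b_ge0 z t : (0 <= beta_h z t)%E by exact: Delta_ge0 (betaB.2 z).
have b_h z : beta_h z (h z) = 0%E by apply: Delta_diag => //; exact: betaB.2.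
have bregE g : bregman mu beta g h = (\int[mu]_z beta_h z (g z))%E.
  by apply: cintegral_ge0 => //; exact: aeW.
have bregkE g k : bregman mu beta_h g k =
    (\int[mu]_z Delta (beta_h z) (g z) (k z))%E.
  by apply: cintegral_ge0; [move=> z _; exact: Delta_ge0 (B.2 z)|exact: aeW].
have JE : value_J mu phi beta h a =
    ereal_inf [set (\int[mu]_z beta_h z (g z))%E | g in Gplus_at mu phi a].
  by rewrite /value_J; congr ereal_inf; apply: eq_imagel => g _; exact: bregE.
have Afin : (ereal_inf [set (\int[mu]_z beta_h z (g z))%E |
    g in Gplus_at mu phi a] < +oo)%E by rewrite -JE.
have [faceF riF] : is_face (moment_cone mu phi) F /\ relative_interior F a.
  apply: face_of_pointP.
  - exact: moment_coneD.
  - exact: moment_coneZ.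
  - by have /ereal_inf_lt[_ [g [Gg ga] _] _] := Afin; exists g.
have Jfin := face_value_lty mphi B b_ge0 faceF riF Afin.
split; first exact: (dual_solution_exists mphi B b_ge0 faceF riF Jfin).
have [gn Hgn] := minimizing_sequence b_ge0 Jfin.
exists (limit_density gn); split; first exact: (measurable_limit_density Hgn).
move=> theta dth; split.
- move=> g Gg; rewrite bregE JE bregkE.
  exact: (total_pythagoras mphi B b_ge0 h_ge0 b_h faceF riF Afin Hgn dth Gg).
- move=> k mk kP.
  apply: (total_pythagoras_unique mphi B b_ge0 h_ge0 b_h faceF riF Afin Hgn dth mk).
  by move=> g Gg; rewrite -bregE -JE -bregkE; exact: kP.
- have := limit_density_ae mphi B b_ge0 h_ge0 b_h faceF riF Jfin Hgn dth.
  by apply: filterS => z [_ _ _ ->].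
Qed.
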